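(* Let $X=(x_n)_{n\ge1}$ be a sequence of positive real numbers such that there is a constant $c>0$ with $x_{n+1}-x_n\ge c$ for all $n$, and suppose $E^{*}(X,N)=N^{2+o(1)}$. Suppose that for some $\kappa\ge2$ and some $m(\kappa)$ the Riemann zeta function satisfies, for every $\varepsilon>0$, $$\frac1T\int_0^T\big|\zeta(\tfrac12+it)\big|^{\kappa}\,dt\ll T^{m(\kappa)+\varepsilon}.$$ Then for almost every $\alpha\in\mathbb{R}$, $$\delta_{\min}^{\alpha}(N)<\frac{1}{N^{\frac{2\kappa-4}{\kappa+4m(\kappa)}-o(1)}},$$ where the rate of decay of the $o(1)$ term depends on $\alpha$.
   Context: For $x\in\mathbb{R}$, $\|x\|=\min_{k\in\mathbb{Z}}|x-k|$. For $\alpha\in\mathbb{R}$, $\delta_{\min}^{\alpha}(N)=\min\{\|\alpha x_m-\alpha x_n\| : 1\le m,n\le N,\ m\ne n\}$. The additive energy is $E^{*}(X,N)=\#\{(n_1,n_2,n_3,n_4)\in[1,N]^4 : |x_{n_1}+x_{n_2}-x_{n_3}-x_{n_4}|<1\}$; $E^{*}(X,N)=N^{2+o(1)}$ means $E^*(X,N)\ll_\varepsilon N^{2+\varepsilon}$ for every $\varepsilon>0$. The notation $\frac{1}{N^{\kappa'-o(1)}}$ means $N^{-(\kappa'-f_\alpha(N))}$ for some function $f_\alpha(N)\to0$, the inequality holding for all sufficiently large $N$. *)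

(* Defs.v *)
From HB Require Import structures.
From mathcomp Require Import all_boot all_order all_algebra.
From mathcomp Require Import all_classical all_reals all_analysis.
Set Implicit Arguments. Unset Strict Implicit. Unset Printing Implicit Defensive.
Import Order.TTheory GRing.Theory Num.Theory.
Import numFieldNormedType.Exports.
Local Open Scope classical_set_scope.
Local Open Scope ring_scope.

Section Defs.
Variable R : realType.

Definition dist_int (y : R) : R := inf [set `|y - k%:~R| | k in [set: int]].

Definition delta_min (x : nat -> R) (alpha : R) (N : nat) : R :=
  inf [set dist_int (alpha * x mn.1 - alpha * x mn.2) |
       mn in [set mn : nat * nat | [/\ (1 <= mn.1 <= N)%N, (1 <= mn.2 <= N)%N
                                     & mn.1 <> mn.2]]].

Definition add_energy (x : nat -> R) (N : nat) : nat :=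
  #|[set t : 'I_N * 'I_N * 'I_N * 'I_N |
     `| x (t.1.1.1).+1 + x (t.1.1.2).+1 - x (t.1.2).+1 - x (t.2).+1 | < 1]|.

(* Riemann zeta on the critical line, zeta(1/2+it), via the Dirichlet eta
   function: zeta(s) = eta(s) / (1 - 2^(1-s)), eta(s) = sum_{n>=1} (-1)^(n-1) n^(-s),
   convergent for Re s > 0.  With s = 1/2 + it, n^(-s) = n^(-1/2)(cos(t ln n) - i sin(t ln n)). *)
Definition eta_crit_re_partial (t : R) (n : nat) : R :=
  \sum_(1 <= k < n.+1) (-1) ^+ k.-1 * (k%:R `^ (- 2^-1)) * cos (t * ln k%:R).
Definition eta_crit_im_partial (t : R) (n : nat) : R :=
  - \sum_(1 <= k < n.+1) (-1) ^+ k.-1 * (k%:R `^ (- 2^-1)) * sin (t * ln k%:R).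
Definition eta_crit_re (t : R) : R := lim (eta_crit_re_partial t @ \oo).
Definition eta_crit_im (t : R) : R := lim (eta_crit_im_partial t @ \oo).

(* |1 - 2^(1-s)|^2 for s = 1/2 + it, where 2^(1-s) = sqrt 2 (cos(t ln 2) - i sin(t ln 2)) *)
Definition eta_factor_sqnorm (t : R) : R :=
  (1 - Num.sqrt 2 * cos (t * ln 2)) ^+ 2 + (Num.sqrt 2 * sin (t * ln 2)) ^+ 2.

Definition zeta_crit_abs (t : R) : R :=
  Num.sqrt (eta_crit_re t ^+ 2 + eta_crit_im t ^+ 2) / Num.sqrt (eta_factor_sqnorm t).

End Defs.

(* Main.v *)
(* Suppose that every difference (x_a - x_b) alpha with a, b <= N is at distance
   at least N^(-th+eps) from the integers.  By the energy bound the differences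
   x_a - x_b visit at least N^(2-2e) unit cells [n, n+1) with n >= N^th; keep one
   difference y_n per cell.  A normalised power of the Fejer kernel is a
   nonnegative cosine polynomial of length about N^(th-eps/2) which, far from the
   integers, is so small that its non-constant part is <= -1/4.  Summing over the
   y_n, the sum over j, n of c_j cos(2 pi j y_n alpha) is at most -M/4, where M
   is the number of cells, so that the measure of the bad alpha in a bounded
   interval is at most a constant times M^(-2) times the second moment of this
   sum.  After a dyadic decomposition in j, the large sieve bounds the second
   moment by the number of quadruples with |j y_n - j' y_n'| < 1 and j, j' in
   [D, 2D).  Taking logarithms and detecting the condition
   |ln j + ln y_n - ln j' - ln y_n'| < 2/T by a Fejer weight, this number becomes
   a mean value of |H|^2 |W|^2, H being a smoothed zeta sum over j ~ D and W a
   Dirichlet polynomial over the cells.  Splitting according to whether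
   |zeta|^2 <= U or not, the two parts are controlled by the mean square of W and
   by the moment hypothesis.  Optimising U gives bad sets of measure N^(-e/2), and
   Borel-Cantelli along N = 2^i, together with the monotonicity of delta_min,
   finishes the proof.

   No approximate functional equation is needed to compare H with zeta.  The
   smoothing is a Gaussian exp(-(ln j - l)^2), a limit of powers of
   cos (d (ln j - l)); multiplying coefficients by cos (d (ln j - l)) averages
   shifts of the sum by -d and d in t, so that the alternating sum with these
   coefficients is bounded by iterated averages of |eta|^2.  The sum without
   signs is recovered from alternating ones by iterating
   (alternating sum at 2D) = (sum at 2D) - sqrt 2 * 2^(-it) (sum at D). *)
Require Import Defs.
From HB Require Import structures.
From mathcomp Require Import all_boot all_order all_algebra.
From mathcomp Require Import all_classical all_reals all_analysis.
From mathcomp Require Import complex ring lra zify measurable_realfun.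
Set Implicit Arguments. Unset Strict Implicit. Unset Printing Implicit Defensive.
Import Order.TTheory GRing.Theory Num.Theory.
Import numFieldNormedType.Exports.
Local Open Scope classical_set_scope.
Local Open Scope ring_scope.

(** * Integrals of continuous functions over segments *)

Section Integral.
Variable R : realType.
Implicit Types (f g F : R -> R) (a b c : R).

(** The exponent [th = (2 kappa - 4) / (kappa + 4 m)] balances three terms. Write X = N, p = kappa /
    2, let D <= X^th be a block of frequencies and M >= X^(2 - 2e) the number of cells. For the
    measures to be summable along powers of 2, the second moment must beat M^2 by a power of X.
    Relative to M^2, the count of close pairs in a block has a diagonal term D U / M, a moment term
    D U^(1 - p) T^m, and a term D^2 / T left by the pole of zeta. The pole forces T slightly above
    D^2. The products j y_n must be at least T for their logarithms to be 1/T-close, which is why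
    only cells beyond D X^e are kept. The diagonal allows U up to about X^2 / D, and up to e the
    moment term is then small exactly when th (p + 2m) <= 2 (p - 1).

    The averages of eta use a number of shifts that is not bounded in advance, so every estimate
    must survive averaging with a uniform constant. Errors and window integrals are therefore
    majorised by the hyperbolic cosine, an eigenfunction of the averaging operator whose eigenvalue
    stays bounded after all the steps. *)

Definition Int a b f : R := \int[@lebesgue_measure R]_(x in `[a, b]) f x.

Lemma cont_integrable a b f : continuous f ->
  (@lebesgue_measure R).-integrable `[a, b] (EFin \o f).
Proof.
move=> cf; apply: continuous_compact_integrable; first exact: segment_compact.
by apply: continuous_subspaceT => x; exact: cf.
Qed.

Lemma IntD a b f g : continuous f -> continuous g ->
  Int a b (fun x => f x + g x) = Int a b f + Int a b g.
Proof. by move=> cf cg; rewrite /Int RintegralD//; exact: cont_integrable. Qed.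

Lemma IntZ a b k f : continuous f -> Int a b (fun x => k * f x) = k * Int a b f.
Proof. by move=> cf; rewrite /Int RintegralZl//; exact: cont_integrable. Qed.

Lemma eq_Int a b f g : (forall x, f x = g x) -> Int a b f = Int a b g.
Proof. by move=> fg; apply: eq_Rintegral => x _. Qed.

Lemma le_Int a b f g : continuous f -> continuous g ->
  (forall x, a <= x <= b -> f x <= g x) -> Int a b f <= Int a b g.
Proof.
move=> cf cg fg; apply: le_Rintegral => //; try exact: cont_integrable.
Qed.

Lemma Int_ge0 a b f : (forall x, a <= x <= b -> 0 <= f x) -> 0 <= Int a b f.
Proof. by move=> f0; apply: Rintegral_ge0 => x /=; rewrite in_itv/=; exact: f0. Qed.

Lemma continuous_sum (I : Type) (r : seq I) (P : pred I) (F : I -> R -> R) :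
  (forall i, continuous (F i)) ->
  continuous (fun x => \sum_(i <- r | P i) F i x).
Proof.
move=> cF; elim: r => [|i r IH].
  by under eq_fun do rewrite big_nil; move=> x; exact: cvg_cst.
under eq_fun do rewrite big_cons; move=> x.
by case: (P i) => //; [apply: cvgD; [exact: cF|exact: IH]|exact: IH].
Qed.

Lemma Int_sum (I : Type) (r : seq I) a b (F : I -> R -> R) :
  (forall i, continuous (F i)) ->
  Int a b (fun x => \sum_(i <- r) F i x) = \sum_(i <- r) Int a b (F i).
Proof.
move=> cF; elim: r => [|i r IH].
  rewrite big_nil (@eq_Int _ _ _ (fun=> 0 * 1)); first last.
    by move=> x; rewrite big_nil mul0r.
  by rewrite IntZ ?mul0r// => x; exact: cvg_cst.
rewrite big_cons -IH -IntD//; last exact: continuous_sum.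
by apply: eq_Int => x; rewrite big_cons.
Qed.

Lemma Int_ereal a b f : continuous f ->
  (\int[lebesgue_measure]_(x in `[a, b]) (f x)%:E = (Int a b f)%:E)%E.
Proof.
move=> cf; rewrite /Int /Rintegral fineK//.
by apply: integrable_fin_num => //; exact: cont_integrable.
Qed.

Lemma Int_split a b c f : continuous f -> a <= b -> b <= c ->
  Int a c f = Int a b f + Int b c f.
Proof.
move=> cf ab bc; have /(_ (BLeft a) (BRight c) b) := @Rintegral_itvB R f.
rewrite /= !bnd_simp ab bc => /(_ (cont_integrable _ _ cf) isT isT).
rewrite Rintegral_itv_obnd_cbnd; first last.
  by apply: (integrableS _ _ _ (cont_integrable b c cf)) => //; exact: subset_itv_oc_cc.
by rewrite /Int => <-; rewrite addrC subrK.
Qed.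

Lemma Int_FTC a b f F : a <= b -> continuous f ->
  (forall x : R, is_derive x 1 F (f x)) -> Int a b f = F b - F a.
Proof.
rewrite le_eqVlt => /predU1P[-> cf dF|ab cf dF].
  by rewrite /Int set_itv1 Rintegral_set1 subrr.
have cF : continuous F.
  move=> x; apply: differentiable_continuous; apply/derivable1_diffP.
  by case: (dF x).
rewrite /Int /Rintegral (@continuous_FTC2 R f F)//.
- by apply: continuous_subspaceT => x; exact: cf.
- split.
  + by move=> x _; case: (dF x).
  + by apply: cvg_at_right_filter; exact: cF.
  + by apply: cvg_at_left_filter; exact: cF.
- by move=> x _; rewrite derive1E; apply: derive_val.
Qed.

Lemma Int_opp a b f : a <= b -> continuous f ->
  Int a b (fun x => f (- x)) = Int (- b) (- a) f.
Proof.
move=> ab cf; apply: EFin_inj; rewrite -!Int_ereal//; last first.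
  by move=> x; apply: continuous_comp; [exact: continuousN|exact: cf].
rewrite (@integration_by_substitution_oppr R f)//.
by apply: continuous_subspaceT => x; exact: cf.
Qed.

Lemma Int_shift a b c f : a <= b -> continuous f ->
  Int a b (fun x => f (x + c)) = Int (a + c) (b + c) f.
Proof.
move=> ab cf; apply: EFin_inj; rewrite -!Int_ereal//; last first.
  by move=> x; apply: continuous_comp; [apply: cvgD; [exact: cvg_id|exact: cvg_cst]|exact: cf].
have D : (fun x : R => x + c)^`()%classic = cst 1.
  by apply/funext => x; rewrite derive1E derive_val addr0.
rewrite (@integration_by_substitution_increasing R (fun x => x + c) f a b)//.
- by apply: eq_integral => x _; rewrite D /= mulr1.
- by move=> x y _ _; rewrite ltrD2r.
- by rewrite D => x _; exact: cvg_cst.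
- by rewrite D; apply: is_cvg_cst.
- by rewrite D; apply: is_cvg_cst.
- split => //.
  + by apply: cvg_at_right_filter; apply: cvgD; [exact: cvg_id|exact: cvg_cst].
  + by apply: cvg_at_left_filter; apply: cvgD; [exact: cvg_id|exact: cvg_cst].
- by apply: continuous_subspaceT => x; exact: cf.
Qed.

Lemma Int_subset a b c d f : continuous f -> (forall x, 0 <= f x) ->
  c <= a -> a <= b -> b <= d -> Int a b f <= Int c d f.
Proof.
move=> cf f0 ca ab bd; rewrite (@Int_split c a d)//; last exact: le_trans bd.
rewrite (@Int_split a b d)//.
by rewrite addrCA lerDl addr_ge0// Int_ge0.
Qed.

End Integral.

(** * The Fejer weight *)

Section Trig.
Variable R : realType.

Lemma sqr_le_norm (a b : R) : `|a| <= `|b| -> a ^+ 2 <= b ^+ 2.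
Proof.
by move=> ab; rewrite -(real_normK (num_real a)) -(real_normK (num_real b)) lerXn2r.
Qed.

Lemma deriv_continuous (f df : R -> R) :
  (forall x : R, is_derive x 1 f (df x)) -> continuous f.
Proof.
move=> dF x; apply: differentiable_continuous; apply/derivable1_diffP.
by case: (dF x).
Qed.

Lemma mvt (f df : R -> R) (a b : R) : a <= b ->
  (forall x : R, is_derive x 1 f (df x)) ->
  exists2 c, a <= c <= b & f b - f a = df c * (b - a).
Proof.
move=> ab df1; have [|c cab E] := MVT_segment ab (fun x _ => df1 x).
  by apply: continuous_subspaceT => x; exact: (deriv_continuous df1).
by exists c => //; move: cab; rewrite in_itv.
Qed.

Lemma lipschitz_deriv (f df : R -> R) (K : R) :
  (forall x : R, is_derive x 1 f (df x)) -> (forall x, `|df x| <= K) ->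
  forall a b, `|f a - f b| <= K * `|a - b|.
Proof.
move=> dF dK a b; wlog ab : a b / a <= b => [H|].
  have [|/ltW] := leP a b; first exact: H.
  by rewrite distrC (distrC a); exact: H.
have [c _ E] := mvt ab dF.
by rewrite distrC (distrC a) E normrM ler_wpM2r.
Qed.

Lemma cos_lip (a b : R) : `|cos a - cos b| <= `|a - b|.
Proof.
rewrite -[leRHS]mul1r; apply: (@lipschitz_deriv cos (fun x => - sin x)) => x.
by rewrite normrN sin_max.
Qed.

Lemma sin_lip (a b : R) : `|sin a - sin b| <= `|a - b|.
Proof.
by rewrite -[leRHS]mul1r; apply: (@lipschitz_deriv sin cos) => x; exact: cos_max.
Qed.

Lemma normr_sin_le (x : R) : `|sin x| <= `|x|.
Proof. by have := sin_lip x 0; rewrite sin0 !subr0. Qed.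

Lemma one_sub_cos (x : R) : 1 - cos x = 2 * sin (x / 2) ^+ 2.
Proof.
have -> : cos x = cos ((x / 2) *+ 2) by rewrite -mulr_natr divfK.
by rewrite cos_mulr2n -mulr_natl sin2cos2; ring.
Qed.

Lemma cos_ge_quad (x : R) : 1 - x ^+ 2 / 2 <= cos x.
Proof.
rewrite -subr_ge0; have -> : cos x - (1 - x ^+ 2 / 2) = x ^+ 2 / 2 - (1 - cos x) by ring.
rewrite one_sub_cos subr_ge0; have := sqr_le_norm (normr_sin_le (x / 2)); lra.
Qed.

Lemma sin_ge_half (x : R) : `|x| <= 1 -> `|x| / 2 <= `|sin x|.
Proof.
wlog x0 : x / 0 <= x => [H|].
  have [|/ltW x0 x1] := leP 0 x; first exact: H.
  by rewrite -normrN -(normrN (sin x)) -sinN; apply: H; rewrite ?oppr_ge0 ?normrN.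
rewrite ger0_norm// => x1.
have [c /andP[c0 cx]] := @mvt sin cos 0 x x0 (fun x => is_derive_sin x).
rewrite sin0 !subr0 => ->; have := cos_ge_quad c; rewrite normrM (ger0_norm x0) => C.
have : 1 / 2 <= `|cos c| by apply: le_trans (ler_norm _); nra.
by move=> /(ler_wpM2r x0); nra.
Qed.

End Trig.

Section Fejer.
Variable R : realType.
Implicit Types (A u : R).

(** Half the Fourier transform of the tent of half-width [A]: the Fejer kernel. It is nonnegative,
    so a form with these entries and nonnegative coefficients can be bounded from above entrywise,
    and from below after dropping terms. *)
Definition kap A u : R := Int 0 A (fun t => (1 - t / A) * cos (u * t)).

Lemma continuous_cosM u : continuous (fun t : R => cos (u * t)).
Proof.
move=> x; apply: continuous_comp; last exact: continuous_cos.
by apply: cvgM; [exact: cvg_cst|exact: cvg_id].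
Qed.

Lemma continuous_sinM u : continuous (fun t : R => sin (u * t)).
Proof.
move=> x; apply: continuous_comp; last exact: continuous_sin.
by apply: cvgM; [exact: cvg_cst|exact: cvg_id].
Qed.

Lemma continuous_tent A : continuous (fun t : R => 1 - t / A).
Proof.
move=> x; apply: cvgB; first exact: cvg_cst.
by apply: cvgM; [exact: cvg_id|exact: cvg_cst].
Qed.

Lemma continuous_tent_cos A u : continuous (fun t : R => (1 - t / A) * cos (u * t)).
Proof.
by move=> x; apply: cvgM; [exact: continuous_tent|exact: continuous_cosM].
Qed.

Lemma is_derive_cosM u (t : R) :
  is_derive t 1 (fun t => cos (u * t)) (- sin (u * t) * u).
Proof.
have ? : is_derive t 1 (fun t => u * t) u by apply: is_derive_eq; rewrite /GRing.scale/= mulr1.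
exact: (@is_derive1_comp R cos (fun t => u * t)).
Qed.

Lemma is_derive_sinM u (t : R) :
  is_derive t 1 (fun t => sin (u * t)) (cos (u * t) * u).
Proof.
have ? : is_derive t 1 (fun t => u * t) u by apply: is_derive_eq; rewrite /GRing.scale/= mulr1.
exact: (@is_derive1_comp R sin (fun t => u * t)).
Qed.

Lemma kap0 A : 0 < A -> kap A 0 = A / 2.
Proof.
move=> A0; have A0' : A != 0 by rewrite gt_eqF.
pose F (t : R) := t - t ^+ 2 / (2 * A).
have dF (t : R) : is_derive t 1 F ((1 - t / A) * cos (0 * t)).
  apply: is_derive_eq; rewrite !mul0r cos0 /GRing.scale/=.
  by field.
rewrite /kap (Int_FTC (ltW A0) (@continuous_tent_cos A 0) dF) /F.
by field.
Qed.

Lemma kapE A u : 0 < A -> u != 0 -> kap A u = (1 - cos (u * A)) / (A * u ^+ 2).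
Proof.
move=> A0 u0; have A0' : A != 0 by rewrite gt_eqF.
pose F (t : R) := (1 - t / A) * sin (u * t) / u - cos (u * t) / (A * u ^+ 2).
have dF (t : R) : is_derive t 1 F ((1 - t / A) * cos (u * t)).
  have H1 := is_derive_cosM u t; have H2 := is_derive_sinM u t.
  by apply: is_derive_eq; rewrite /GRing.scale/=; field; rewrite ?A0' ?u0.
rewrite /kap (Int_FTC (ltW A0) (@continuous_tent_cos A u) dF) /F.
by rewrite !mulr0 sin0 cos0; field; rewrite ?A0' ?u0.
Qed.

Lemma kap_ge0 A u : 0 < A -> 0 <= kap A u.
Proof.
move=> A0; have [->|u0] := eqVneq u 0; first by rewrite kap0// divr_ge0 ?ltW.
by rewrite kapE// one_sub_cos; apply: divr_ge0; apply: mulr_ge0; rewrite ?sqr_ge0// ltW.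
Qed.

Lemma kap_le_half A u : 0 < A -> kap A u <= A / 2.
Proof.
move=> A0; rewrite -kap0//; apply: le_Int => [||x /andP[x0 xA]].
- by move=> x; apply: cvgM; [exact: continuous_tent|exact: continuous_cosM].
- by move=> x; apply: cvgM; [exact: continuous_tent|exact: continuous_cosM].
rewrite mul0r cos0 mulr1 -[leRHS]mulr1 ler_wpM2l ?cos_le1//.
by rewrite subr_ge0 ler_pdivrMr// mul1r.
Qed.

Lemma kap_le_quad A u : 0 < A -> u != 0 -> kap A u <= 2 / (A * u ^+ 2).
Proof.
move=> A0 u0; rewrite kapE//; apply: ler_wpM2r.
  by rewrite invr_ge0 mulr_ge0 ?sqr_ge0// ltW.
by have := cos_geN1 (u * A); lra.
Qed.

(** In 1 - cos(uA) = 2 sin(uA/2)^2 the sine has argument in [-1, 1], where it is at least half its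
    argument in absolute value. This range fixes the tolerance 2/T in the count of close
    logarithms. *)
Lemma kap_ge A u : 0 < A -> `|u| * A <= 2 -> A / 8 <= kap A u.
Proof.
move=> A0 uA; have [->|u0] := eqVneq u 0; first by rewrite kap0//; lra.
rewrite kapE// one_sub_cos ler_pdivlMr; last first.
  by rewrite mulr_gt0// exprn_even_gt0.
have : `|u * A / 2| <= 1.
  by rewrite !normrM (gtr0_norm A0) (@gtr0_norm _ 2^-1) ?invr_gt0//; lra.
move=> /sin_ge_half H.
have {H} : (u * A / 2 / 2) ^+ 2 <= sin (u * A / 2) ^+ 2.
  by apply: sqr_le_norm; rewrite normrM (ger0_norm (x := 2^-1)) ?invr_ge0.
by lra.
Qed.

End Fejer.

(** * Mean values and the large sieve *)

Section MeanValue.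
Variable R : realType.
Implicit Types (A u : R).

(** Square modulus of the exponential sum with coefficients [c i] and frequencies [l i], kept within
    the reals. *)
Definition trigsq (I : Type) (r : seq I) (c l : I -> R) (t : R) : R :=
  (\sum_(i <- r) c i * cos (l i * t)) ^+ 2 + (\sum_(i <- r) c i * sin (l i * t)) ^+ 2.

Lemma trigsq_ge0 (I : Type) (r : seq I) (c l : I -> R) t : 0 <= trigsq r c l t.
Proof. by rewrite addr_ge0 ?sqr_ge0. Qed.

Lemma trigsqE (I : Type) (r : seq I) (c l : I -> R) t :
  trigsq r c l t = \sum_(i <- r) \sum_(j <- r) c i * c j * cos ((l i - l j) * t).
Proof.
rewrite /trigsq !expr2 !big_distrlr/= -big_split/=; apply: eq_bigr => i _.
rewrite -big_split/=; apply: eq_bigr => j _.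
by rewrite mulrBl cosB; ring.
Qed.

Lemma continuous_trigsq (I : Type) (r : seq I) (c l : I -> R) :
  continuous (trigsq r c l).
Proof.
have -> : trigsq r c l =
    (fun t => \sum_(i <- r) \sum_(j <- r) c i * c j * cos ((l i - l j) * t)).
  by apply/funext => t; exact: trigsqE.
apply: continuous_sum => i; apply: continuous_sum => j x.
by apply: cvgM; [exact: cvg_cst|exact: continuous_cosM].
Qed.

Lemma mean_value (I : Type) (r : seq I) (c l : I -> R) A :
  Int 0 A (fun t => (1 - t / A) * trigsq r c l t) =
  \sum_(i <- r) \sum_(j <- r) c i * c j * kap A (l i - l j).
Proof.
pose K i j (t : R) := c i * c j * ((1 - t / A) * cos ((l i - l j) * t)).
have cK i j : continuous (K i j).
  by move=> x; apply: cvgM; [exact: cvg_cst|exact: continuous_tent_cos].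
rewrite (@eq_Int R _ _ _ (fun t => \sum_(i <- r) \sum_(j <- r) K i j t)).
  rewrite Int_sum => [|i]; last exact: continuous_sum.
  apply: eq_bigr => i _; rewrite Int_sum//; apply: eq_bigr => j _.
  by rewrite IntZ//; exact: continuous_tent_cos.
move=> t; rewrite trigsqE big_distrr/=; apply: eq_bigr => i _.
by rewrite big_distrr/=; apply: eq_bigr => j _; rewrite /K; ring.
Qed.

Lemma sum_inv_sqr_le (m : nat) : \sum_(0 <= d < m) ((d.+1%:R : R) ^+ 2)^-1 <= 2.
Proof.
suff H n : \sum_(0 <= d < n.+1) ((d.+1%:R : R) ^+ 2)^-1 <= 2 - n.+1%:R^-1.
  by case: m => [|m]; [rewrite big_nil|apply: le_trans (H m) _; rewrite gerBl].
elim: n => [|n IH]; first by rewrite big_nat1 expr1n invr1; lra.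
rewrite big_nat_recr//=; apply: le_trans (lerD IH (lexx _)) _.
have x0 : 0 < n.+1%:R :> R by rewrite ltr0n.
rewrite -[in n.+2%:R]addn1 natrD; move: x0; set x := n.+1%:R => x0.
rewrite -subr_ge0 (_ : _ - _ = (x * (x + 1) ^+ 2)^-1).
  by rewrite invr_ge0 mulr_ge0 ?sqr_ge0// ltW.
by field; rewrite !gt_eqF// addr_gt0.
Qed.

Let dist (n k : nat) : nat := (n - k) + (k - n).

Lemma sum_dist_le (B n : nat) :
  \sum_(0 <= k < B) (((dist n k).+1%:R : R) ^+ 2)^-1 <= 4.
Proof.
have g0 d : 0 <= ((d.+1%:R : R) ^+ 2)^-1 by rewrite invr_ge0 sqr_ge0.
apply: (@le_trans _ _ (\sum_(0 <= k < n + B) (((dist n k).+1%:R : R) ^+ 2)^-1)).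
  by rewrite (big_cat_nat (n := B) (p := n + B))//= ?leq_addl// lerDl sumr_ge0.
rewrite (big_cat_nat (n := n)) ?leq_addr//= (_ : 4 = 2 + 2); last by ring.
apply: lerD.
  rewrite big_nat_rev/= add0n; apply: le_trans (sum_inv_sqr_le n).
  rewrite big_nat [leRHS]big_nat; apply: ler_sum => k /= kn.
  have -> : dist n (n - k.+1) = k.+1 by rewrite /dist; lia.
  by rewrite lef_pV2 ?posrE ?exprn_gt0 ?ltr0n// lerXn2r ?nnegrE// ler_nat.
rewrite -{1}[n]add0n big_addn addKn; apply: le_trans (sum_inv_sqr_le B).
by apply: ler_sum => k _; have -> : dist n (k + n) = k by rewrite /dist; lia.
Qed.

Lemma kap_cell_le A (x y : R) : 0 < A -> 0 <= x -> 0 <= y ->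
  kap A (x - y) <=
  8 * A / ((dist (Num.truncn (A * x)) (Num.truncn (A * y))).+1%:R) ^+ 2.
Proof.
move=> A0 x0 y0; set d := dist _ _.
have dle : d.+1%:R <= 2 + `|A * (x - y)| :> R.
  have /andP[a1 a2] : (Num.truncn (A * x))%:R <= A * x < (Num.truncn (A * x)).+1%:R.
    by apply: truncn_itv; rewrite mulr_ge0// ltW.
  have /andP[b1 b2] : (Num.truncn (A * y))%:R <= A * y < (Num.truncn (A * y)).+1%:R.
    by apply: truncn_itv; rewrite mulr_ge0// ltW.
  rewrite /d mulrBr; move: a1 a2 b1 b2; rewrite -!natr1.
  move: (Num.truncn _) (Num.truncn _) => k n a1 a2 b1 b2.
  have [nk|/ltnW nk] := leqP n k.
    rewrite /dist (_ : _ + _ = k - n)%N; last by lia.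
      by rewrite natrB// -normrN; apply: le_trans _ (lerD (lexx _) (ler_norm _)); lra.
  rewrite /dist (_ : _ + _ = n - k)%N; last by lia.
  by rewrite natrB//; apply: le_trans _ (lerD (lexx _) (ler_norm _)); lra.
have d0 : 0 < d.+1%:R :> R by rewrite ltr0n.
rewrite ler_pdivlMr ?exprn_gt0//.
have [x2|x2] := leP `|A * (x - y)| 2.
  have : d.+1%:R ^+ 2 <= 16 :> R by nra.
  move=> /(ler_wpM2l (kap_ge0 (x - y) A0)); have := @kap_le_half R A (x - y) A0; lra.
have xy0 : x - y != 0 by apply/eqP => E; rewrite E mulr0 normr0 in x2; lra.
have := kap_le_quad A0 xy0; rewrite ler_pdivlMr; last first.
  by rewrite mulr_gt0// exprn_even_gt0.
have H1 : d.+1%:R ^+ 2 <= 4 * (A * (x - y)) ^+ 2.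
  rewrite -[in leRHS](real_normK (num_real (A * (x - y)))); nra.
move=> H2; have := kap_ge0 (x - y) A0 => H3.
apply: le_trans (ler_wpM2l H3 H1) _; nra.
Qed.

(** The frequencies are gathered into cells of length 1/A, with masses [s n]. The kernel between
    cells is at most 8A / (1 + distance)^2, with row sums at most 32A, so a Schur test by 2ab <= a^2
    + b^2 leaves only the sum of [s n ^+ 2]. No spacing is assumed: coincidences are counted on the
    right. *)
Lemma large_sieve (I : Type) (r : seq I) (c l : I -> R) A : 0 < A ->
  (forall i, 0 <= c i) -> (forall i, 0 <= l i) ->
  Int 0 A (fun t => (1 - t / A) * trigsq r c l t) <=
  32 * A * \sum_(i <- r) \sum_(j <- r |
     Num.truncn (A * l i) == Num.truncn (A * l j)) c i * c j.
Proof.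
move=> A0 c0 l0; rewrite mean_value; set N := fun i => Num.truncn (A * l i).
have [B NB] : exists B, forall i, i \in [seq N i | i <- r] -> (i < B)%N.
  exists (\max_(i <- [seq N i | i <- r]) i).+1 => i ir.
  by rewrite ltnS; exact: (@leq_bigmax_seq _ _ xpredT (fun i => i) i ir).
pose s n := \sum_(i <- r | N i == n) c i.
have cells (g : nat -> R) : \sum_(i <- r) c i * g (N i) = \sum_(0 <= n < B) s n * g n.
  have : all (fun i => N i < B)%N r.
    by rewrite -[all _ _]/(all (preim N (fun n => n < B)%N) r) -all_map; apply/allP.
  rewrite /s; elim: (r) => [_|i q IH /= /andP[iB /IH E]].
    by rewrite big_nil big1// => n _; rewrite big_nil mul0r.
  under [RHS]eq_bigr do rewrite big_cons.
  rewrite big_cons E (bigD1_seq (N i))/= ?mem_index_iota ?iota_uniq//.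
  rewrite [in RHS](bigD1_seq (N i))/= ?mem_index_iota ?iota_uniq// eqxx.
  rewrite mulrDl addrA; congr (_ + _).
  by apply: eq_bigr => n; rewrite eq_sym => /negbTE ->.
have s0 n : 0 <= s n by apply: sumr_ge0.
pose b n k : R := 8 * A / (dist n k).+1%:R ^+ 2.
have b0 n k : 0 <= b n k by rewrite divr_ge0 ?sqr_ge0// mulr_ge0// ltW.
apply: (@le_trans _ _ (\sum_(i <- r) c i * \sum_(j <- r) c j * b (N i) (N j))).
  apply: ler_sum => i _; rewrite big_distrr/=; apply: ler_sum => j _.
  by rewrite -mulrA ler_wpM2l// ler_wpM2l//; exact: kap_cell_le.
under eq_bigr do rewrite cells.
rewrite (cells (fun n => \sum_(0 <= k < B) s k * b n k)).
have -> : \sum_(i <- r) \sum_(j <- r | N i == N j) c i * c j =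
          \sum_(0 <= n < B) s n * s n.
  rewrite -cells; apply: eq_bigr => i _; rewrite -big_distrr/=; congr (_ * _).
  by apply: eq_bigl => j; rewrite eq_sym.
have bC n k : b n k = b k n by rewrite /b /dist addnC.
have bs n : \sum_(0 <= k < B) b n k <= 32 * A.
  rewrite -big_distrr/= (_ : 32 * A = 8 * A * 4); last by ring.
  by rewrite ler_wpM2l ?sum_dist_le// mulr_ge0// ltW.
apply: (@le_trans _ _ (\sum_(0 <= n < B) \sum_(0 <= k < B)
    ((s n ^+ 2 * b n k) / 2 + (s k ^+ 2 * b n k) / 2))).
  apply: ler_sum => n _; rewrite big_distrr/=; apply: ler_sum => k _.
  have := b0 n k; have := sqr_ge0 (s n - s k); nra.
under eq_bigr do rewrite big_split/=.
rewrite big_split/= [X in _ + X]exchange_big/=.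
under [X in _ + X]eq_bigr do under eq_bigr do rewrite bC.
rewrite -big_split/= big_distrr/=; apply: ler_sum => n _.
rewrite -big_split/=; under eq_bigr do rewrite -mulrDl -mulr2n -[_ *+ 2]mulr_natr mulfK//.
by rewrite -big_distrr/= -expr2 mulrC ler_wpM2r ?sqr_ge0.
Qed.

End MeanValue.

(** * The eta function on the critical line *)

Section Eta.
Variable R : realType.

(** Meant for x = sqrt k and y = sqrt (k + 2): the term k^(-3/2) is dominated by a difference that
    telescopes in steps of two. *)
Lemma inv_step2 (x y : R) : 1 <= x -> 0 < y -> y ^+ 2 = x ^+ 2 + 2 ->
  (x ^+ 3)^-1 <= 4 * (x^-1 - y^-1).
Proof.
move=> x1 y0 y2; have x0 : 0 < x by lra.
have yx : y <= 2 * x by nra.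
have xy : x <= y by nra.
have -> : x^-1 - y^-1 = 2 / (x * y * (x + y)).
  by rewrite (_ : 2 = y ^+ 2 - x ^+ 2); [field; rewrite !gt_eqF ?addr_gt0|rewrite y2; ring].
have D0 : 0 < x * y * (x + y) by rewrite !mulr_gt0 ?addr_gt0.
rewrite mulrA ler_pdivlMr// mulrC ler_pdivrMr ?exprn_gt0//.
have : y * (x + y) <= 2 * x * (3 * x) by apply: ler_pM; nra.
by move=> /(ler_wpM2l (ltW x0)); nra.
Qed.

Lemma inv_step1 (x y : R) : 0 < x -> 0 < y -> y ^+ 2 = x ^+ 2 + 1 ->
  `|x^-1 - y^-1| <= (x ^+ 3)^-1.
Proof.
move=> x0 y0 y2; have xy : x <= y by nra.
rewrite ger0_norm ?subr_ge0 ?lef_pV2//.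
have -> : x^-1 - y^-1 = (x * y * (x + y))^-1.
  rewrite -[RHS]mul1r (_ : 1 = y ^+ 2 - x ^+ 2); last by rewrite y2; ring.
  by field; rewrite !gt_eqF ?addr_gt0.
rewrite lef_pV2 ?posrE ?exprn_gt0 ?mulr_gt0 ?addr_gt0//.
have : x * x <= y * (x + y) by nra.
by move=> /(ler_wpM2l (ltW x0)); nra.
Qed.

Definition altsum (f : nat -> R) (n p : nat) : R :=
  \sum_(n <= k < n + p) (-1) ^+ k.-1 * f k.

(** Consecutive terms are paired. The paired differences, of size b k^(-3/2), telescope in steps of
    two; an unpaired last term costs a / sqrt n. *)
Lemma altsum_le (f : nat -> R) (a b : R) : 0 <= a -> 0 <= b ->
  (forall k, (0 < k)%N -> `|f k| <= a / Num.sqrt k%:R) ->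
  (forall k, (0 < k)%N -> `|f k - f k.+1| <= b / Num.sqrt k%:R ^+ 3) ->
  forall p n, (0 < n)%N -> `|altsum f n p| <= (a + 4 * b) / Num.sqrt n%:R.
Proof.
move=> a0 b0 fa fb p; have [m] := ubnP p; elim: m p => // m IH [|[|p]] pm n n0.
- by rewrite /altsum addn0 big_geq// normr0 divr_ge0// ?sqrtr_ge0// addr_ge0// mulr_ge0.
- rewrite /altsum addn1 big_nat1 normrM normrX normrN1 expr1n mul1r.
  apply: le_trans (fa _ n0) _; rewrite ler_wpM2r ?invr_ge0 ?sqrtr_ge0//.
  by rewrite lerDl mulr_ge0.
have -> : altsum f n p.+2 = (-1) ^+ n.-1 * (f n - f n.+1) + altsum f n.+2 p.
  rewrite /altsum big_ltn; last by lia.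
  rewrite big_ltn; last by lia.
  have -> : (n + p.+2 = n.+2 + p)%N by lia.
  by case: (n) n0 => // q _ /=; rewrite exprS; ring.
apply: le_trans (ler_normD _ _) _; rewrite normrM normrX normrN1 expr1n mul1r.
have p2 : (p < m)%N by lia.
apply: le_trans (lerD (fb _ n0) (IH p p2 n.+2 isT)) _.
have := @inv_step2 (Num.sqrt n%:R) (Num.sqrt n.+2%:R).
have E2 : n.+2%:R = n%:R + 2 :> R by rewrite -addn2 natrD.
rewrite sqrtr_gt0 ltr0n !sqr_sqrtr ?ler0n// => /(_ _ isT E2).
have -> : 1 <= Num.sqrt n%:R :> R by rewrite -[leLHS]sqrtr1 ler_wsqrtr// ler1n.
move=> /(_ isT) /(ler_wpM2l b0).
have : a / Num.sqrt n.+2%:R <= a / Num.sqrt n%:R.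
  rewrite ler_wpM2l// lef_pV2 ?posrE ?sqrtr_gt0 ?ltr0n// ler_wsqrtr// ler_nat; lia.
by rewrite !mulrDl; lra.
Qed.


Lemma inv_sqrtE (k : nat) : k%:R `^ (- 2^-1) = (Num.sqrt k%:R)^-1 :> R.
Proof. by rewrite powRN powR12_sqrt. Qed.

Lemma ln_succ_le (k : nat) : (0 < k)%N ->
  0 <= ln (k.+1%:R : R) - ln k%:R <= k%:R^-1.
Proof.
move=> k0; have k0' : 0 < k%:R :> R by rewrite ltr0n.
rewrite subr_ge0 ler_ln ?posrE ?ltr0n// ler_nat leqnSn/=.
rewrite -ln_div ?posrE ?ltr0n//.
have -> : k.+1%:R / k%:R = 1 + k%:R^-1 :> R by rewrite -natr1 mulrDl divff ?gt_eqF// mul1r.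
by apply: le_ln1Dx; apply: (@lt_trans _ _ 0); rewrite ?oppr_lt0 ?invr_gt0.
Qed.

Lemma osc_diff (t : R) (F : R -> R) :
  (forall x, `|F x| <= 1) -> (forall x y, `|F x - F y| <= `|x - y|) ->
  forall k, (0 < k)%N ->
  `|k%:R `^ (- 2^-1) * F (t * ln k%:R) - k.+1%:R `^ (- 2^-1) * F (t * ln k.+1%:R)|
    <= (1 + `|t|) / Num.sqrt k%:R ^+ 3.
Proof.
move=> F1 FL k k0; rewrite !inv_sqrtE.
have x0 : 0 < Num.sqrt k%:R :> R by rewrite sqrtr_gt0 ltr0n.
have y0 : 0 < Num.sqrt k.+1%:R :> R by rewrite sqrtr_gt0 ltr0n.
set x := Num.sqrt _ in x0 *; set y := Num.sqrt _ in y0 *.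
set u := F _; set v := F _.
have -> : x^-1 * u - y^-1 * v = (x^-1 - y^-1) * v + x^-1 * (u - v) by ring.
apply: le_trans (ler_normD _ _) _; rewrite !normrM mulrDl mul1r; apply: lerD.
  apply: le_trans (ler_wpM2l (normr_ge0 _) (F1 _)) _; rewrite mulr1.
  by apply: inv_step1 => //; rewrite !sqr_sqrtr ?ler0n// natr1.
rewrite (gtr0_norm (x := x^-1)) ?invr_gt0//.
have : `|u - v| <= `|t| / x ^+ 2.
  apply: le_trans (FL _ _) _; rewrite -mulrBr normrM ler_wpM2l// distrC.
  have /andP[l0 l1] := ln_succ_le k0.
  by rewrite ger0_norm// sqr_sqrtr ?ler0n.
move=> /(ler_wpM2l (ltW (_ : 0 < x^-1))) => /(_ _)/le_trans; apply; first by rewrite invr_gt0.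
by rewrite mulrCA -invfM -exprS.
Qed.

Lemma osc_bound (F : R -> R) (t : R) : (forall x, `|F x| <= 1) ->
  forall k, `|k%:R `^ (- 2^-1) * F (t * ln k%:R)| <= 1 / Num.sqrt k%:R.
Proof.
move=> F1 k; rewrite inv_sqrtE normrM mul1r -[leRHS]mulr1 ler_pM//.
by rewrite ger0_norm// invr_ge0 sqrtr_ge0.
Qed.

(** Treats both parts of eta at once: with [cos] it is the partial sum of the real part, with [sin]
    the opposite of that of the imaginary part. *)
Definition osc (F : R -> R) (t : R) (n : nat) : R :=
  \sum_(1 <= k < n.+1) (-1) ^+ k.-1 * (k%:R `^ (- 2^-1)) * F (t * ln k%:R).

Lemma osc_cauchy (F : R -> R) (t : R) :
  (forall x, `|F x| <= 1) -> (forall x y, `|F x - F y| <= `|x - y|) ->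
  forall n p, `|osc F t (n + p) - osc F t n| <= 5 * (1 + `|t|) / Num.sqrt n.+1%:R.
Proof.
move=> F1 FL n p.
have -> : osc F t (n + p) - osc F t n =
    altsum (fun k => k%:R `^ (- 2^-1) * F (t * ln k%:R)) n.+1 p.
  rewrite /osc (big_cat_nat (n := n.+1))//= ?ltnS ?leq_addr//.
  by rewrite addrAC subrr add0r /altsum addSn; apply: eq_bigr => k _; rewrite mulrA.
have b0 : 0 <= 1 + `|t| by rewrite addr_ge0.
have := @altsum_le _ 1 (1 + `|t|) ler01 b0 (fun k _ => osc_bound t F1 k) (osc_diff t F1 FL) p n.+1 isT.
move=> /le_trans; apply; rewrite ler_wpM2r ?invr_ge0 ?sqrtr_ge0//.
by have := normr_ge0 t; lra.
Qed.

Lemma inv_sqrt_cvg0 (K : R) : K / Num.sqrt n.+1%:R @[n --> \oo] --> (0 : R).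
Proof.
apply/cvgrPdist_lt => e e0; near=> n.
have s0 : 0 < Num.sqrt n.+1%:R :> R by rewrite sqrtr_gt0 ltr0n.
rewrite sub0r normrN normrM normfV (gtr0_norm s0) ltr_pdivrMr// -ltr_pdivrMl//.
have -> : e^-1 * `|K| = Num.sqrt ((e^-1 * `|K|) ^+ 2).
  by rewrite sqrtr_sqr [RHS]ger0_norm// mulr_ge0// invr_ge0 ltW.
rewrite ltr_sqrt ?ltr0n//; apply: (@lt_le_trans _ _ n%:R); last by rewrite ler_nat.
by near: n; exact: nbhs_infty_gtr.
Unshelve. all: by end_near. Qed.

Lemma osc_cvg (F : R -> R) (t : R) :
  (forall x, `|F x| <= 1) -> (forall x y, `|F x - F y| <= `|x - y|) ->
  cvg (osc F t @ \oo).
Proof.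
move=> F1 FL; apply/cauchy_cvgP/cauchy_exP => e e0.
have /cvgrPdist_lt/(_ _ e0) [n _ /(_ n (leqnn n))/=] := inv_sqrt_cvg0 (5 * (1 + `|t|)).
rewrite sub0r normrN => /ltr_normlW He; exists (osc F t n).
exists n => // q /= nq; rewrite /ball/= -normrN opprB.
by apply: le_lt_trans He; have := osc_cauchy t F1 FL n (q - n); rewrite subnKC.
Qed.

(** The rate is explicit in t, hence locally uniform. It yields the continuity of eta and the error
    made by replacing |eta|^2 by a partial sum. *)
Lemma osc_rate (F : R -> R) (t : R) :
  (forall x, `|F x| <= 1) -> (forall x y, `|F x - F y| <= `|x - y|) ->
  forall n, `|lim (osc F t @ \oo) - osc F t n| <= 5 * (1 + `|t|) / Num.sqrt n.+1%:R.
Proof.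
move=> F1 FL n; have cF := @osc_cvg F t F1 FL.
have cN : (fun q => `|osc F t q - osc F t n|) @ \oo --> `|lim (osc F t @ \oo) - osc F t n|.
  by apply: cvg_norm; apply: cvgB; [exact: cF|exact: cvg_cst].
rewrite -(cvg_lim _ cN)//; apply: limr_le; first exact: (cvgP _ cN).
by exists n => // q /= nq; have := osc_cauchy t F1 FL n (q - n); rewrite subnKC.
Qed.

Lemma locally_uniform_limit_continuous (f : nat -> R -> R) (g : R -> R) (K : R) :
  (forall n, continuous (f n)) ->
  (forall t n, `|g t - f n t| <= K * (1 + `|t|) / Num.sqrt n.+1%:R) ->
  continuous g.
Proof.
move=> cf fg t; apply/cvgrPdist_lt => e e0.
have e3 : 0 < e / 3 by rewrite divr_gt0.
have /cvgrPdist_lt/(_ _ e3) [n _ /(_ n (leqnn n))/=] := inv_sqrt_cvg0 (`|K| * (2 + `|t|)).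
rewrite sub0r normrN => /ltr_normlW He.
have close s : `|s| <= 1 + `|t| -> `|g s - f n s| < e / 3.
  move=> st; apply: le_lt_trans (fg s n) _; apply: le_lt_trans _ He.
  rewrite ler_wpM2r ?invr_ge0 ?sqrtr_ge0//.
  by apply: le_trans (ler_norm _) _; rewrite normrM ler_wpM2l// ger0_norm ?addr_ge0//; lra.
have /cvgrPdist_lt/(_ _ e3) ct := cf n t.
near=> s.
have Hs : `|s| <= 1 + `|t|.
  have : `|t - s| < 1 by near: s; apply: cvgr_dist_lt => //; exact: cvg_id.
  by move=> ts; have := ler_distD t s 0; rewrite !subr0 (distrC s t); lra.
have h1 := close _ Hs; have h2 : `|g t - f n t| < e / 3 by apply: close; lra.
have h3 : `|f n t - f n s| < e / 3 by near: s; exact: ct.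
have -> : g t - g s = (g t - f n t) + (f n t - f n s) - (g s - f n s) by ring.
apply: le_lt_trans (ler_normB _ _) _.
have := ler_normD (g t - f n t) (f n t - f n s); lra.
Unshelve. all: by end_near. Qed.

Lemma continuous_osc (F : R -> R) n : continuous F -> continuous (fun t => osc F t n).
Proof.
move=> cF; apply: continuous_sum => k t.
apply: cvgM; first exact: cvg_cst.
apply: continuous_comp; last exact: cF.
by apply: cvgM; [exact: cvg_id|exact: cvg_cst].
Qed.

Lemma eta_crit_reE (t : R) : eta_crit_re t = lim (osc cos t @ \oo).
Proof. by []. Qed.

Lemma eta_crit_imE (t : R) : eta_crit_im t = - lim (osc sin t @ \oo).
Proof.
have cS : cvg (osc sin t @ \oo) by apply: osc_cvg; [exact: sin_max|exact: sin_lip].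
by rewrite -limN.
Qed.

Definition etasq (t : R) : R := eta_crit_re t ^+ 2 + eta_crit_im t ^+ 2.
Definition etasq_part (n : nat) (t : R) : R := osc cos t n ^+ 2 + osc sin t n ^+ 2.

Lemma continuous_etasq : continuous etasq.
Proof.
have c1 : continuous (@eta_crit_re R).
  apply: (@locally_uniform_limit_continuous (fun n t => osc cos t n) _ 5).
    by move=> n; apply: continuous_osc; exact: continuous_cos.
  by move=> t n; apply: osc_rate; [exact: cos_max|exact: cos_lip].
have c2 : continuous (fun t : R => lim (osc sin t @ \oo)).
  apply: (@locally_uniform_limit_continuous (fun n t => osc sin t n) _ 5).
    by move=> n; apply: continuous_osc; exact: continuous_sin.
  by move=> t n; apply: osc_rate; [exact: sin_max|exact: sin_lip].
have -> : etasq = (fun t => eta_crit_re t * eta_crit_re t +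
    lim (osc sin t @ \oo) * lim (osc sin t @ \oo)).
  by apply/funext => t; rewrite /etasq eta_crit_imE sqrrN !expr2.
by move=> t; apply: cvgD; [apply: cvgM; exact: c1|apply: cvgM; exact: c2].
Qed.

Lemma etasq_ge0 t : 0 <= etasq t.
Proof. by rewrite addr_ge0 ?sqr_ge0. Qed.

Lemma etasqN t : etasq (- t) = etasq t.
Proof.
rewrite /etasq !eta_crit_imE !eta_crit_reE !sqrrN.
have -> : osc cos (- t) = osc cos t.
  by apply/funext => n; apply: eq_bigr => k _; rewrite mulNr cosN.
have -> : osc sin (- t) = - osc sin t.
  apply/funext => n; rewrite fctE /osc -sumrN; apply: eq_bigr => k _.
  by rewrite mulNr sinN mulrN.
by rewrite limN ?sqrrN//; apply: osc_cvg; [exact: sin_max|exact: sin_lip].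
Qed.

Lemma etasq_part_le n t :
  etasq_part n t <= 2 * etasq t + 100 * (1 + `|t|) ^+ 2 / n.+1%:R.
Proof.
have h1 := @osc_rate cos t (@cos_max R) (@cos_lip R) n.
have h2 := @osc_rate sin t (@sin_max R) (@sin_lip R) n.
rewrite /etasq_part /etasq eta_crit_imE eta_crit_reE sqrrN.
move: h1 h2; set c := lim _; set s := lim _; set c' := osc _ _ _; set s' := osc _ _ _.
set d := _ / _ => h1 h2.
have d0 : 0 <= d by apply: le_trans h1.
have dE : d ^+ 2 = 25 * (1 + `|t|) ^+ 2 / n.+1%:R.
  by rewrite /d expr_div_n sqr_sqrtr ?ler0n// exprMn; congr (_ * _ / _); ring.
have H (x y : R) : `|x - y| <= d -> y ^+ 2 <= 2 * x ^+ 2 + 2 * d ^+ 2.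
  move=> xy; have : (x - y) ^+ 2 <= d ^+ 2.
    by apply: sqr_le_norm; rewrite (ger0_norm d0).
  by have := sqr_ge0 (2 * x - y); nra.
apply: le_trans (lerD (H _ _ h1) (H _ _ h2)) _; rewrite dE.
by rewrite le_eqVlt; apply/orP; left; apply/eqP; field; rewrite ?nat1r ?natr1 ?pnatr_eq0.
Qed.

(** The value is 3 - 2 sqrt 2 cos(t ln 2), which is positive since 2 sqrt 2 < 3. The bound 9 is
    rounded up to have an integral square root. *)
Lemma eta_factor_bounds (t : R) : 0 < eta_factor_sqnorm t <= 9.
Proof.
rewrite /eta_factor_sqnorm; set c := cos _; set s := sin _.
have cs : c ^+ 2 + s ^+ 2 = 1 by exact: cos2Dsin2.
have q2 : Num.sqrt 2 ^+ 2 = 2 :> R by rewrite sqr_sqrtr.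
have q0 : 0 <= Num.sqrt 2 :> R by rewrite sqrtr_ge0.
have q3 : Num.sqrt 2 <= 3 / 2 :> R by nra.
have c1 : c <= 1 := cos_le1 _; have c2 : -1 <= c := cos_geN1 _.
have -> : (1 - Num.sqrt 2 * c) ^+ 2 + (Num.sqrt 2 * s) ^+ 2 = 3 - 2 * Num.sqrt 2 * c.
  transitivity (1 - 2 * Num.sqrt 2 * c + Num.sqrt 2 ^+ 2 * (c ^+ 2 + s ^+ 2)); first by ring.
  by rewrite q2 cs; ring.
apply/andP; split; nra.
Qed.

Lemma sqrt_etasq_le_zeta (t : R) : Num.sqrt (etasq t) <= 3 * zeta_crit_abs t.
Proof.
have /andP[f0 f9] := eta_factor_bounds t.
rewrite /zeta_crit_abs mulrA ler_pdivlMr ?sqrtr_gt0// mulrC ler_wpM2r ?sqrtr_ge0//.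
have -> : 3 = Num.sqrt 9 :> R by rewrite (_ : 9 = 3 ^+ 2) ?sqrtr_sqr ?ger0_norm//; ring.
by rewrite ler_wsqrtr.
Qed.

End Eta.

(** * Smoothed zeta sums *)

Section SmoothSums.
Variable R : realType.
Implicit Types (w : nat -> R) (F G : R -> R) (l t : R) (n k : nat).

Lemma hypot_triangle (a b c d : R) :
  Num.sqrt ((a + c) ^+ 2 + (b + d) ^+ 2) <=
  Num.sqrt (a ^+ 2 + b ^+ 2) + Num.sqrt (c ^+ 2 + d ^+ 2).
Proof.
have ab0 : 0 <= a ^+ 2 + b ^+ 2 by rewrite addr_ge0 ?sqr_ge0.
have cd0 : 0 <= c ^+ 2 + d ^+ 2 by rewrite addr_ge0 ?sqr_ge0.
have := sqr_sqrtr ab0; have := sqr_sqrtr cd0.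
have := sqrtr_ge0 (a ^+ 2 + b ^+ 2); have := sqrtr_ge0 (c ^+ 2 + d ^+ 2).
set x := Num.sqrt (a ^+ 2 + _); set y := Num.sqrt (c ^+ 2 + _) => y0 x0 y2 x2.
have xy0 : 0 <= x * y by rewrite mulr_ge0.
have cs : a * c + b * d <= x * y.
  have [//|H] := leP (a * c + b * d) (x * y).
  have : (x * y) ^+ 2 < (a * c + b * d) ^+ 2 by rewrite ltrXn2r.
  rewrite exprMn x2 y2; have := sqr_ge0 (a * d - b * c); nra.
rewrite -[leRHS]ger0_norm ?addr_ge0// -sqrtr_sqr ler_wsqrtr//.
nra.
Qed.

Definition wsum w F n t : R := \sum_(1 <= k < n.+1) w k * F (t * ln k%:R).
Definition wsq w n t : R := wsum w cos n t ^+ 2 + wsum w sin n t ^+ 2.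
(** The coefficient k^(-1/2) localised around k = exp l by a Gaussian in ln k. Depending on k only
    through ln k - l, the Gaussian is compatible with k -> 2k. *)
Definition gw l k : R := k%:R `^ (- 2^-1) * expR (- (ln k%:R - l) ^+ 2).
Definition alt w k : R := (-1) ^+ k.-1 * w k.

Lemma wsq_ge0 w n t : 0 <= wsq w n t.
Proof. by rewrite addr_ge0 ?sqr_ge0. Qed.

Lemma gw_ge0 l k : 0 <= gw l k.
Proof. by rewrite mulr_ge0 ?powR_ge0 ?expR_ge0. Qed.

(** The Gaussian rises, then falls. The function [phi] records the variation accumulated so far,
    measured from the peak; it takes values in [-1, 1], and the sum of its increments telescopes. *)
Lemma total_variation_gauss (u : nat -> R) n : (forall k, (0 < k)%N -> u k <= u k.+1) ->
  \sum_(1 <= k < n.+1) `|expR (- u k.+1 ^+ 2) - expR (- u k ^+ 2)| <= 2.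
Proof.
move=> uinc.
pose g (x : R) := expR (- x ^+ 2).
pose phi (x : R) := if x <= 0 then g x - 1 else 1 - g x.
have g0 x : 0 <= g x by exact: expR_ge0.
have g1 x : g x <= 1 by rewrite -expR0 ler_expR oppr_le0 sqr_ge0.
have gneg x y : x <= y -> y <= 0 -> g x <= g y by move=> xy y0; rewrite ler_expR lerN2; nra.
have gpos x y : 0 <= x -> x <= y -> g y <= g x by move=> x0 xy; rewrite ler_expR lerN2; nra.
have step x y : x <= y -> `|g y - g x| <= phi y - phi x.
  move=> xy; rewrite /phi; have [y0|y0] := leP y 0.
    rewrite (le_trans xy y0) ger0_norm; first by lra.
    by rewrite subr_ge0 gneg.
  have [x0|x0] := leP x 0.
    by rewrite ler_norml; have := g0 x; have := g0 y; have := g1 x; have := g1 y; lra.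
  by rewrite ler0_norm; [lra|rewrite subr_le0 gpos// ltW].
apply: (@le_trans _ _ (\sum_(1 <= k < n.+1) (phi (u k.+1) - phi (u k)))).
  rewrite big_nat [leRHS]big_nat; apply: ler_sum => k /andP[k0 _].
  by apply: step; exact: uinc.
rewrite telescope_sumr//.
have phib x : -1 <= phi x <= 1.
  by rewrite /phi; have := g0 x; have := g1 x; case: ifP => _ H1 H2; apply/andP; split; lra.
by have /andP[_] := phib (u n.+1); have /andP[+ _] := phib (u 1%N); lra.
Qed.

Lemma sum_inv_sqrt3_le m p : (0 < m)%N ->
  \sum_(m <= k < m + p) (Num.sqrt k%:R ^+ 3)^-1 <= 8 / Num.sqrt m%:R :> R.
Proof.
move=> m0; pose s k : R := (Num.sqrt k%:R)^-1.
have s0 k : 0 <= s k by rewrite invr_ge0 sqrtr_ge0.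
apply: (@le_trans _ _ (\sum_(m <= k < m + p) 4 * ((- s k.+1 - s k.+2) - (- s k - s k.+1)))).
  rewrite big_nat [leRHS]big_nat; apply: ler_sum => k /andP[mk _].
  have k0 : (0 < k)%N by apply: leq_trans mk.
  have -> : - s k.+1 - s k.+2 - (- s k - s k.+1) = s k - s k.+2 by ring.
  apply: inv_step2.
  - by rewrite -[leLHS]sqrtr1 ler_wsqrtr// ler1n.
  - by rewrite sqrtr_gt0 ltr0n.
  - by rewrite !sqr_sqrtr ?ler0n// -addn2 natrD.
rewrite -big_distrr/= telescope_sumr ?leq_addr//.
have : s m.+1 <= s m.
  by rewrite lef_pV2 ?posrE ?sqrtr_gt0 ?ltr0n// ler_wsqrtr// ler_nat.
have := s0 (m + p).+1; have := s0 (m + p)%N; rewrite /s.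
by lra.
Qed.

Lemma sum_inv_sqrt_le n :
  \sum_(1 <= k < n.+1) (Num.sqrt k%:R)^-1 <= 2 * Num.sqrt n%:R :> R.
Proof.
elim: n => [|n IH]; first by rewrite big_geq// sqrtr0 mulr0.
rewrite big_nat_recr//=; apply: le_trans (lerD IH (lexx _)) _.
have y0 : 0 < Num.sqrt n.+1%:R :> R by rewrite sqrtr_gt0 ltr0n.
have y2 : Num.sqrt n.+1%:R ^+ 2 = n%:R + 1 :> R by rewrite sqr_sqrtr ?ler0n// natr1.
have x2 : Num.sqrt n%:R ^+ 2 = n%:R :> R by rewrite sqr_sqrtr ?ler0n.
have x0 : 0 <= Num.sqrt n%:R :> R by rewrite sqrtr_ge0.
rewrite -lerBrDl -[leLHS]mulr1 ler_pdivrMl//; nra.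
Qed.

Lemma gw_le_inv_sqrt l k : gw l k <= (Num.sqrt k%:R)^-1.
Proof.
rewrite /gw inv_sqrtE -[leRHS]mulr1 ler_wpM2l ?invr_ge0 ?sqrtr_ge0//.
by rewrite -expR0 ler_expR oppr_le0 sqr_ge0.
Qed.

Lemma expR1_le3 : expR 1 <= 3 :> R.
Proof.
have -> : expR 1 = (expR 8^-1) ^+ 8 :> R by rewrite -expRM_natl mulfV// pnatr_eq0.
have e0 := expR_gt0 (8^-1 : R).
have h : expR 8^-1 <= 8 / 7 :> R.
  have : (7 / 8) * expR 8^-1 <= expR (- 8^-1) * expR 8^-1 :> R.
    by apply: (ler_wpM2r (ltW e0)); have := expR_ge1Dx (- 8^-1 : R); lra.
  by rewrite -expRD addNr expR0; lra.
apply: (@le_trans _ _ ((8 / 7) ^+ 8)); last by lra.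
by apply: lerXn2r => //; rewrite nnegrE ltW.
Qed.

(** From v^2 >= v - 1 the Gaussian is at most e exp(-v) = e X / k, which leaves the summable
    k^(-3/2). *)
Lemma gw_tail_le (X : nat) k : (0 < X)%N -> (0 < k)%N ->
  gw (ln X%:R) k <= 3 * X%:R / Num.sqrt k%:R ^+ 3.
Proof.
move=> X0 k0.
have X0' : 0 < X%:R :> R by rewrite ltr0n.
have k0' : 0 < k%:R :> R by rewrite ltr0n.
have s0 : 0 < Num.sqrt k%:R :> R by rewrite sqrtr_gt0.
rewrite /gw inv_sqrtE.
have -> : 3 * X%:R / Num.sqrt k%:R ^+ 3 = (Num.sqrt k%:R)^-1 * (3 * X%:R / k%:R) :> R.
  have sk := sqr_sqrtr (ltW k0'); move: sk s0; set s := Num.sqrt _ => sk s0.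
  by rewrite -sk; field; rewrite gt_eqF.
rewrite ler_wpM2l ?invr_ge0 ?sqrtr_ge0//.
set v := ln _ - _.
apply: (@le_trans _ _ (expR (1 - v))); first by rewrite ler_expR; have := sqr_ge0 (2 * v - 1); nra.
rewrite expRD -mulrA ler_pM ?expR_ge0// ?expR1_le3//.
by rewrite /v opprB expRB !lnK ?posrE.
Qed.

Lemma sum_gw_le (X n : nat) : (0 < X)%N ->
  \sum_(1 <= k < n.+1) gw (ln X%:R) k <= 26 * Num.sqrt X%:R.
Proof.
move=> X0.
have s0 : 0 < Num.sqrt X%:R :> R by rewrite sqrtr_gt0 ltr0n.
apply: (@le_trans _ _ (\sum_(1 <= k < X.+1 + n) gw (ln X%:R) k)).
  rewrite [leRHS](big_cat_nat (n := n.+1))//=; last by lia.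
  by rewrite lerDl sumr_ge0// => k _; exact: gw_ge0.
rewrite (big_cat_nat (n := X.+1)) ?leq_addr//=.
have h1 : \sum_(1 <= k < X.+1) gw (ln X%:R) k <= 2 * Num.sqrt X%:R.
  by apply: le_trans (sum_inv_sqrt_le X); apply: ler_sum => k _; exact: gw_le_inv_sqrt.
have h2 : \sum_(X.+1 <= k < X.+1 + n) gw (ln X%:R) k <= 24 * Num.sqrt X%:R.
  apply: (@le_trans _ _ (\sum_(X.+1 <= k < X.+1 + n) 3 * X%:R * (Num.sqrt k%:R ^+ 3)^-1)).
    rewrite big_nat [leRHS]big_nat; apply: ler_sum => k /andP[k0 _].
    by apply: gw_tail_le => //; exact: leq_ltn_trans k0.
  rewrite -big_distrr/=.
  have := @sum_inv_sqrt3_le X.+1 n isT => /(ler_wpM2l (_ : 0 <= 3 * X%:R)).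
  move=> /(_ (mulr_ge0 _ (ler0n _ _)))/le_trans; apply => //.
  have : 8 / Num.sqrt X.+1%:R <= 8 / Num.sqrt X%:R :> R.
    by rewrite ler_wpM2l// lef_pV2 ?posrE ?sqrtr_gt0 ?ltr0n// ler_wsqrtr// ler_nat.
  move=> /(ler_wpM2l (_ : 0 <= 3 * X%:R)) => /(_ (mulr_ge0 _ (ler0n _ _)))/le_trans; apply => //.
  rewrite -{1}(sqr_sqrtr (ler0n R X)) mulrA ler_pdivrMr//; nra.
by apply: le_trans (lerD h1 h2) _; lra.
Qed.

Lemma wsum_norm_le w F n t : (forall x, `|F x| <= 1) -> (forall k, 0 <= w k) ->
  `|wsum w F n t| <= \sum_(1 <= k < n.+1) w k.
Proof.
move=> F1 w0; apply: le_trans (ler_norm_sum _ _ _) _; apply: ler_sum => k _.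
by rewrite normrM ger0_norm// -[leRHS]mulr1 ler_wpM2l.
Qed.

End SmoothSums.

(** * Cancellation in the smoothed sum for t away from 0 *)

Section Osc.
Variable R : realType.
Implicit Types (w : nat -> R) (F G : R -> R) (l t : R) (n k : nat).

(* amplitude k * gw l k, a Gaussian in ln k centred at l + 1/4 *)
Lemma kgwE l k : (0 < k)%N ->
  k%:R * gw l k = expR (l / 2 + 16^-1) * expR (- (ln k%:R - (l + 4^-1)) ^+ 2).
Proof.
move=> k0; have k0' : 0 < k%:R :> R by rewrite ltr0n.
rewrite /gw mulrA /powR gt_eqF// -{1}(lnK (_ : k%:R \is Num.pos)) ?posrE//.
by rewrite -!expRD; congr expR; lra.
Qed.

Lemma expR16_le2 : expR 16^-1 <= 2 :> R.
Proof.
have e0 := expR_gt0 (16^-1 : R).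
have : (1 / 2) * expR 16^-1 <= expR (- 16^-1) * expR 16^-1 :> R.
  by apply: (ler_wpM2r (ltW e0)); have := expR_ge1Dx (- 16^-1 : R); lra.
by rewrite -expRD addNr expR0; lra.
Qed.

Lemma expR_half_ln (X : nat) : (0 < X)%N -> expR (ln X%:R / 2) = Num.sqrt X%:R :> R.
Proof.
move=> X0; rewrite -powR12_sqrt ?ler0n// /powR.
by rewrite pnatr_eq0 -[X == _]negbK -lt0n X0/= mulrC.
Qed.

Lemma taylor1 F G : (forall x : R, is_derive x 1 F (G x)) ->
  (forall x y, `|G x - G y| <= `|x - y|) ->
  forall a b, a <= b -> `|F b - F a - G a * (b - a)| <= (b - a) ^+ 2.
Proof.
move=> dF GL a b ab; have [c /andP[ac cb] ->] := mvt ab dF.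
rewrite -mulrBl normrM expr2 (ger0_norm (x := b - a)) ?subr_ge0// ler_wpM2r ?subr_ge0//.
by apply: le_trans (GL _ _) _; rewrite ger0_norm ?subr_ge0//; lra.
Qed.

Lemma ln_succ_approx k : (0 < k)%N ->
  `|(ln k.+1%:R - ln k%:R) - k%:R^-1| <= (k%:R ^+ 2)^-1 :> R.
Proof.
move=> k0; have k0' : 0 < k%:R :> R by rewrite ltr0n.
have /andP[l0 l1] := @ln_succ_le R k k0.
have k1 : 0 < k.+1%:R :> R by rewrite ltr0n.
have l2 : k.+1%:R^-1 <= ln k.+1%:R - ln k%:R :> R.
  rewrite -lerN2 opprB -ln_div ?posrE//.
  have -> : k%:R / k.+1%:R = 1 + - k.+1%:R^-1 :> R.
    by rewrite -natr1; field; rewrite natr1 gt_eqF.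
  apply: le_ln1Dx; rewrite ltrN2 invf_lt1// ltr1n; lia.
have : k%:R^-1 - k.+1%:R^-1 <= (k%:R ^+ 2)^-1 :> R.
  have -> : k%:R^-1 - k.+1%:R^-1 = (k%:R * k.+1%:R)^-1 :> R.
    by rewrite -natr1; field; rewrite natr1 !gt_eqF.
  by rewrite lef_pV2 ?posrE ?exprn_gt0 ?mulr_gt0// expr2 ler_wpM2l ?(ltW k0')// ler_nat.
have : 0 <= (k%:R ^+ 2)^-1 :> R by rewrite invr_ge0 sqr_ge0.
move: l1 l2; move: (ln _ - ln _) (k.+1%:R^-1) (k%:R^-1) ((k%:R ^+ 2)^-1) => a b c d.
by rewrite ler_norml => *; apply/andP; split; lra.
Qed.

(* Summation by parts: [t * k^-1 F'(t ln k)] is nearly the increment of [F (t ln k)],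
   and [k * gw l k] has total variation at most [2 * 2 sqrt X]. *)
Lemma wsum_gw_bound F G (X n : nat) t :
  (forall x, `|F x| <= 1) -> (forall x, `|G x| <= 1) ->
  (forall x : R, is_derive x 1 F (G x)) ->
  (forall x y, `|G x - G y| <= `|x - y|) ->
  (0 < X)%N -> 0 <= t ->
  t * `|wsum (gw (ln X%:R)) G n t| <= 8 * Num.sqrt X%:R + 8 * (t ^+ 2 + t).
Proof.
move=> F1 G1 dF GL X0 t0.
pose l : R := ln X%:R; pose v k : R := ln k%:R; pose p k := k%:R * gw l k.
pose P : R := 2 * Num.sqrt X%:R.
have P0 : 0 <= P by rewrite mulr_ge0 ?sqrtr_ge0.
pose g k := expR (- (v k - (l + 4^-1)) ^+ 2).
pose Q : R := expR (l / 2 + 16^-1).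
have Q0 : 0 <= Q by exact: expR_ge0.
have QP : Q <= P.
  by rewrite /Q expRD expR_half_ln// mulrC ler_wpM2r ?sqrtr_ge0// expR16_le2.
have pE k : (0 < k)%N -> p k = Q * g k by move=> k0; rewrite /p kgwE.
have g1 k : 0 <= g k <= 1 by rewrite expR_ge0/= -expR0 ler_expR oppr_le0 sqr_ge0.
have p0 k : 0 <= p k by rewrite mulr_ge0 ?gw_ge0.
have pP k : (0 < k)%N -> p k <= P.
  by move=> k0; rewrite pE//; have := g1 k; nra.
(* Besides [p k <= P], this bound is free of X: it turns the second-order errors k^(-2) into
   k^(-3/2), so their total is of order t^2 + t whatever X is. *)
have pS k : (0 < k)%N -> p k <= Num.sqrt k%:R.
  move=> k0; have s0 : 0 < Num.sqrt k%:R :> R by rewrite sqrtr_gt0 ltr0n.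
  have := gw_le_inv_sqrt l k; rewrite -(ler_pM2l (ltr0n R k.-1.+1)) prednK//.
  move=> /le_trans; apply; rewrite -{1}(sqr_sqrtr (ler0n R k)) expr2 -mulrA divff ?mulr1//.
  by rewrite gt_eqF.
have vinc k : (0 < k)%N -> v k <= v k.+1.
  by move=> k0; have := @ln_succ_le R k k0; rewrite subr_ge0 => /andP[].
have TV : \sum_(1 <= k < n.+1) `|p k.+1 - p k| <= 2 * P.
  apply: (@le_trans _ _ (Q * 2)); last by rewrite mulrC ler_wpM2l.
  have H := @total_variation_gauss R (fun k => v k - (l + 4^-1)) n.
  apply: le_trans (ler_wpM2l Q0 (H _)); last first.
    by move=> k k0; rewrite lerB// vinc.
  rewrite big_distrr/= big_nat [leRHS]big_nat; apply: ler_sum => k /andP[k0 _].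
  by rewrite !pE// -mulrBr normrM ger0_norm.
have E : t * wsum (gw l) G n t =
    (p n.+1 * F (t * v n.+1) - p 1%N * F (t * v 1%N))
    - \sum_(1 <= k < n.+1) (p k.+1 - p k) * F (t * v k.+1)
    - \sum_(1 <= k < n.+1) p k * (F (t * v k.+1) - F (t * v k) - t * k%:R^-1 * G (t * v k)).
  rewrite -(telescope_sumr (fun k => p k * F (t * v k)))//.
  rewrite -!sumrB /wsum big_distrr/= big_nat [RHS]big_nat; apply: eq_bigr => k /andP[k0 _].
  have -> : gw l k = p k * k%:R^-1.
    by rewrite /p mulrAC divff ?mul1r// pnatr_eq0 -lt0n.
  rewrite -/(v k); ring.
have t0' : `|t| = t by rewrite ger0_norm.
rewrite -[X in X * _]t0' -normrM E.
apply: le_trans (ler_normB _ _) _.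
apply: le_trans (lerD (ler_normB _ _) (lexx _)) _.
apply: le_trans (lerD (lerD (ler_normB _ _) (lexx _)) (lexx _)) _.
have nF k x : (0 < k)%N -> `|p k * F x| <= P.
  move=> k0; rewrite normrM ger0_norm// -[leRHS]mulr1.
  by apply: ler_pM => //; exact: pP.
have S1 : `|\sum_(1 <= k < n.+1) (p k.+1 - p k) * F (t * v k.+1)| <= 2 * P.
  apply: le_trans (ler_norm_sum _ _ _) (le_trans _ TV); apply: ler_sum => k _.
  by rewrite normrM -[leRHS]mulr1 ler_wpM2l.
have S2 : `|\sum_(1 <= k < n.+1) p k *
    (F (t * v k.+1) - F (t * v k) - t * k%:R^-1 * G (t * v k))| <= 8 * (t ^+ 2 + t).
  apply: le_trans (ler_norm_sum _ _ _) _.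
  have := @sum_inv_sqrt3_le R 1 n isT; rewrite sqrtr1 divr1.
  have tt : 0 <= t ^+ 2 + t by rewrite addr_ge0 ?sqr_ge0.
  move=> /(ler_wpM2l tt); rewrite [X in _ <= X]mulrC; apply: le_trans.
  rewrite add1n big_distrr/= big_nat [leRHS]big_nat; apply: ler_sum => k /andP[k0 _].
  have s0 : 0 < Num.sqrt k%:R :> R by rewrite sqrtr_gt0 ltr0n.
  have s2 : Num.sqrt k%:R ^+ 2 = k%:R :> R by rewrite sqr_sqrtr.
  rewrite normrM ger0_norm//.
  have k0' : 0 < k%:R :> R by rewrite ltr0n.
  have H : `|F (t * v k.+1) - F (t * v k) - t * k%:R^-1 * G (t * v k)|
      <= (t ^+ 2 + t) * (k%:R ^+ 2)^-1.
    have /andP[d0 d1] := @ln_succ_le R k k0; rewrite -/(v k) -/(v k.+1) in d0 d1.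
    have tv : t * v k <= t * v k.+1 by rewrite ler_wpM2l// vinc.
    have h1 := taylor1 dF GL tv.
    have h2 := @ln_succ_approx k k0; rewrite -/(v k) -/(v k.+1) in h2.
    have -> : F (t * v k.+1) - F (t * v k) - t * k%:R^-1 * G (t * v k) =
      (F (t * v k.+1) - F (t * v k) - G (t * v k) * (t * v k.+1 - t * v k)) +
      G (t * v k) * (t * (v k.+1 - v k - k%:R^-1)) by ring.
    apply: le_trans (ler_normD _ _) _; rewrite [leRHS]mulrDl; apply: lerD.
      apply: le_trans h1 _; rewrite -mulrBr exprMn ler_wpM2l ?sqr_ge0//.
      by rewrite -exprVn lerXn2r ?nnegrE ?invr_ge0.
    rewrite normrM -[leRHS]mul1r ler_pM// normrM t0' ler_wpM2l//.
  apply: le_trans (ler_wpM2l (p0 k) H) _.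
  rewrite mulrCA ler_wpM2l//.
  apply: le_trans (ler_wpM2r _ (pS k k0)) _; first by rewrite invr_ge0 sqr_ge0.
  rewrite -[X in (X ^+ 2)^-1]s2 exprS.
  move: s0; set s := Num.sqrt _ => s0.
  by rewrite le_eqVlt; apply/orP; left; apply/eqP; field; rewrite gt_eqF.
apply: le_trans (lerD (lerD (lerD (nF n.+1 _ isT) (nF 1%N _ isT)) S1) S2) _.
by rewrite /P; lra.
Qed.

End Osc.

(** * From alternating sums to iterated averages of eta *)

Section Averaging.
Variable R : realType.
Implicit Types (w : nat -> R) (F G : R -> R) (l t d : R) (n k : nat).

Lemma alternating_sum_double (f : nat -> R) n :
  \sum_(1 <= k < (2 * n).+1) (-1) ^+ k.-1 * f k =
  \sum_(1 <= k < (2 * n).+1) f k - 2 * \sum_(1 <= k < n.+1) f (2 * k)%N.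
Proof.
elim: n => [|n IH]; first by rewrite !big_geq// mulr0 subr0.
have -> : (2 * n.+1 = (2 * n).+2)%N by lia.
rewrite [LHS]big_nat_recr//= [X in X + _]big_nat_recr//= IH.
rewrite [X in _ = X - _]big_nat_recr//= [X in _ = X + _ - _]big_nat_recr//=.
rewrite [X in _ = _ - 2 * X]big_nat_recr//=.
have -> : (2 * n.+1 = (2 * n).+2)%N by lia.
by rewrite exprS exprM sqrrN !expr1n; ring.
Qed.

Lemma gw_double l k : (0 < k)%N ->
  gw (l + ln 2) (2 * k)%N = (Num.sqrt 2)^-1 * gw l k.
Proof.
move=> k0; rewrite /gw natrM lnM ?posrE ?ltr0n// powRM ?ler0n//.
rewrite powRN powR12_sqrt// -mulrA; congr (_ * (_ * expR (- _ ^+ 2))); ring.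
Qed.

Lemma sqrt2_gt0 : 0 < Num.sqrt 2 :> R. Proof. by rewrite sqrtr_gt0. Qed.

Lemma wsum_alt_double F l n t :
  wsum (alt (gw (l + ln 2))) F (2 * n) t =
  wsum (gw (l + ln 2)) F (2 * n) t -
  Num.sqrt 2 * wsum (gw l) (fun x => F (t * ln 2 + x)) n t.
Proof.
have s0 := sqrt2_gt0; have s2 : Num.sqrt 2 ^+ 2 = 2 :> R by rewrite sqr_sqrtr.
rewrite /wsum /alt; under eq_bigr do rewrite -mulrA.
rewrite alternating_sum_double; congr (_ - _).
rewrite !big_distrr/= big_nat [RHS]big_nat; apply: eq_bigr => k /andP[k0 _].
rewrite gw_double// natrM lnM ?posrE ?ltr0n// mulrDr -{1}s2.
by field; rewrite gt_eqF.
Qed.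

(** The factor 2^(-it) rotates the pair formed by the cosine and sine sums by the angle t ln 2,
    which leaves its length unchanged. The rest is the triangle inequality. *)
Lemma sqrt_wsq_double l n t :
  Num.sqrt 2 * Num.sqrt (wsq (gw l) n t) <=
  Num.sqrt (wsq (gw (l + ln 2)) (2 * n) t) +
  Num.sqrt (wsq (alt (gw (l + ln 2))) (2 * n) t).
Proof.
have s0 := sqrt2_gt0; have s2 : Num.sqrt 2 ^+ 2 = 2 :> R by rewrite sqr_sqrtr.
rewrite {3}/wsq !wsum_alt_double.
pose c := cos (t * ln 2); pose s := sin (t * ln 2).
have cs : c ^+ 2 + s ^+ 2 = 1 := cos2Dsin2 _.
have E1 : wsum (gw l) (fun x => cos (t * ln 2 + x)) n t =
    c * wsum (gw l) cos n t - s * wsum (gw l) sin n t.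
  rewrite /wsum !big_distrr -sumrB; apply: eq_bigr => k _; rewrite /= cosD /c /s; ring.
have E2 : wsum (gw l) (fun x => sin (t * ln 2 + x)) n t =
    s * wsum (gw l) cos n t + c * wsum (gw l) sin n t.
  rewrite /wsum !big_distrr -big_split; apply: eq_bigr => k _; rewrite /= sinD /c /s; ring.
rewrite E1 E2 /wsq; set x := wsum _ cos n t; set y := wsum _ sin n t.
set a := wsum _ cos _ _; set b := wsum _ sin _ _; set q := Num.sqrt 2 in s0 s2 *.
have -> : q * Num.sqrt (x ^+ 2 + y ^+ 2) =
    Num.sqrt ((q * (c * x - s * y)) ^+ 2 + (q * (s * x + c * y)) ^+ 2).
  rewrite -[q in LHS]ger0_norm ?(ltW s0)// -sqrtr_sqr -sqrtrM ?sqr_ge0//; congr Num.sqrt.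
  by rewrite -[LHS]mulr1 -[X in _ * X = _]cs; ring.
have H := hypot_triangle a b (- (a - q * (c * x - s * y))) (- (b - q * (s * x + c * y))).
have e1 (u v : R) : u - (u - v) = v by ring.
by rewrite !e1 !sqrrN in H.
Qed.

(* Iterates, in the l^2 norm of (cos, sin) parts,
   [sum at 2D] = [alternating sum at 2D] + sqrt 2 * 2^(-it) [sum at D],
   solved for the sum at [D]: each step gains the factor [1 / sqrt 2]. *)
Lemma sqrt_wsq_iter l n t (K : nat) (al : R) : 0 <= al ->
  (forall k, (k < K)%N ->
     Num.sqrt (wsq (alt (gw (l + k.+1%:R * ln 2))) (2 ^ k.+1 * n) t) <= al) ->
  Num.sqrt (wsq (gw l) n t) <=
  (Num.sqrt 2)^-1 ^+ K * Num.sqrt (wsq (gw (l + K%:R * ln 2)) (2 ^ K * n) t)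
  + 3 * al * (1 - (Num.sqrt 2)^-1 ^+ K).
Proof.
move=> al0; have s0 := sqrt2_gt0; have s2 : Num.sqrt 2 ^+ 2 = 2 :> R by rewrite sqr_sqrtr.
(* With r = 1 / sqrt 2, the bound r <= 3/4 means r al <= 3 al (1 - r), so that 3 al (1 - r^K)
   absorbs the new alternating sum at each step. *)
have r34 : (Num.sqrt 2)^-1 <= 3 / 4 :> R.
  by rewrite -[leLHS]mulr1 ler_pdivrMl//; nra.
elim: K => [|K IH] H; first by rewrite !expr0 mul0r addr0 expn0 mul1n; lra.
have r0 : 0 < (Num.sqrt 2)^-1 :> R by rewrite invr_gt0.
apply: le_trans (IH _) _; first by move=> k kK; apply: H; exact: ltnW.
have := sqrt_wsq_double (l + K%:R * ln 2) (2 ^ K * n) t.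
have := H K (ltnSn _).
have -> : l + K%:R * ln 2 + ln 2 = l + K.+1%:R * ln 2 by rewrite -natr1; ring.
rewrite mulnA -expnS; set h := Num.sqrt (wsq (gw (l + K%:R * _)) _ _).
set h' := Num.sqrt (wsq (gw (l + K.+1%:R * _)) _ _); set a := Num.sqrt (wsq _ _ _).
rewrite -ler_pdivlMl// => ha hh; rewrite exprS.
have rK : 0 <= (Num.sqrt 2)^-1 ^+ K :> R by rewrite exprn_ge0// ltW.
move: hh; set r := (Num.sqrt 2)^-1 in r34 r0 rK *; set u := r ^+ K in rK *.
move=> hh; have hh' : h <= r * h' + r * al by nra.
have : u * h <= u * (r * h' + r * al) by rewrite ler_wpM2l.
have : u * al * r <= u * al * (3 / 4) by rewrite ler_wpM2l// mulr_ge0.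
have : 3 * u * al * r <= 3 * u * al * (3 / 4) by rewrite ler_wpM2l// !mulr_ge0.
nra.
Qed.

Definition avg d (f : R -> R) : R -> R := fun t => (f (t - d) + f (t + d)) / 2.

Lemma avg_iter_le d (f g : R -> R) r : (forall t, f t <= g t) ->
  forall t, iter r (avg d) f t <= iter r (avg d) g t.
Proof.
move=> fg; elim: r => [//|r IH] t /=; rewrite /avg.
by have := IH (t - d); have := IH (t + d); lra.
Qed.

Lemma avg_iter_lin d (f g : R -> R) (a b : R) r t :
  iter r (avg d) (fun t => a * f t + b * g t) t =
  a * iter r (avg d) f t + b * iter r (avg d) g t.
Proof. by elim: r t => [//|r IH] t /=; rewrite /avg !IH; ring. Qed.

Lemma avg_iter_cst d (a : R) r t : iter r (avg d) (fun=> a) t = a.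
Proof. by elim: r t => [//|r IH] t /=; rewrite /avg !IH; field. Qed.

Lemma continuous_avg_iter d (f : R -> R) r : continuous f ->
  continuous (iter r (avg d) f).
Proof.
move=> cf; elim: r => [//|r IH] t /=.
have sh (e : R) : {for t, continuous (fun x => iter r (avg d) f (x + e))}.
  by apply: continuous_comp; [apply: cvgD; [exact: cvg_id|exact: cvg_cst]|exact: IH].
by apply: cvgM; [apply: cvgD; exact: sh|exact: cvg_cst].
Qed.

(** The hyperbolic cosine. It is an eigenfunction of [avg d] with eigenvalue [ch d], so a bound by a
    multiple of [ch] survives any number of averages. *)
Definition ch (x : R) : R := (expR x + expR (- x)) / 2.

Lemma ch_gt0 x : 0 < ch x.
Proof. by rewrite divr_gt0 ?addr_gt0 ?expR_gt0. Qed.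

Lemma avg_iter_ch d r t : iter r (avg d) ch t = ch d ^+ r * ch t.
Proof.
elim: r t => [|r IH] t /=; first by rewrite mul1r.
by rewrite /avg !IH exprS /ch opprB opprD !expRD; field.
Qed.

Lemma expR_le_quad (x : R) : x <= 1 / 2 -> expR x <= 1 + x + 2 * x ^+ 2.
Proof.
move=> x2; have := expR_ge1Dx (- x); have e0 := expR_gt0 x => H.
have : (1 - x) * expR x <= 1.
  have := ler_wpM2r (ltW e0) H.
  by rewrite -[X in _ <= X -> _]expRD addNr expR0.
move=> H1; have h2 : 0 < 1 - x by lra.
rewrite -(ler_pM2l h2); apply: le_trans H1 _; nra.
Qed.

Lemma ch_le (d : R) : `|d| <= 1 / 2 -> ch d <= expR (2 * d ^+ 2).
Proof.
rewrite ler_norml => /andP[d1 d2]; apply: le_trans (expR_ge1Dx _).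
have := @expR_le_quad d; have := @expR_le_quad (- d); rewrite /ch; nra.
Qed.

Definition bw d l r k : R := k%:R `^ (- 2^-1) * cos (d * (ln k%:R - l)) ^+ r.

(** The addition formulas are abstracted so that (cos, sin) and (sin, -cos) are instances. The
    factor cos(d (ln k - l)) shifts t by -d and d and rotates the sums by angles of size d l. *)
Lemma wsum_bw_step F G d l r n t :
  (forall x y, F (x - y) = cos y * F x + sin y * G x) ->
  (forall x y, F (x + y) = cos y * F x - sin y * G x) ->
  wsum (alt (bw d l r.+1)) F n t =
  ((cos (d * l) * wsum (alt (bw d l r)) F n (t - d)
    - sin (d * l) * wsum (alt (bw d l r)) G n (t - d)) +
   (cos (d * l) * wsum (alt (bw d l r)) F n (t + d)
    + sin (d * l) * wsum (alt (bw d l r)) G n (t + d))) / 2.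
Proof.
move=> FB FD.
have H (v : R) : cos (d * (v - l)) * F (t * v) =
   ((cos (d * l) * F ((t - d) * v) - sin (d * l) * G ((t - d) * v)) +
    (cos (d * l) * F ((t + d) * v) + sin (d * l) * G ((t + d) * v))) / 2.
  rewrite -FD -FB.
  have -> : (t - d) * v + d * l = t * v - d * (v - l) by ring.
  have -> : (t + d) * v - d * l = t * v + d * (v - l) by ring.
  by rewrite FB FD; field.
rewrite /wsum !big_distrr/= -sumrB -!big_split big_distrl/=.
apply: eq_bigr => k _; rewrite /alt /bw exprSr.
rewrite [LHS](_ : _ = (-1) ^+ k.-1 * (k%:R `^ (- 2^-1) * cos (d * (ln k%:R - l)) ^+ r)
  * (cos (d * (ln k%:R - l)) * F (t * ln k%:R))); last by ring.
by rewrite H; ring.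
Qed.

(** The rotations by d l do not change moduli, and the square modulus of a mean is at most the mean
    of the square moduli. *)
Lemma wsq_bw_step d l r n t :
  wsq (alt (bw d l r.+1)) n t <= avg d (wsq (alt (bw d l r)) n) t.
Proof.
rewrite /wsq (@wsum_bw_step cos (fun x => sin x)); first last.
- by move=> x y; rewrite cosD; ring.
- by move=> x y; rewrite cosB; ring.
rewrite (@wsum_bw_step sin (fun x => - cos x)); first last.
- by move=> x y; rewrite sinD; ring.
- by move=> x y; rewrite sinB; ring.
have N u : wsum (alt (bw d l r)) (fun x => - cos x) n u = - wsum (alt (bw d l r)) cos n u.
  by rewrite /wsum -sumrN; apply: eq_bigr => k _; rewrite mulrN.
rewrite !N /avg /=.
have := cos2Dsin2 (d * l); set c := cos _; set s := sin _ => cs.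
move: (wsum _ _ _ _) (wsum _ _ _ _) (wsum _ _ _ _) (wsum _ _ _ _) => x y z w.
have H (p q : R) : ((p + q) / 2) ^+ 2 <= (p ^+ 2 + q ^+ 2) / 2.
  by have := sqr_ge0 (p - q); nra.
apply: le_trans (lerD (H _ _) (H _ _)) _.
by rewrite le_eqVlt; apply/orP; left; apply/eqP; rewrite -[RHS]mul1r -[X in _ = X * _]cs; field.
Qed.

Lemma wsq_bw_le d l r n t :
  wsq (alt (bw d l r)) n t <= iter r (avg d) (etasq_part n) t.
Proof.
elim: r t => [|r IH] t /=.
  rewrite le_eqVlt; apply/orP; left; apply/eqP; rewrite /etasq_part /osc.
  by congr (_ ^+ 2 + _ ^+ 2); apply: eq_bigr => k _; rewrite /alt /bw mulr1.
apply: le_trans (wsq_bw_step d l r n t) _; rewrite /avg.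
by have := IH (t - d); have := IH (t + d); lra.
Qed.

End Averaging.

(** * Gaussian weights as limits of powers of cosines *)

Section GaussLimit.
Variable R : realType.
Implicit Types (w : nat -> R) (F G : R -> R) (l t d : R) (n k : nat).

(** The step for 2(q + 1) averages, scaled so that (q + 1) [dq q] ^ 2 = 1: then cos(dq v)^(2(q+1))
    tends to exp(-v^2), while the total spread of the shifts stays bounded in mean square. *)
Definition dq (q : nat) : R := (Num.sqrt q.+1%:R)^-1.

Lemma dq_gt0 q : 0 < dq q.
Proof. by rewrite invr_gt0 sqrtr_gt0 ltr0n. Qed.

Lemma dq_sqr q : q.+1%:R * dq q ^+ 2 = 1.
Proof. by rewrite exprVn sqr_sqrtr ?ler0n// divff// pnatr_eq0. Qed.

Lemma dq_cvg0 : dq q @[q --> \oo] --> (0 : R).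
Proof.
have := inv_sqrt_cvg0 (1 : R); apply: cvg_trans; apply: near_eq_cvg.
by near=> n; rewrite mul1r.
Unshelve. all: by end_near. Qed.

Lemma one_sub_ge_expR (s : R) : 0 <= s -> s <= 1 / 2 ->
  expR (- (s + 2 * s ^+ 2)) <= 1 - s.
Proof.
move=> s0 s2; have := expR_ge1Dx (s + 2 * s ^+ 2).
have e0 := expR_gt0 (s + 2 * s ^+ 2); have e1 := expR_gt0 (- (s + 2 * s ^+ 2)).
move=> H; rewrite -(ler_pM2r e0) -expRD addNr expR0.
have h2 : 0 <= 1 - s by lra.
apply: le_trans (ler_wpM2l h2 H); nra.
Qed.

Lemma sin_sqr_bounds (x : R) : 0 <= x -> x <= 1 ->
  x ^+ 2 - 2 * x ^+ 3 <= sin x ^+ 2 <= x ^+ 2.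
Proof.
move=> x0 x1; have := normr_sin_le x => /sqr_le_norm ->; rewrite andbT.
have := @taylor1 R sin cos (fun x => is_derive_sin x) (@cos_lip R) 0 x x0.
rewrite sin0 cos0 !subr0 mul1r ler_norml => /andP[h _].
have h1 : x - x ^+ 2 <= sin x by lra.
have h2 : 0 <= x - x ^+ 2 by nra.
have : (x - x ^+ 2) ^+ 2 <= sin x ^+ 2 by rewrite lerXn2r// nnegrE// (le_trans h2).
have : 0 <= x ^+ 4 by rewrite exprn_ge0.
nra.
Qed.

(** The even power is (1 - sin^2)^(q+1). Comparing 1 - s with exponentials and sin x with x turns
    both sides into exp(-v^2) up to errors that vanish with [dq q]. *)
Lemma cos_pow_bounds (v : R) q : 0 <= v -> v * dq q <= 1 / 2 ->
  expR (- (v ^+ 2 + 2 * v ^+ 4 * dq q ^+ 2)) <= cos (dq q * v) ^+ (2 * q.+1)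
  <= expR (- v ^+ 2 + 2 * v ^+ 3 * dq q).
Proof.
move=> v0 vq; have d0 := dq_gt0 q; have dN := dq_sqr q.
set x := dq q * v; have x0 : 0 <= x by rewrite mulr_ge0 ?(ltW d0).
have x12 : x <= 1 / 2 by rewrite /x mulrC.
have x1 : x <= 1 by lra.
have /andP[s1 s2] := sin_sqr_bounds x0 x1.
have -> : cos x ^+ (2 * q.+1) = (1 - sin x ^+ 2) ^+ q.+1 by rewrite exprM cos2sin2.
set s := sin x ^+ 2 in s1 s2 *; have s0 : 0 <= s by exact: sqr_ge0.
have sx : s <= 1 / 4 by nra.
have x2 : q.+1%:R * x ^+ 2 = v ^+ 2 by rewrite exprMn mulrA dN mul1r.
have x3 : q.+1%:R * x ^+ 3 = v ^+ 3 * dq q.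
  by rewrite exprS mulrCA x2 /x; ring.
have x4 : q.+1%:R * x ^+ 4 = v ^+ 4 * dq q ^+ 2.
  by rewrite (_ : x ^+ 4 = x ^+ 2 * x ^+ 2); [rewrite mulrA x2 /x; ring|ring].
have N0 : 0 <= q.+1%:R :> R by rewrite ler0n.
apply/andP; split.
  apply: (@le_trans _ _ (expR (- (s + 2 * s ^+ 2)) ^+ q.+1)).
    rewrite -expRM_natl ler_expR mulrN lerN2.
    have : s + 2 * s ^+ 2 <= x ^+ 2 + 2 * x ^+ 4.
      have : s ^+ 2 <= x ^+ 4.
        have -> : x ^+ 4 = (x ^+ 2) ^+ 2 by ring.
        by rewrite lerXn2r ?nnegrE ?sqr_ge0.
      by lra.
    move=> /(ler_wpM2l N0).
    have -> : q.+1%:R * (x ^+ 2 + 2 * x ^+ 4) = q.+1%:R * x ^+ 2 + 2 * (q.+1%:R * x ^+ 4) by ring.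
    by rewrite x2 x4; lra.
  apply: lerXn2r; rewrite ?nnegrE ?expR_ge0//; first by lra.
  by apply: one_sub_ge_expR => //; lra.
apply: (@le_trans _ _ (expR (- s) ^+ q.+1)).
  apply: lerXn2r; rewrite ?nnegrE ?expR_ge0//; first by lra.
  exact: expR_ge1Dx.
rewrite -expRM_natl ler_expR mulrN.
have := ler_wpM2l N0 s1.
have -> : q.+1%:R * (x ^+ 2 - 2 * x ^+ 3) = q.+1%:R * x ^+ 2 - 2 * (q.+1%:R * x ^+ 3) by ring.
by rewrite x2 x3; lra.
Qed.

Lemma cos_pow_cvg (v : R) : cos (dq q * v) ^+ (2 * q.+1) @[q --> \oo] --> expR (- v ^+ 2).
Proof.
wlog v0 : v / 0 <= v => [H|].
  have [|/ltW v0] := leP 0 v; first exact: H.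
  have := H (- v); rewrite oppr_ge0 sqrrN => /(_ v0).
  by under eq_fun do rewrite mulrN cosN.
have H1 : expR (- (v ^+ 2 + 2 * v ^+ 4 * dq q ^+ 2)) @[q --> \oo] --> expR (- v ^+ 2).
  rewrite -[X in _ --> expR (- X)]addr0 -[X in _ --> expR (- (_ + X))](mulr0 (2 * v ^+ 4)).
  rewrite -[X in _ --> expR (- (_ + _ * X))](mulr0 (0 : R)).
  apply: continuous_cvg; first exact: continuous_expR.
  apply: cvgN; apply: cvgD; first exact: cvg_cst.
  apply: cvgM; first exact: cvg_cst.
  by under eq_fun do rewrite expr2; apply: cvgM; exact: dq_cvg0.
have H2 : expR (- v ^+ 2 + 2 * v ^+ 3 * dq q) @[q --> \oo] --> expR (- v ^+ 2).
  rewrite -[X in _ --> expR X]addr0 -[X in _ --> expR (_ + X)](mulr0 (2 * v ^+ 3)).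
  apply: continuous_cvg; first exact: continuous_expR.
  apply: cvgD; first exact: cvg_cst.
  by apply: cvgM; [exact: cvg_cst|exact: dq_cvg0].
apply: squeeze_cvgr H1 H2; near=> q; apply: cos_pow_bounds => //.
have : `|0 - v * dq q| <= 1 / 2; last by rewrite sub0r normrN; apply: le_trans (ler_norm _).
near: q; apply: cvgr_dist_le; last by [].
by rewrite -[X in _ --> X](mulr0 v); apply: cvgM; [exact: cvg_cst|exact: dq_cvg0].
Unshelve. all: by end_near. Qed.

(* [cos (x / sqrt q) ^ (2 q) --> exp (- x^2)] *)
Lemma gw_approx l n (e : R) : 0 < e -> \forall q \near \oo,
  \sum_(1 <= k < n.+1) `|gw l k - bw (dq q) l (2 * q.+1) k| <= e.
Proof.
move=> e0; suff H : (fun q => \sum_(1 <= k < n.+1) `|gw l k - bw (dq q) l (2 * q.+1) k|)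
    @ \oo --> (0 : R).
  near=> q; apply: le_trans (ler_norm _) _.
  by rewrite -normrN -sub0r; near: q; apply: cvgr_dist_le.
elim: n => [|n IH].
  by under eq_fun do rewrite big_geq//; exact: cvg_cst.
have C : (fun q => `|gw l n.+1 - bw (dq q) l (2 * q.+1) n.+1|) @ \oo --> (0 : R).
  rewrite -(normr0 R) -(subrr (gw l n.+1)); apply: cvg_norm; apply: cvgB; first exact: cvg_cst.
  by apply: cvgM; [exact: cvg_cst|exact: cos_pow_cvg].
under eq_fun do rewrite big_nat_recr//=.
have := cvgD IH C; rewrite addr0. exact.
Unshelve. all: by end_near. Qed.

Lemma wsq_alt_close w w' n t :
  wsq (alt w) n t <= 2 * wsq (alt w') n t + 4 * (\sum_(1 <= k < n.+1) `|w k - w' k|) ^+ 2.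
Proof.
have H F : (forall x, `|F x| <= 1) -> wsum (alt w) F n t ^+ 2 <=
    2 * wsum (alt w') F n t ^+ 2 + 2 * (\sum_(1 <= k < n.+1) `|w k - w' k|) ^+ 2.
  move=> F1; set S := \sum_(_ <= _ < _) _.
  have : (wsum (alt w) F n t - wsum (alt w') F n t) ^+ 2 <= S ^+ 2.
    apply: sqr_le_norm; rewrite (ger0_norm (x := S)) ?sumr_ge0//.
    rewrite /wsum -sumrB; apply: le_trans (ler_norm_sum _ _ _) _.
    apply: ler_sum => k _; rewrite -mulrBl /alt -mulrBr !normrM normrX normrN1 expr1n mul1r.
    by rewrite -[leRHS]mulr1 ler_wpM2l.
  by have := sqr_ge0 (wsum (alt w) F n t - 2 * wsum (alt w') F n t); nra.
by rewrite /wsq; have := H cos (@cos_max R); have := H sin (@sin_max R); lra.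
Qed.

(** Puts the polynomial truncation error of the eta series in a form that can be averaged
    exactly. *)
Lemma abs_sqr_le_ch t : (1 + `|t|) ^+ 2 <= 8 * ch t.
Proof.
have H : expR `|t| <= 2 * ch t.
  rewrite /ch; have h1 := expR_ge0 t; have h2 := expR_ge0 (- t).
  by case: (ger0P t) => _; lra.
have : (1 + `|t| / 2) ^+ 2 <= expR `|t|.
  have -> : expR `|t| = expR (`|t| / 2) ^+ 2 by rewrite -expRM_natl mulrC divfK.
  by rewrite lerXn2r ?nnegrE ?expR_ge0 ?expR_ge1Dx// addr_ge0// divr_ge0.
by have := normr_ge0 t; nra.
Qed.

(** Since ch d <= exp(2 d^2) for |d| <= 1/2 and the squared steps add up to 2, the eigenvalue after
    all averages is at most e^4 <= 3^4, uniformly in q. *)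
Lemma ch_dq_pow q : (4 <= q.+1)%N -> ch (dq q) ^+ (2 * q.+1) <= 81.
Proof.
move=> q4; have d0 := dq_gt0 q; have dN := dq_sqr q.
have N4 : 4 <= q.+1%:R :> R by rewrite ler_nat.
have d12 : dq q <= 1 / 2 by nra.
apply: (@le_trans _ _ (expR (2 * dq q ^+ 2) ^+ (2 * q.+1))).
  apply: lerXn2r; rewrite ?nnegrE ?expR_ge0 ?(ltW (ch_gt0 _))//.
  by apply: ch_le; rewrite gtr0_norm.
rewrite -expRM_natl natrM.
have -> : 2 * q.+1%:R * (2 * dq q ^+ 2) = 4%:R * 1 :> R.
  by rewrite -[X in _ = _ * X]dN; ring.
rewrite expRM_natl; apply: (@le_trans _ _ (3 ^+ 4)); last by lra.
by apply: lerXn2r; rewrite ?nnegrE ?expR_ge0// expR1_le3.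
Qed.

Lemma ch_le_mono (x y : R) : 0 <= x -> x <= y -> ch x <= 2 * ch y.
Proof.
move=> x0 xy; rewrite /ch.
have h1 : expR x <= expR y by rewrite ler_expR.
have h2 : expR (- x) <= expR x by rewrite ler_expR; lra.
have h3 := expR_ge0 (- y); lra.
Qed.


Definition etaavg (q : nat) : R -> R := iter (2 * q.+1) (avg (dq q)) (@etasq R).

Lemma wsq_alt_gw_le l n q (e : R) t : (4 <= q.+1)%N -> 0 <= e ->
  \sum_(1 <= k < n.+1) `|gw l k - bw (dq q) l (2 * q.+1) k| <= e ->
  wsq (alt (gw l)) n t <=
  4 * etaavg q t + 2 * (800 / n.+1%:R * (81 * ch t)) + 4 * e ^+ 2.
Proof.
move=> q4 e0 he; apply: le_trans (wsq_alt_close _ (bw (dq q) l (2 * q.+1)) _ _) _.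
apply: lerD; last by rewrite ler_wpM2l// lerXn2r ?nnegrE// sumr_ge0.
have h2 : wsq (alt (bw (dq q) l (2 * q.+1))) n t <= 2 * etaavg q t +
    800 / n.+1%:R * (ch (dq q) ^+ (2 * q.+1) * ch t).
  apply: le_trans (wsq_bw_le (dq q) l (2 * q.+1) n t) _.
  rewrite -avg_iter_ch -avg_iter_lin; apply: avg_iter_le => x.
  apply: le_trans (etasq_part_le n x) _; rewrite lerD2l.
  rewrite [leRHS]mulrAC ler_wpM2r ?invr_ge0//.
  by have := abs_sqr_le_ch x; lra.
have h3 : 800 / n.+1%:R * (ch (dq q) ^+ (2 * q.+1) * ch t) <=
    800 / n.+1%:R * (81 * ch t).
  apply: ler_wpM2l; first by apply: divr_ge0; exact: ler0n.
  by apply: ler_wpM2r (ch_dq_pow q4); exact: ltW (ch_gt0 t).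
have := ler_wpM2l (ler0n R 2) (le_trans h2 (lerD (lexx _) h3)).
move: (800 / _ * (81 * _)) (etaavg q t) => u v; lra.
Qed.

(** Used at X = 2^K D, then divided by 2^(K/2): the first term becomes 16 sqrt D / t, the trace of
    the pole of zeta, and the second, free of X, vanishes as K grows. *)
Lemma wsq_gw_large (X n : nat) t : (0 < X)%N -> 1 <= t ->
  Num.sqrt (wsq (gw (ln X%:R)) n t) <= 16 * Num.sqrt X%:R / t + 32 * t.
Proof.
move=> X0 t1; have t0 : 0 < t by lra.
have h1 := @wsum_gw_bound R sin cos X n t (@sin_max R) (@cos_max R)
  (fun x => is_derive_sin x) (@cos_lip R) X0 (ltW t0).
have h2 : t * `|wsum (gw (ln X%:R)) sin n t| <= 8 * Num.sqrt X%:R + 8 * (t ^+ 2 + t).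
  apply: (@wsum_gw_bound R (fun x => - cos x) sin) => //.
  - by move=> x; rewrite normrN cos_max.
  - by move=> x; exact: sin_max.
  - move=> x; have H := is_deriveN (is_derive_cos x).
    by rewrite opprK in H.
  - exact: sin_lip.
  - exact: ltW.
rewrite -ler_pdivlMl// in h1; rewrite -ler_pdivlMl// in h2.
set a := wsum _ _ _ _ in h1; set b := wsum _ _ _ _ in h2.
have h3 : Num.sqrt (wsq (gw (ln X%:R)) n t) <= `|a| + `|b|.
  rewrite -[leRHS]ger0_norm ?addr_ge0// -sqrtr_sqr ler_wsqrtr//.
  rewrite sqrrD !real_normK ?num_real// /wsq -/a -/b.
  by have := mulr_ge0 (normr_ge0 a) (normr_ge0 b); lra.
apply: le_trans h3 _; apply: le_trans (lerD h1 h2) _.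
have -> : t^-1 * (8 * Num.sqrt X%:R + 8 * (t ^+ 2 + t)) = 8 * Num.sqrt X%:R / t + 8 * (t + 1).
  by field; rewrite gt_eqF.
by rewrite -!mulrA; lra.
Qed.

End GaussLimit.

(** * The smoothed sum bounded by averages of eta *)

Section SmoothSumBound.
Variable R : realType.
Implicit Types (l t d : R) (n k : nat).

Lemma near_forall_lt (K : nat) (P : nat -> nat -> Prop) :
  (forall k, (k < K)%N -> \forall q \near \oo, P k q) ->
  \forall q \near \oo, forall k, (k < K)%N -> P k q.
Proof.
elim: K => [|K IH] H; first by near=> q.
have H1 := IH (fun k kK => H k (ltnW kK)); have H2 := H K (ltnSn K).
near=> q => k; rewrite ltnS leq_eqVlt => /predU1P[->|kK].
  by near: q.
by move: k kK; near: q.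
Unshelve. all: by end_near. Qed.

Lemma sqrt_pow2M (K D : nat) :
  Num.sqrt (2 ^ K * D)%:R = Num.sqrt 2 ^+ K * Num.sqrt D%:R :> R.
Proof.
rewrite natrM natrX sqrtrM ?exprn_ge0//; congr (_ * _).
elim: K => [|K IH]; first by rewrite !expr0 sqrtr1.
by rewrite !exprS sqrtrM// IH.
Qed.

Lemma ln_pow2M (K D : nat) : (0 < D)%N ->
  ln D%:R + K%:R * ln 2 = ln (2 ^ K * D)%:R :> R.
Proof.
move=> D0; rewrite natrM natrX lnM ?posrE ?exprn_gt0 ?ltr0n// lnXn//.
by rewrite addrC mulr_natl.
Qed.

Lemma etaavg_ge0 q t : 0 <= etaavg q t :> R.
Proof.
have := @avg_iter_le R (dq R q) (fun=> 0) (@etasq R) (2 * q.+1) (@etasq_ge0 R) t.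
by rewrite avg_iter_cst.
Qed.

(** The term D / (1 + t)^2 accounts for the pole of zeta. The truncation n and the number of
    averages depend on D and T, but the constant does not, and every truncation error is absorbed by
    the pole term, which is at least (1 + T)^(-2). *)
Lemma smooth_sum_bound : exists2 c : R, 0 <= c & forall (D : nat) (T : R),
  (0 < D)%N -> 1 <= T -> exists n q : nat,
  [/\ (2 * D <= n)%N, (4 <= q.+1)%N & forall t, 0 <= t -> t <= T ->
    wsq (gw (ln D%:R)) n t <= c * (etaavg q t + D%:R / (1 + t) ^+ 2)].
Proof.
have [c1 c1E] : exists c : R, c = 2 * 33 ^+ 2 + 36 by eexists.
have [c2 c2E] : exists c : R, c = 8 * 26 ^+ 2 by eexists.
have c10 : 0 <= c1 by rewrite c1E addr_ge0 ?mulr_ge0 ?sqr_ge0.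
have c20 : 0 <= c2 by rewrite c2E mulr_ge0 ?sqr_ge0.
exists (c1 + c2 + 72); first by rewrite !addr_ge0.
move=> D T D0 T1; have s0 := sqrt2_gt0 R.
have T0 : 0 < 1 + T by lra.
set B := (1 + T)^-1; have B0 : 0 < B by rewrite invr_gt0.
have r1 : `|(Num.sqrt 2)^-1| < 1 :> R.
  by rewrite gtr0_norm ?invr_gt0// invf_lt1// -[ltLHS]sqrtr1 ltr_sqrt// ltr1n.
(* Enough doublings to push the X-free term of [wsq_gw_large] below [B], itself at most sqrt D / (1
   + t) for t <= T. *)
have [K rK] : exists K, 32 * T * (Num.sqrt 2)^-1 ^+ K <= B.
  have /cvgrPdist_le/(_ (B / (32 * T))) := cvg_expr r1.
  have B1 : 0 < B / (32 * T) by rewrite divr_gt0// mulr_gt0//; lra.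
  move=> /(_ B1) [K _ /(_ K (leqnn K))/=]; rewrite sub0r normrN => /(le_trans (ler_norm _)) H.
  exists K; rewrite mulrC -ler_pdivlMr//.
  by rewrite mulr_gt0//; lra.
(* For n >= M the truncation error of the eta sums is at most [B ^+ 2] for all t in [0, T], where ch
   t <= 2 ch T. *)
pose M : R := 2 * (800 * (81 * (2 * ch T))) / B ^+ 2.
pose n := maxn (2 * D) (Num.truncn M).+1.
have nM : M <= n%:R.
  apply: ltW; apply: lt_le_trans (truncnS_gt M) _.
  by rewrite ler_nat leq_maxr.
have n0 : (0 < n)%N by rewrite /n; lia.
pose e := B / 2; have e0 : 0 < e by rewrite divr_gt0.
pose L k : R := ln D%:R + k.+1%:R * ln 2.
have [q [qK q4]] : exists q, (forall k, (k < K)%N ->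
    \sum_(1 <= j < (2 ^ k.+1 * n).+1) `|gw (L k) j - bw (dq R q) (L k) (2 * q.+1) j| <= e)
    /\ (4 <= q.+1)%N.
  have H := @near_forall_lt K _ (fun k _ => @gw_approx R (L k) (2 ^ k.+1 * n) e e0).
  have H4 : \forall q \near \oo, (4 <= q.+1)%N by exists 4%N => // q /= q4; exact: ltnW.
  by have [q ?] := filter_ex (filterI H H4); exists q.
exists n, q; split=> //; first by rewrite leq_maxl.
move=> t t0 tT.
have D1 : 1 <= D%:R :> R by rewrite ler1n.
have sD : 1 <= Num.sqrt D%:R :> R by rewrite -[leLHS]sqrtr1 ler_wsqrtr.
have sD2 : Num.sqrt D%:R ^+ 2 = D%:R :> R by rewrite sqr_sqrtr// ler0n.
have t10 : 0 < 1 + t by lra.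
pose s := Num.sqrt D%:R / (1 + t).
have s2 : D%:R / (1 + t) ^+ 2 = s ^+ 2 by rewrite expr_div_n sD2.
have ea := etaavg_ge0 q t.
rewrite s2; have ss := sqr_ge0 s.
(* For t < 1 there is no oscillation to exploit, and the trivial bound, of order D, is already of
   the size of the pole term. *)
have [t1|t1] := leP 1 t; last first.
  have Hw F : (forall x : R, `|F x| <= 1) -> wsum (gw (ln D%:R)) F n t ^+ 2 <=
      (26 * Num.sqrt D%:R) ^+ 2.
    move=> F1; apply: sqr_le_norm; rewrite [leRHS]ger0_norm ?mulr_ge0 ?sqrtr_ge0//.
    apply: le_trans (wsum_norm_le _ _ F1 (gw_ge0 _)) _; exact: sum_gw_le.
  have Ds : Num.sqrt D%:R ^+ 2 <= 4 * s ^+ 2.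
    rewrite -s2 sD2 mulrA ler_pdivlMr ?exprn_gt0//.
    have : (1 + t) ^+ 2 <= 4 by nra.
    by move=> /(ler_wpM2l (ler0n R D)); rewrite mulrC [X in _ <= X]mulrC.
  apply: le_trans (lerD (Hw _ (@cos_max R)) (Hw _ (@sin_max R))) _.
  apply: (@le_trans _ _ (c2 * s ^+ 2)).
    rewrite exprMn c2E; move: (26 ^+ 2) (sqr_ge0 (26 : R)) => z z0.
    by have := ler_wpM2l z0 Ds; lra.
  apply: (@le_trans _ _ ((c1 + c2 + 72) * s ^+ 2)).
    by rewrite ler_wpM2r// addrAC addrC lerDl addr_ge0.
  by rewrite ler_wpM2l ?addr_ge0// lerDr.
pose al := Num.sqrt (4 * etaavg q t + 2 * B ^+ 2).
have al2 : al ^+ 2 = 4 * etaavg q t + 2 * B ^+ 2.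
  rewrite sqr_sqrtr//; apply: addr_ge0; apply: mulr_ge0; rewrite ?sqr_ge0 ?ler0n//.
have al0 : 0 <= al by rewrite sqrtr_ge0.
have HA k : (k < K)%N ->
    Num.sqrt (wsq (alt (gw (L k))) (2 ^ k.+1 * n) t) <= al.
  move=> kK; apply: ler_wsqrtr.
  apply: le_trans (wsq_alt_gw_le t q4 (ltW e0) (qK k kK)) _.
  rewrite -addrA lerD2l; set m := (2 ^ k.+1 * n)%N.
  have mn : (n <= m)%N by rewrite leq_pmull// expn_gt0.
  have n0' : 0 < n%:R :> R by rewrite ltr0n.
  have : 2 * (800 / m.+1%:R * (81 * ch t)) <= B ^+ 2.
    apply: (@le_trans _ _ (2 * (800 * (81 * (2 * ch T))) / n%:R)).
      have : ch t / m.+1%:R <= (2 * ch T) / n%:R.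
        apply: ler_pM.
        - exact: ltW (ch_gt0 t).
        - by rewrite invr_ge0 ler0n.
        - exact: ch_le_mono.
        - by rewrite lef_pV2 ?posrE ?ltr0n// ler_nat; exact: leqW.
      move: (ler0n R 800) (ler0n R 81); move: (800 : R) (81 : R) => a b a0 b0.
      move=> /(ler_wpM2l a0)/(ler_wpM2l b0).
      by move: (m.+1%:R^-1) (n%:R^-1) => u v; lra.
    by rewrite ler_pdivrMr// -ler_pdivrMl ?exprn_gt0// mulrC.
  by move: (800 / _ * _) => u; rewrite /e; lra.
have h0 : Num.sqrt (wsq (gw (ln D%:R)) n t) <= 33 * s + 3 * al.
  apply: le_trans (sqrt_wsq_iter al0 HA) _.
  have rp : 0 < (Num.sqrt 2)^-1 ^+ K :> R by rewrite exprn_gt0// invr_gt0.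
  rewrite ln_pow2M//; apply: lerD; last first.
    by rewrite -[leRHS]mulr1 ler_wpM2l ?mulr_ge0//; lra.
  have X0 : (0 < 2 ^ K * D)%N by rewrite muln_gt0 expn_gt0.
  apply: le_trans (ler_wpM2l (ltW rp) (wsq_gw_large _ X0 t1)) _.
  rewrite sqrt_pow2M.
  have -> : (Num.sqrt 2)^-1 ^+ K * (16 * (Num.sqrt 2 ^+ K * Num.sqrt D%:R) / t + 32 * t)
     = 16 * Num.sqrt D%:R / t + 32 * t * (Num.sqrt 2)^-1 ^+ K.
    rewrite exprVn; field; rewrite !gt_eqF ?exprn_gt0//; lra.
  have tp : 0 < t by lra.
  have -> : 33 * s = 32 * s + s by ring.
  apply: lerD.
    rewrite /s ler_pdivrMr// mulrA mulrAC ler_pdivlMr//.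
    have : 0 <= Num.sqrt D%:R * (t - 1) by rewrite mulr_ge0 ?sqrtr_ge0// subr_ge0.
    by move: (Num.sqrt _) => z; lra.
  apply: (@le_trans _ _ B).
    apply: le_trans rK; by rewrite ler_wpM2r ?(ltW rp)// ler_wpM2l.
  rewrite /s /B -[leLHS]mul1r ler_pM ?invr_ge0 ?(ltW T0)//.
  by rewrite lef_pV2 ?posrE// lerD2l.
have Bs : B ^+ 2 <= s ^+ 2.
  rewrite lerXn2r ?nnegrE ?(ltW B0)// ?divr_ge0 ?sqrtr_ge0 ?(ltW t10)//.
  rewrite /s /B -[leLHS]mul1r ler_pM ?invr_ge0 ?(ltW T0)//.
  by rewrite lef_pV2 ?posrE// lerD2l.
have := sqr_sqrtr (wsq_ge0 (gw (ln D%:R)) n t) => <-.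
move: h0 al2; have := sqrtr_ge0 (wsq (gw (ln D%:R)) n t).
move: (Num.sqrt (wsq _ _ _)) (etaavg q t) ea => h u u0 h0 hs al2.
have h1 : h ^+ 2 <= 2 * (33 * s) ^+ 2 + 2 * (3 * al) ^+ 2.
  have : h ^+ 2 <= (33 * s + 3 * al) ^+ 2 by rewrite lerXn2r// nnegrE// (le_trans h0).
  by have := sqr_ge0 (33 * s - 3 * al); lra.
apply: le_trans h1 _; rewrite [(33 * s) ^+ 2]exprMn [(3 * al) ^+ 2]exprMn al2.
have h3 : 0 <= c2 * s ^+ 2 by rewrite mulr_ge0.
have h4 : 0 <= (c1 + c2) * u by rewrite mulr_ge0// addr_ge0.
move: h3 h4; rewrite c1E {c2E}; move: c2 c20 (33 ^+ 2) => z z0 y; move: (s ^+ 2) (B ^+ 2) ss Bs => a b ss Bs.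
lra.
Qed.

End SmoothSumBound.

(** * Counting near-coincidences by moments of zeta *)

Section ZetaCount.
Variable R : realType.
Implicit Types (l t d p b U : R) (n k D : nat).

(** Powers are differentiable only at positive points, and zeta may vanish on the line, so the zeros
    of [f] are treated by hand. *)
Lemma continuous_powR_comp (f : R -> R) p : 0 < p -> continuous f ->
  (forall t, 0 <= f t) -> continuous (fun t => f t `^ p).
Proof.
move=> p0 cf f0 t; have [ft0|ft0] := eqVneq (f t) 0; last first.
  have ftp : 0 < f t by rewrite lt_neqAle eq_sym ft0 f0.
  have : derivable (fun x : R => x `^ p) (f t) 1.
    by apply: derivable_powR; rewrite in_itv/= ftp.
  move=> /derivable1_diffP/differentiable_continuous cp.
  exact: (continuous_comp (cf t) cp).
rewrite /continuous_at/= ft0 powR0 ?gt_eqF//; apply/cvgrPdist_lt => e e0.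
have e1 : 0 < e `^ p^-1 by rewrite powR_gt0.
have /cvgrPdist_lt/(_ _ e1) := cf t; rewrite ft0 => H.
near=> s; rewrite sub0r normrN ger0_norm ?powR_ge0//.
have Hs : `|0 - f s| < e `^ p^-1 by near: s.
move: Hs; rewrite sub0r normrN ger0_norm// => Hs.
have -> : e = (e `^ p^-1) `^ p by rewrite -powRrM mulVf ?gt_eqF// powRr1// ltW.
by apply: gt0_ltr_powR => //; rewrite nnegrE// powR_ge0.
Unshelve. all: by end_near. Qed.

Lemma le_powR_split (e U p : R) : 0 <= e -> 0 < U -> 1 <= p ->
  e <= U + U `^ (1 - p) * e `^ p.
Proof.
move=> e0 U0 p1; have [eU|eU] := leP e U.
  by rewrite -[leLHS]addr0 lerD// mulr_ge0 ?powR_ge0.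
have ep : 0 < e by apply: lt_trans eU.
apply: (@le_trans _ _ (U `^ (1 - p) * e `^ p)); last by rewrite lerDr ltW.
rewrite -[e `^ p]mulr_powRB1 ?(lt_le_trans _ p1)// mulrCA -[leLHS]mulr1 ler_wpM2l//.
have -> : 1 - p = - (p - 1) by ring.
rewrite powRN mulrC ler_pdivlMr ?powR_gt0// mul1r.
by rewrite ge0_ler_powR ?subr_ge0// ?nnegrE ltW.
Qed.

Lemma powR_le_ch b : exists2 c : R, 0 <= c & forall x, 0 <= x -> (1 + x) `^ b <= c * ch x.
Proof.
pose m := (Num.truncn `|b|).+1.
exists (m`!%:R * 3 * 2); first by rewrite !mulr_ge0.
move=> x x0; have x1 : 1 <= 1 + x by rewrite lerDl.
have bm : b <= m%:R by apply: le_trans (ler_norm _) (ltW (truncnS_gt _)).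
apply: le_trans (ler_powR x1 bm) _.
rewrite powR_mulrn; last by rewrite (le_trans _ x1).
have H : (1 + x) ^+ m <= m`!%:R * expR (1 + x).
  have := @expR_ge1Dxn R (1 + x) m.-1; rewrite -/m => /(_ (le_trans ler01 x1)) H.
  rewrite mulrC -ler_pdivrMr ?ltr0n ?fact_gt0//; apply: le_trans H.
  by rewrite lerDr.
apply: le_trans H _; rewrite expRD -!mulrA ler_wpM2l// ler_pM ?expR_ge0 ?expR1_le3//.
by rewrite /ch; have := expR_ge0 (- x); lra.
Qed.

(** Averaging in t moves the window of integration away from 0. By evenness a window at [a] is
    bounded by integrals over [0, |a| + T], and the polynomial growth in |a| is majorised by
    [ch a]. *)
Lemma Int_window_le (f : R -> R) (cz b : R) : continuous f -> (forall t, 0 <= f t) ->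
  (forall t, f (- t) = f t) -> 0 <= cz -> 0 <= b ->
  (forall x, 0 <= x -> Int 0 x f <= cz * (1 + x) `^ b) ->
  exists2 c : R, 0 <= c & forall T a, 1 <= T -> Int a (a + T) f <= c * T `^ b * ch a.
Proof.
move=> cf f0 fN cz0 b0 Hf; have [c1 c10 Hc] := powR_le_ch b.
exists (2 * cz * 2 `^ b * c1 * 2); first by rewrite !mulr_ge0 ?powR_ge0.
move=> T a T1; have T0 : 0 < T by lra.
have a0 := normr_ge0 a; have aa := ler_norm a; have aN := ler_normr (- a) a.
have aa' : - `|a| <= a by rewrite lerNl -normrN ler_norm.
apply: (@le_trans _ _ (Int (- `|a|) (`|a| + T) f)); first by apply: Int_subset => //; lra.
rewrite (@Int_split R _ 0)//; last by lra.
have E : Int (- `|a|) 0 f = Int 0 `|a| f.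
  have := @Int_opp R 0 `|a| f a0 cf; rewrite oppr0 => <-; exact: eq_Int.
rewrite E; have h1 : Int 0 `|a| f <= Int 0 (`|a| + T) f by apply: Int_subset => //; lra.
have h2 : Int 0 (`|a| + T) f <= cz * (1 + (`|a| + T)) `^ b by apply: Hf; lra.
have h3 : (1 + (`|a| + T)) `^ b <= (2 * T) `^ b * (1 + `|a|) `^ b.
  rewrite -powRM; [|lra|lra].
  by apply: ge0_ler_powR => //; rewrite ?nnegrE; nra.
have h4 : (1 + `|a|) `^ b <= c1 * (2 * ch a).
  apply: le_trans (Hc _ a0) _; rewrite ler_wpM2l//.
  rewrite /ch; have h1' := expR_ge0 a; have h2' := expR_ge0 (- a).
  by case: (ger0P a) => _; rewrite ?opprK; lra.
rewrite powRM// in h3; last by lra.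
have P0 : 0 <= 2 `^ b * T `^ b :> R by rewrite mulr_ge0 ?powR_ge0.
have := ler_wpM2l cz0 (le_trans h3 (ler_wpM2l P0 h4)).
have -> : 2 * cz * 2 `^ b * c1 * 2 * T `^ b * ch a =
   2 * (cz * (2 `^ b * T `^ b * (c1 * (2 * ch a)))) by ring.
by move: (cz * (_ * _)) => z; lra.
Qed.

(** Averaging the integrand amounts to averaging the windows, and [ch] is reproduced with the factor
    [ch d] at each step. *)
Lemma Int_avg_iter_le (f : R -> R) (c T d : R) r : continuous f -> 0 <= T ->
  (forall a, Int a (a + T) f <= c * ch a) ->
  forall a, Int a (a + T) (iter r (avg d) f) <= c * ch d ^+ r * ch a.
Proof.
move=> cf T0 Hf; elim: r => [|r IH] a /=; first by rewrite mulr1.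
have cg := @continuous_avg_iter R d f r cf.
have aT : a <= a + T by rewrite lerDl.
have E e : Int a (a + T) (fun t => iter r (avg d) f (t + e)) =
    Int (a + e) (a + e + T) (iter r (avg d) f).
  by rewrite Int_shift// (addrAC a T).
have csh e : continuous (fun t => iter r (avg d) f (t + e)).
  by move=> x; apply: (@continuous_comp _ _ _ (fun t => t + e) (iter r (avg d) f)); [apply: cvgD; [exact: cvg_id|exact: cvg_cst]|exact: cg].
have -> : Int a (a + T) (avg d (iter r (avg d) f)) =
   2^-1 * (Int (a + - d) (a + - d + T) (iter r (avg d) f) +
           Int (a + d) (a + d + T) (iter r (avg d) f)).
  rewrite -!E -IntD// -IntZ; last by move=> x; apply: cvgD; exact: csh.
  by apply: eq_Int => t; rewrite /avg mulrC.
have -> : c * ch d ^+ r.+1 * ch a = 2^-1 * (c * ch d ^+ r * ch (a - d) + c * ch d ^+ r * ch (a + d)).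
  have E2 : (ch (a - d) + ch (a + d)) / 2 = ch d * ch a.
    by have := @avg_iter_ch R d 1 a; rewrite expr1.
  have {}E2 : ch (a - d) + ch (a + d) = 2 * (ch d * ch a) by rewrite -E2 mulrC divfK.
  by rewrite -mulrDr E2 exprS; field.
by rewrite ler_wpM2l ?invr_ge0// lerD.
Qed.

Lemma trigsq_prod (I J : Type) (r : seq I) (s : seq J) (c : I -> R) (w : J -> R)
    (l : I -> R) (m : J -> R) t :
  trigsq [seq (i, j) | i <- r, j <- s] (fun ij => c ij.1 * w ij.2)
    (fun ij => l ij.1 + m ij.2) t = trigsq r c l t * trigsq s w m t.
Proof.
rewrite /trigsq !big_allpairs/=.
set C1 := \sum_(i <- r) c i * cos _; set S1 := \sum_(i <- r) c i * sin _.
set C2 := \sum_(i <- s) w i * cos _; set S2 := \sum_(i <- s) w i * sin _.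
have -> : \sum_(i <- r) \sum_(j <- s) c i * w j * cos ((l i + m j) * t) = C1 * C2 - S1 * S2.
  rewrite /C1 /C2 /S1 /S2 !big_distrlr/= -sumrB; apply: eq_bigr => i _.
  by rewrite -sumrB; apply: eq_bigr => j _; rewrite mulrDl cosD; ring.
have -> : \sum_(i <- r) \sum_(j <- s) c i * w j * sin ((l i + m j) * t) = S1 * C2 + C1 * S2.
  rewrite /C1 /C2 /S1 /S2 !big_distrlr/= -big_split/=; apply: eq_bigr => i _.
  by rewrite -big_split/=; apply: eq_bigr => j _; rewrite mulrDl sinD; ring.
by ring.
Qed.

Lemma trigsq_le (I : Type) (r : seq I) (c l : I -> R) t : (forall i, 0 <= c i) ->
  trigsq r c l t <= (\sum_(i <- r) c i) ^+ 2.
Proof.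
move=> c0; rewrite trigsqE expr2 big_distrlr/=; apply: ler_sum => i _.
apply: ler_sum => j _; rewrite -[leRHS]mulr1 ler_wpM2l ?mulr_ge0//; exact: cos_le1.
Qed.

(** At resolution 1/(2T) the frequencies k/T fall into distinct cells, so only the diagonal survives
    in the large sieve. The tent of length 2T is at least 1/2 on [0, T]. *)
Lemma Int_trigsq_separated (s : seq nat) (w : nat -> R) T : 0 < T -> uniq s ->
  (forall k, 0 <= w k) ->
  Int 0 T (trigsq s w (fun k => k%:R / T)) <= 128 * T * \sum_(k <- s) w k ^+ 2.
Proof.
move=> T0 us w0; pose W := trigsq s w (fun k => k%:R / T).
have cW : continuous W by exact: continuous_trigsq.
have T2 : 0 < 2 * T by rewrite mulr_gt0.
have cK : continuous (fun t => (1 - t / (2 * T)) * W t).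
  by move=> x; apply: cvgM; [exact: continuous_tent|exact: cW].
have H := @large_sieve R nat s w (fun k => k%:R / T) (2 * T) T2 w0.
have l0 k : 0 <= k%:R / T :> R by rewrite divr_ge0 ?(ltW T0).
move: (H l0); have -> : \sum_(i <- s) \sum_(j <- s | Num.truncn (2 * T * (i%:R / T)) ==
     Num.truncn (2 * T * (j%:R / T))) w i * w j = \sum_(k <- s) w k ^+ 2.
  apply: eq_big_seq => i si.
  have tr k : Num.truncn (2 * T * (k%:R / T)) = (2 * k)%N.
    have -> : 2 * T * (k%:R / T) = (2 * k)%:R :> R by rewrite natrM; field; rewrite gt_eqF.
    by rewrite natrK.
  under eq_bigl do rewrite !tr eqn_pmul2l// eq_sym.
  rewrite -big_filter; have -> : [seq j <- s | j == i] = [:: i] by exact: filter_pred1_uniq.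
  by rewrite big_seq1 expr2.
move=> {}H; apply: (@le_trans _ _ (2 * Int 0 (2 * T) (fun t => (1 - t / (2 * T)) * W t))).
  rewrite -IntZ//; apply: (@le_trans _ _ (Int 0 T (fun x => 2 * ((1 - x / (2 * T)) * W x)))).
    apply: le_Int => //.
      by move=> x; apply: cvgM; [exact: cvg_cst|exact: cK].
    move=> x /andP[x0 xT]; have W0 : 0 <= W x := trigsq_ge0 _ _ _ _.
    rewrite mulrA -[leLHS]mul1r ler_wpM2r//.
    have : x / (2 * T) <= 1 / 2 by rewrite ler_pdivrMr//; lra.
    lra.
  have cK2 : continuous (fun t => 2 * ((1 - t / (2 * T)) * W t)).
    by move=> x; apply: cvgM; [exact: cvg_cst|exact: cK].
  rewrite (@Int_split R 0 T (2 * T))//; [|lra|lra].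
  rewrite lerDl; apply: Int_ge0 => x /andP[x0 xT].
  rewrite mulr_ge0// mulr_ge0//; last exact: trigsq_ge0.
  by rewrite subr_ge0 ler_pdivrMr// mul1r.
have := ler_wpM2l (ler0n R 2) H; move: (\sum_(k <- s) _) => z; lra.
Qed.

Lemma wsqE w n t : wsq w n t = trigsq (index_iota 1 n.+1) w (fun k => ln k%:R) t :> R.
Proof.
rewrite /wsq /wsum /trigsq; congr (_ ^+ 2 + _ ^+ 2); apply: eq_bigr => k _.
  by rewrite (mulrC t).
by rewrite (mulrC t).
Qed.

End ZetaCount.

Section ZetaCount.
Variable R : realType.
Implicit Types (l t d p b U T : R) (n k D : nat).

(** An index k stands for a cluster of cells whose ln y_n lies within 1/T above k/T. The tolerance
    2/T is 1/T for the closeness of two products plus 1/T for the rounding. *)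
Definition close_count (D : nat) (T : R) (s : seq nat) (w : nat -> R) : R :=
  \sum_(D <= i < 2 * D) \sum_(D <= j < 2 * D) \sum_(k <- s) \sum_(h <- s |
    `|ln i%:R + k%:R / T - (ln j%:R + h%:R / T)| <= 2 / T) w k * w h.

Lemma continuous_wsq (w : nat -> R) n : continuous (wsq w n).
Proof.
have -> : wsq w n = trigsq (index_iota 1 n.+1) w (fun k => ln k%:R) :> (R -> R).
  by apply/funext => t; exact: wsqE.
exact: continuous_trigsq.
Qed.

(** On the block ln i - ln D lies in [0, 1], so the squared Gaussian is at least e^(-2) >= 1/9, and
    1/i >= 1/(2D). *)
Lemma gw_block_ge D i : (0 < D)%N -> (D <= i < 2 * D)%N ->
  (18 * D%:R)^-1 <= gw (ln D%:R) i ^+ 2 :> R.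
Proof.
move=> D0 /andP[Di iD]; have i0 : (0 < i)%N by lia.
have D0' : 0 < D%:R :> R by rewrite ltr0n.
have i0' : 0 < i%:R :> R by rewrite ltr0n.
rewrite /gw inv_sqrtE exprMn exprVn sqr_sqrtr ?ler0n//.
have hi : (2 * D%:R)^-1 <= i%:R^-1 :> R.
  by rewrite lef_pV2 ?posrE ?mulr_gt0// -natrM ler_nat ltnW.
have v0 : 0 <= ln i%:R - ln D%:R :> R by rewrite subr_ge0 ler_ln ?posrE// ler_nat.
have v1 : ln i%:R - ln D%:R <= 1 :> R.
  rewrite -ln_div ?posrE//.
  have -> : i%:R / D%:R = 1 + (i%:R / D%:R - 1) :> R by ring.
  apply: le_trans (le_ln1Dx _) _.
    have : 0 < i%:R / D%:R :> R by rewrite divr_gt0.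
    by lra.
  rewrite lerBlDr ler_pdivrMr//; have : i%:R <= (2 * D)%:R :> R by rewrite ler_nat ltnW.
  by rewrite natrM; lra.
have he : 9^-1 <= expR (- (ln i%:R - ln D%:R) ^+ 2) ^+ 2 :> R.
  rewrite -expRM_natl mulrN expRN lef_pV2 ?posrE ?expR_gt0//.
  apply: (@le_trans _ _ (expR (2%:R * 1))); first by rewrite ler_expR ler_wpM2l//; nra.
  rewrite expRM_natl; have := expR1_le3 R; have := expR_ge0 (1 : R); nra.
have -> : (18 * D%:R)^-1 = (2 * D%:R)^-1 * 9^-1 :> R.
  by rewrite -invfM; congr (_^-1); ring.
by apply: ler_pM; rewrite ?invr_ge0// mulr_ge0 ?ler0n.
Qed.

(** The mean value expands into a sum of nonnegative terms. Keeping only i, j in the block and close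
    logarithms bounds it from below, each kernel value kept being at least T/8. *)
Lemma close_count_le_integral D T n s (w : nat -> R) : (0 < D)%N -> 0 < T ->
  (2 * D <= n)%N -> (forall k, 0 <= w k) ->
  T / 8 * (18 * D%:R)^-1 * close_count D T s w <=
  Int 0 T (fun t => (1 - t / T) * (wsq (gw (ln D%:R)) n t * trigsq s w (fun k => k%:R / T) t)).
Proof.
move=> D0 T0 Dn w0; pose g : nat -> R := gw (ln D%:R).
have g0 k : 0 <= g k by exact: gw_ge0.
under eq_Int do rewrite wsqE -trigsq_prod.
rewrite mean_value big_allpairs/=.
pose tm i k j h := g i * w k * (g j * w h) * kap T (ln i%:R + k%:R / T - (ln j%:R + h%:R / T)).
have tm0 i k j h : 0 <= tm i k j h by rewrite mulr_ge0 ?kap_ge0// !mulr_ge0.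
have widen (F : nat -> R) : (forall i, 0 <= F i) ->
    \sum_(D <= i < 2 * D) F i <= \sum_(1 <= i < n.+1) F i.
  move=> F0; rewrite (big_cat_nat (n := D) (p := n.+1))//=; last by lia.
  rewrite (big_cat_nat (m := D) (n := 2 * D) (p := n.+1))//=; [|lia|lia].
  by rewrite addrCA lerDl addr_ge0// sumr_ge0.
apply: (@le_trans _ _ (\sum_(1 <= i < n.+1) \sum_(k <- s)
    \sum_(1 <= j < n.+1) \sum_(h <- s) tm i k j h)); last first.
  apply: ler_sum => i _; apply: ler_sum => k _; rewrite big_allpairs/=.
  exact: lexx.
apply: le_trans (widen _ _); last by move=> i; do 3!(apply: sumr_ge0 => ? _).
rewrite /close_count big_distrr/= big_nat [leRHS]big_nat; apply: ler_sum => i iD.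
rewrite big_distrr/=.
apply: (@le_trans _ _ (\sum_(k <- s) \sum_(D <= j < 2 * D) \sum_(h <- s) tm i k j h)); last first.
  by apply: ler_sum => k _; apply: widen => j; apply: sumr_ge0.
rewrite [leRHS]exchange_big/= big_nat [leRHS]big_nat; apply: ler_sum => j jD.
rewrite big_distrr/=; apply: ler_sum => k _; rewrite big_distrr/= big_mkcond/=.
apply: ler_sum => h _; case: ifP => [hc|_]; last exact: tm0.
have gi := gw_block_ge D0 iD; have gj := gw_block_ge D0 jD.
have gij : (18 * D%:R)^-1 <= g i * g j.
  have D18 : 0 < (18 * D%:R)^-1 :> R by rewrite invr_gt0 mulr_gt0 ?ltr0n.
  rewrite -(ler_pXn2r (n := 2)) ?nnegrE ?(ltW D18) ?mulr_ge0// exprMn [leLHS]expr2.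
  by apply: ler_pM => //; exact: ltW.
have kp : T / 8 <= kap T (ln i%:R + k%:R / T - (ln j%:R + h%:R / T)).
  by apply: kap_ge => //; rewrite -ler_pdivlMr.
rewrite /tm.
have -> : g i * w k * (g j * w h) = g i * g j * (w k * w h) by ring.
have -> : T / 8 * (18 * D%:R)^-1 * (w k * w h) = (18 * D%:R)^-1 * (w k * w h) * (T / 8) by ring.
apply: ler_pM => //; [|lra|].
  by rewrite !mulr_ge0// invr_ge0 mulr_ge0 ?ler0n.
by rewrite ler_wpM2r// mulr_ge0.
Qed.

(* [U] separates small from large values of [|eta|^2], by [z <= U + U^(1-p) z^p]. *)
Lemma zeta_count p b cz : 1 <= p -> 0 <= b -> 0 <= cz ->
  (forall x, 0 <= x -> Int 0 x (fun t => etasq t `^ p) <= cz * (1 + x) `^ b) ->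
  exists2 c : R, 0 <= c & forall D T U s (w : nat -> R),
  (0 < D)%N -> 1 <= T -> 0 < U -> uniq s -> (forall k, 0 <= w k) ->
  close_count D T s w <= c * (D%:R / T) *
    (U * T * (\sum_(k <- s) w k ^+ 2)
     + (U `^ (1 - p) * T `^ b + D%:R) * (\sum_(k <- s) w k) ^+ 2).
Proof.
move=> p1 b0 cz0 Hcz; have p0 : 0 < p by lra.
pose phi t : R := etasq t `^ p.
have cphi : continuous phi.
  by apply: continuous_powR_comp => //; [exact: continuous_etasq|exact: etasq_ge0].
have phi0 t : 0 <= phi t by exact: powR_ge0.
have phiN t : phi (- t) = phi t by rewrite /phi etasqN.
have [c1 c10 Hw] := Int_window_le cphi phi0 phiN cz0 b0 Hcz.
have [c0 c00 Hs] := smooth_sum_bound R.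
exists (144 * (c0 * (128 + 81 * c1 + 2))); first by rewrite !mulr_ge0 ?addr_ge0 ?mulr_ge0.
move=> D T U s w D0 T1 U0 us w0.
have T0 : 0 < T by lra.
have D0' : 0 < D%:R :> R by rewrite ltr0n.
have [n [q [Dn q4 Hb]]] := Hs D T D0 T1.
have := @close_count_le_integral D T n s w D0 T0 Dn w0.
set LHS := close_count _ _ _ _; set I := Int _ _ _ => HI.
set S2 := \sum_(k <- s) w k ^+ 2; set S1 := (\sum_(k <- s) w k) ^+ 2.
pose W := trigsq s w (fun k => k%:R / T).
have W0 t : 0 <= W t by exact: trigsq_ge0.
have WS t : W t <= S1 by exact: trigsq_le.
have cW : continuous W by exact: continuous_trigsq.
pose Psi : R -> R := iter (2 * q.+1) (avg (dq R q)) phi.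
have cPsi : continuous Psi by exact: continuous_avg_iter.
have Psi0 t : 0 <= Psi t.
  by have := @avg_iter_le R (dq R q) (fun=> 0) phi (2 * q.+1) phi0 t; rewrite avg_iter_cst.
have HPsi : Int 0 T Psi <= 81 * c1 * T `^ b.
  have := @Int_avg_iter_le R phi (c1 * T `^ b) T (dq R q) (2 * q.+1) cphi (ltW T0).
  move=> /(_ (fun a => Hw T a T1) 0); rewrite add0r => /le_trans; apply.
  have ch0 : ch (0 : R) = 1 by rewrite /ch oppr0 expR0; field.
  rewrite ch0 mulr1 [leLHS]mulrC -[leRHS]mulrA ler_wpM2r ?mulr_ge0 ?powR_ge0//; exact: ch_dq_pow.
have etaU t : etaavg q t <= U + U `^ (1 - p) * Psi t.
  have -> : U + U `^ (1 - p) * Psi t =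
     iter (2 * q.+1) (avg (dq R q)) (fun t => U * 1 + U `^ (1 - p) * phi t) t.
    by rewrite (@avg_iter_lin R (dq R q) (fun=> 1) phi) avg_iter_cst mulr1.
  by apply: avg_iter_le => x; rewrite mulr1; apply: le_powR_split => //; exact: etasq_ge0.
(* The pole factor (1 + t)^(-2) is replaced by the larger 1 / (1 + t^2), whose integral is an
   arctangent and stays bounded in T. *)
have cV : continuous (fun t : R => (oneDsqr t)^-1) := @continuous_oneDsqrV R.
pose F t := c0 * (U * W t + (U `^ (1 - p) * S1 * Psi t + D%:R * S1 * (oneDsqr t)^-1)).
have cW' : continuous (fun t => U * W t).
  by move=> x; apply: cvgM; [exact: cvg_cst|exact: cW].
have cP' : continuous (fun t => U `^ (1 - p) * S1 * Psi t).
  by move=> x; apply: cvgM; [exact: cvg_cst|exact: cPsi].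
have cV' : continuous (fun t => D%:R * S1 * (oneDsqr t)^-1).
  by move=> x; apply: cvgM; [exact: cvg_cst|exact: cV].
have cPV : continuous (fun t => U `^ (1 - p) * S1 * Psi t + D%:R * S1 * (oneDsqr t)^-1).
  by move=> x; apply: cvgD; [exact: cP'|exact: cV'].
have cWPV : continuous (fun t => U * W t + (U `^ (1 - p) * S1 * Psi t + D%:R * S1 * (oneDsqr t)^-1)).
  by move=> x; apply: cvgD; [exact: cW'|exact: cPV].
have cF : continuous F by move=> x; apply: cvgM; [exact: cvg_cst|exact: cWPV].
have S10 : 0 <= S1 by exact: sqr_ge0.
have IF : I <= Int 0 T F.
  apply: le_Int => //.
    move=> x; apply: cvgM; first exact: continuous_tent.
    apply: cvgM; last exact: cW.
    exact: continuous_wsq.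
  move=> x /andP[x0 xT]; rewrite -/(W x).
  have h1 : 0 <= 1 - x / T <= 1.
    rewrite subr_ge0 ler_pdivrMr// mul1r xT/=.
    by rewrite gerBl divr_ge0// ltW.
  have h2 : 0 <= wsq (gw (ln D%:R)) n x * W x by rewrite mulr_ge0 ?wsq_ge0.
  apply: (@le_trans _ _ (wsq (gw (ln D%:R)) n x * W x)).
    by rewrite -[leRHS]mul1r ler_wpM2r//; case/andP: h1.
  apply: le_trans (ler_wpM2r (W0 x) (Hb x x0 xT)) _.
  rewrite -mulrA /F ler_wpM2l//.
  have q0 : 0 < oneDsqr x by apply: lt_le_trans (oneDsqr_ge1 x).
  have q1 : 0 < 1 + x by lra.
  apply: (@le_trans _ _ ((U + U `^ (1 - p) * Psi x + D%:R * (oneDsqr x)^-1) * W x)).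
    rewrite ler_wpM2r// lerD// ler_wpM2l ?ler0n// lef_pV2 ?posrE ?exprn_gt0//.
    by rewrite /oneDsqr; lra.
  rewrite !mulrDl addrA.
  have h3 : 0 <= U `^ (1 - p) * Psi x by rewrite mulr_ge0 ?powR_ge0.
  have h4 : 0 <= D%:R * (oneDsqr x)^-1 by rewrite mulr_ge0 ?ler0n// invr_ge0 ltW.
  rewrite lerD//; last by rewrite [leRHS]mulrAC ler_wpM2l.
  by rewrite lerD// [leRHS]mulrAC ler_wpM2l.
have IFE : Int 0 T F = c0 * (U * Int 0 T W + (U `^ (1 - p) * S1 * Int 0 T Psi + D%:R * S1 * atan T)).
  by rewrite IntZ// IntD// IntD// !IntZ// /Int integral0_oneDsqr ?(ltW T0).
have HW := Int_trigsq_separated T0 us w0; rewrite -/W -/S2 in HW.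
have Hat : atan T <= 2 by have := atan_ltpi2 T; have := pihalf_lt2 R; lra.
have HF : Int 0 T F <= c0 * (128 + 81 * c1 + 2) *
    (U * T * S2 + (U `^ (1 - p) * T `^ b + D%:R) * S1).
  rewrite IFE -[leRHS]mulrA ler_wpM2l//.
  have S20 : 0 <= S2 by apply: sumr_ge0 => k _; exact: sqr_ge0.
  have a1 := ler_wpM2l (ltW U0) HW.
  have u0 : 0 <= U `^ (1 - p) * S1 by rewrite mulr_ge0 ?powR_ge0.
  have a2 := ler_wpM2l u0 HPsi.
  have d0 : 0 <= D%:R * S1 by rewrite mulr_ge0 ?ler0n.
  have a3 := ler_wpM2l d0 Hat.
  apply: le_trans (lerD a1 (lerD a2 a3)) _.
  have X0 : 0 <= U * T * S2 by rewrite !mulr_ge0// ltW.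
  have Y0 : 0 <= U `^ (1 - p) * S1 * T `^ b by rewrite mulr_ge0 ?powR_ge0.
  have -> : U * (128 * T * S2) = 128 * (U * T * S2) by ring.
  have -> : U `^ (1 - p) * S1 * (81 * c1 * T `^ b) = 81 * c1 * (U `^ (1 - p) * S1 * T `^ b) by ring.
  have -> : (U `^ (1 - p) * T `^ b + D%:R) * S1 = U `^ (1 - p) * S1 * T `^ b + D%:R * S1 by ring.
  move: X0 Y0 d0; move: (U * T * S2) (U `^ (1 - p) * S1 * T `^ b) (D%:R * S1) => X Y Z X0 Y0 Z0.
  have c81 : 0 <= 81 * c1 by rewrite mulr_ge0.
  move: (128 : R) (ler0n R 128) (81 * c1) c81 => k1 k10 k2 k20.
  rewrite -subr_ge0 (_ : _ - _ = k2 * X + 2 * X + k1 * Y + 2 * Y + k1 * Z + k2 * Z); last by ring.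
  by rewrite !addr_ge0 ?mulr_ge0.
have := le_trans HI (le_trans IF HF); set K := (U * T * S2 + _).
have c3 : 0 <= T / 8 * (18 * D%:R)^-1 by rewrite !mulr_ge0 ?invr_ge0 ?mulr_ge0 ?ler0n// ltW.
have -> : T / 8 * (18 * D%:R)^-1 = (144 * (D%:R / T))^-1.
  by field; rewrite !gt_eqF.
rewrite ler_pdivrMl; last by apply: mulr_gt0 => //; exact: divr_gt0.
move: (128 + 81 * c1 + 2) (144 : R) => c4 c5.
by have -> : c5 * (c0 * c4) * (D%:R / T) * K = c5 * (D%:R / T) * (c0 * c4 * K) by ring.
Qed.

End ZetaCount.

(** * From the moment of zeta to that of eta, and the sign of m *)

Section Moment.
Variable R : realType.
Implicit Types (t p b U T kappa m : R).

Lemma continuous_zeta : continuous (@zeta_crit_abs R).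
Proof.
have c1 : continuous (fun t : R => Num.sqrt (etasq t)).
  by move=> t; apply: continuous_comp; [exact: continuous_etasq|exact: sqrt_continuous].
have cc : continuous (fun t : R => cos (t * ln 2)).
  by under eq_fun do rewrite mulrC; exact: continuous_cosM.
have cs : continuous (fun t : R => sin (t * ln 2)).
  by under eq_fun do rewrite mulrC; exact: continuous_sinM.
have c2 : continuous (@eta_factor_sqnorm R).
  have -> : @eta_factor_sqnorm R = fun t =>
     (1 - Num.sqrt 2 * cos (t * ln 2)) * (1 - Num.sqrt 2 * cos (t * ln 2)) +
     (Num.sqrt 2 * sin (t * ln 2)) * (Num.sqrt 2 * sin (t * ln 2)).
    by apply/funext => t; rewrite /eta_factor_sqnorm !expr2.
  have h1 : continuous (fun t : R => 1 - Num.sqrt 2 * cos (t * ln 2)).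
    move=> t; apply: cvgB; first exact: cvg_cst.
    by apply: cvgM; [exact: cvg_cst|exact: cc].
  have h2 : continuous (fun t : R => Num.sqrt 2 * sin (t * ln 2)).
    by move=> t; apply: cvgM; [exact: cvg_cst|exact: cs].
  by move=> t; apply: cvgD; apply: cvgM; (exact: h1 || exact: h2).
move=> t; apply: cvgM; first exact: c1.
apply: cvgV.
  by have /andP[f0 _] := eta_factor_bounds t; rewrite gt_eqF// sqrtr_gt0.
by apply: continuous_comp; [exact: c2|exact: sqrt_continuous].
Qed.

Lemma zeta_ge0 t : 0 <= zeta_crit_abs t.
Proof. by rewrite divr_ge0 ?sqrtr_ge0. Qed.

(** Integrating up to x + T1 instead of x reaches the range where the hypothesis applies, and x + T1
    <= T1 (1 + x) keeps its shape. The exponent is halved because [etasq] is already a square. *)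
Lemma moment_bound kappa mu : 0 < kappa -> 0 <= 1 + mu ->
  (exists C T0 : R, forall T : R, T0 <= T -> 0 < T ->
     ((T^-1)%:E * \int[lebesgue_measure]_(t in `[0%R, T]%classic) ((zeta_crit_abs t) `^ kappa)%:E
       <= (C * T `^ mu)%:E)%E) ->
  exists2 cz : R, 0 <= cz &
    forall x, 0 <= x -> Int 0 x (fun t => etasq t `^ (kappa / 2)) <= cz * (1 + x) `^ (1 + mu).
Proof.
move=> k0 b0 [C [T0 HC]]; pose T1 : R := Num.max T0 1.
have T11 : 1 <= T1 by rewrite le_max lexx orbT.
have T10 : T0 <= T1 by rewrite le_max lexx.
have cZ : continuous (fun t : R => zeta_crit_abs t `^ kappa).
  by apply: continuous_powR_comp => //; [exact: continuous_zeta|exact: zeta_ge0].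
have cE : continuous (fun t : R => etasq t `^ (kappa / 2)).
  apply: continuous_powR_comp; [by rewrite divr_gt0|exact: continuous_etasq|exact: etasq_ge0].
exists (3 `^ kappa * (`|C| * T1 `^ (1 + mu))); first by rewrite !mulr_ge0 ?powR_ge0.
move=> x x0; have xT : 0 < x + T1 by lra.
have xT0 : T0 <= x + T1 by lra.
have := HC _ xT0 xT; rewrite (Int_ereal _ _ cZ) -EFinM lee_fin => H1.
have H2 : Int 0 (x + T1) (fun t => zeta_crit_abs t `^ kappa) <= `|C| * (x + T1) `^ (1 + mu).
  rewrite ler_pdivrMl// in H1; apply: le_trans H1 _.
  rewrite powRD; last by rewrite (gt_eqF xT) implybT.
  rewrite powRr1 ?(ltW xT)// mulrCA ler_wpM2r ?mulr_ge0 ?powR_ge0 ?(ltW xT)//.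
  exact: ler_norm.
apply: (@le_trans _ _ (Int 0 (x + T1) (fun t => etasq t `^ (kappa / 2)))).
  by apply: Int_subset => //; [move=> t; exact: powR_ge0|lra].
apply: (@le_trans _ _ (3 `^ kappa * Int 0 (x + T1) (fun t => zeta_crit_abs t `^ kappa))).
  rewrite -IntZ//; apply: le_Int => //.
    by move=> t; apply: cvgM; [exact: cvg_cst|exact: cZ].
  move=> t _; rewrite -powRM ?zeta_ge0// mulrC powRrM powR12_sqrt ?etasq_ge0//.
  apply: ge0_ler_powR; rewrite ?nnegrE ?sqrtr_ge0 ?(ltW k0)//.
  - by rewrite mulr_ge0// zeta_ge0.
  - exact: sqrt_etasq_le_zeta.
rewrite -mulrA ler_wpM2l ?powR_ge0//; apply: le_trans H2 _.
rewrite -mulrA ler_wpM2l// -powRM; [|lra|lra].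
by apply: ge0_ler_powR => //; rewrite ?nnegrE; nra.
Qed.

Lemma powR_unbounded (a M : R) : 0 < a ->
  exists2 T0 : R, 1 <= T0 & forall T, T0 <= T -> M <= T `^ a.
Proof.
move=> a0; have M1 : 1 <= `|M| + 1 by rewrite lerDr.
exists ((`|M| + 1) `^ a^-1).
  by rewrite -[leLHS](powRr0 (`|M| + 1)) ler_powR// invr_ge0 ltW.
move=> T HT; have T0 : 0 <= T by apply: le_trans HT; exact: powR_ge0.
apply: (@le_trans _ _ (((`|M| + 1) `^ a^-1) `^ a)).
  rewrite -powRrM mulVf ?gt_eqF// powRr1 ?(le_trans ler01 M1)//.
  by have := ler_norm M; lra.
by apply: ge0_ler_powR; rewrite ?nnegrE ?powR_ge0// ltW.
Qed.

(* For [m < 0], [zeta_count] with [D = 1] and a single weight would, for small [U] and then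
   large [T], bound the diagonal term 1 by 3/4. *)
Lemma moment_exponent_ge0 kappa m : 2 <= kappa ->
  (forall eps : R, 0 < eps -> exists C T0 : R, forall T : R, T0 <= T -> 0 < T ->
     ((T^-1)%:E * \int[lebesgue_measure]_(t in `[0%R, T]%classic) ((zeta_crit_abs t) `^ kappa)%:E
       <= (C * T `^ (m + eps))%:E)%E) ->
  0 <= m.
Proof.
move=> k2 Hz; rewrite leNgt; apply/negP => m0.
(* Raising a very negative m to -1/2 keeps the exponent 1 + m'/2 nonnegative, as [zeta_count]
   demands, while m' stays negative. *)
pose m' := Num.max m (- (1 / 2)).
have m'0 : m' < 0 by rewrite gt_max m0/=; lra.
have mm' : m <= m' by rewrite le_max lexx.
have m'2 : - (1 / 2) <= m' by rewrite le_max lexx orbT.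
pose eps := m' / 2 - m; have eps0 : 0 < eps by rewrite /eps; lra.
have k0 : 0 < kappa by lra.
have := Hz _ eps0; have -> : m + eps = m' / 2 by rewrite /eps; ring.
move=> /(moment_bound k0 (_ : 0 <= 1 + m' / 2)) [|cz cz0 Hcz]; first by lra.
have p1 : 1 <= kappa / 2 by lra.
have b0 : 0 <= 1 + m' / 2 by lra.
have [c c0 Hc] := zeta_count p1 b0 cz0 Hcz.
pose U : R := (4 * (c + 1))^-1.
have U0 : 0 < U by rewrite invr_gt0; lra.
have cU : c * U <= 1 / 4 by rewrite /U ler_pdivrMr; lra.
have a0 : 0 < - (m' / 2) by lra.
have [T1 T11 HT1] := powR_unbounded (4 * c * U `^ (1 - kappa / 2)) a0.
pose T := Num.max T1 (4 * c + 1).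
have TT1 : T1 <= T by rewrite le_max lexx.
have Tc : 4 * c + 1 <= T by rewrite le_max lexx orbT.
have T1' : 1 <= T by lra.
have T0 : 0 < T by lra.
have := Hc 1%N T U [:: 0%N] (fun=> 1) isT T1' U0 isT (fun=> ler01).
have -> : close_count 1 T [:: 0%N] (fun=> 1) = 1.
  rewrite /close_count muln1 !big_nat1 big_seq1 big_mkcond big_seq1 subrr normr0.
  by rewrite divr_ge0 ?(ltW T0)// mulr1.
rewrite !big_seq1 !expr1n !mulr1.
have E : T `^ (1 + m' / 2) = T / T `^ (- (m' / 2)).
  rewrite -powRN opprK powRD; last by rewrite (gt_eqF T0) implybT.
  by rewrite powRr1 ?(ltW T0).
have P0 : 0 < T `^ (- (m' / 2)) by rewrite powR_gt0.
have h1 := HT1 T TT1.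
have -> : c * (1 / T) * (U * T + (U `^ (1 - kappa / 2) * T `^ (1 + m' / 2) + 1))
  = c * U + (c * U `^ (1 - kappa / 2)) / T `^ (- (m' / 2)) + c / T.
  by rewrite E; field; rewrite !gt_eqF.
have h2 : (c * U `^ (1 - kappa / 2)) / T `^ (- (m' / 2)) <= 1 / 4.
  by rewrite ler_pdivrMr//; lra.
have h3 : c / T <= 1 / 4 by rewrite ler_pdivrMr//; lra.
by move: h2 h3 cU; move: (_ / _ `^ _) (c / T) (c * U) => x y z; lra.
Qed.

End Moment.

(** * Products close to each other *)

Section Clusters.
Variable R : realType.
Implicit Types (s : seq nat) (y : nat -> R) (T : R) (D : nat).

Definition pair_count D s y : R :=
  \sum_(D <= i < 2 * D) \sum_(D <= j < 2 * D) \sum_(n <- s) \sum_(h <- s |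
    `|i%:R * y n - j%:R * y h| < 1) 1.

Lemma sum_fibers (s : seq nat) (K : nat -> nat) (F : nat -> R) :
  \sum_(n <- s) F n = \sum_(k <- undup (map K s)) \sum_(n <- s | K n == k) F n.
Proof.
rewrite (exchange_big_dep predT)//= big_seq [RHS]big_seq; apply: eq_bigr => n ns.
rewrite (eq_bigl (fun k => k == K n)); last by move=> k /=; rewrite eq_sym.
rewrite -big_filter (_ : [seq k <- _ | k == K n] = [:: K n]) ?big_seq1//.
by apply: filter_pred1_uniq; rewrite ?undup_uniq// mem_undup map_f.
Qed.

Lemma sum1_filter (I : Type) (s : seq I) (P : pred I) :
  \sum_(n <- s | P n) 1 = (size [seq n <- s | P n])%:R :> R.
Proof. by rewrite -big_filter; elim: [seq n <- s | P n] => [|a r IH]; rewrite ?big_nil// big_cons IH -nat1r. Qed.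

Lemma count_window (s : seq nat) (P : pred nat) (z : R) : uniq s ->
  (forall n, n \in s -> P n -> z - 2 < n%:R < z + 1) ->
  \sum_(n <- s | P n) 1 <= 4 :> R.
Proof.
move=> us HP; rewrite sum1_filter; pose a := Num.truncn (Num.max (z - 2) 0).
have m0 : 0 <= Num.max (z - 2) 0 by rewrite le_max lexx orbT.
have /andP[a1 a2] := truncn_itv m0; rewrite -/a in a1 a2.
have : (size [seq n <- s | P n] <= size (iota a 4))%N.
  apply: uniq_leq_size; first exact: filter_uniq.
  move=> n; rewrite mem_filter mem_iota => /andP[Pn ns].
  have /andP[n1 n2] := HP n ns Pn.
  have za : z - 2 < a.+1%:R by apply: le_lt_trans a2; rewrite le_max lexx.
  apply/andP; split.
    rewrite -ltnS -(ltr_nat R); apply: le_lt_trans a1 _.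
    by rewrite gt_max ltr0n -natr1 andbT; lra.
  rewrite -(ltr_nat R) natrD; rewrite -natr1 in za; lra.
by rewrite size_iota -(ler_nat R).
Qed.

Lemma ln_dist_le (a b T : R) : 0 < T -> T <= a -> T <= b -> `|a - b| < 1 ->
  `|ln a - ln b| <= T^-1.
Proof.
wlog ab : a b / a <= b => [H|] T0 Ta Tb.
  have [|/ltW] := leP a b => ab; first exact: H.
  by rewrite distrC (distrC (ln a)); exact: H.
rewrite distrC ger0_norm ?subr_ge0// => ab1.
have a0 : 0 < a by lra. have b0 : 0 < b by lra.
rewrite distrC ger0_norm ?subr_ge0 ?ler_ln ?posrE//.
rewrite -ln_div ?posrE//.
have -> : b / a = 1 + (b - a) / a by rewrite mulrBl divff ?gt_eqF//; ring.
apply: le_trans (le_ln1Dx _) _.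
  by apply: (@lt_le_trans _ _ 0); rewrite ?oppr_lt0// divr_ge0 ?subr_ge0// ltW.
apply: (@le_trans _ _ (1 / a)); first by rewrite ler_wpM2r ?invr_ge0 ?(ltW a0)// ltW.
by rewrite mul1r lef_pV2 ?posrE.
Qed.

(** Rounding T ln y_n down to an integer makes the frequencies of W exact multiples of 1/T, hence
    separated. *)
Definition cl_index T y (n : nat) : nat := Num.truncn (T * ln (y n)).
Definition cl_seq T s y : seq nat := undup (map (cl_index T y) s).
Definition cl_size T s y (k : nat) : R := \sum_(n <- s | cl_index T y n == k) 1.
(* square root, because two clusters contain at most [4 min(#1, #2) <= 4 sqrt(#1 #2)] close pairs *)
Definition cl_weight T s y (k : nat) : R := Num.sqrt (cl_size T s y k).

Lemma cl_size_ge0 T s y k : 0 <= cl_size T s y k.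
Proof. by apply: sumr_ge0. Qed.

Lemma cl_weight_sqr T s y k : cl_weight T s y k ^+ 2 = cl_size T s y k.
Proof. by rewrite sqr_sqrtr// cl_size_ge0. Qed.

Lemma sum_cl_weight_sqr T s y :
  \sum_(k <- cl_seq T s y) cl_weight T s y k ^+ 2 = (size s)%:R.
Proof.
under eq_bigr do rewrite cl_weight_sqr.
by rewrite -sum_fibers -[s in size s]filter_predT -sum1_filter.
Qed.

Lemma sum_cl_weight_le T s y :
  \sum_(k <- cl_seq T s y) cl_weight T s y k <= (size s)%:R.
Proof.
rewrite -(sum_cl_weight_sqr T s y); apply: ler_sum => k _.
rewrite cl_weight_sqr /cl_weight /cl_size sum1_filter.
case: (size _) => [|q]; first by rewrite sqrtr0.
have q1 : 1 <= q.+1%:R :> R by rewrite ler1n.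
have := sqrtr_ge0 (q.+1%:R : R); have := sqr_sqrtr (le_trans ler01 q1).
by move: (Num.sqrt _) => x; nra.
Qed.

(** As the y_n lie in distinct unit cells, each n has at most four partners for given i, j. The
    products are at least D Y >= T, so a close pair has logarithms within 1/T, and its clusters are
    within the tolerance of [close_count]. *)
Lemma pair_count_le D T (Y : R) s y : (0 < D)%N -> 0 < T -> T <= D%:R * Y -> 1 <= Y ->
  uniq s -> (forall n, n \in s -> n%:R <= y n < n.+1%:R) ->
  (forall n, n \in s -> Y <= n%:R) ->
  pair_count D s y <= 4 * close_count D T (cl_seq T s y) (cl_weight T s y).
Proof.
move=> D0 T0 TY Y1 us ys sY.
have D1 : 1 <= D%:R :> R by rewrite ler1n.
have yY n : n \in s -> Y <= y n.
  by move=> ns; apply: le_trans (sY n ns) _; case/andP: (ys n ns).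
rewrite /pair_count /close_count big_distrr/= big_nat [leRHS]big_nat.
apply: ler_sum => i /andP[Di iD].
rewrite big_distrr/= big_nat [leRHS]big_nat; apply: ler_sum => j /andP[Dj jD].
have i1 : 1 <= i%:R :> R by rewrite ler1n (leq_trans D0).
have j1 : 1 <= j%:R :> R by rewrite ler1n (leq_trans D0).
pose P n h := `|i%:R * y n - j%:R * y h| < 1.
rewrite (sum_fibers s (cl_index T y)) -/(cl_seq T s y) big_distrr/=.
apply: ler_sum => k _.
under eq_bigr => n _.
  rewrite big_mkcond (sum_fibers s (cl_index T y)) -/(cl_seq T s y).
  over.
rewrite exchange_big/= big_distrr/= [leRHS]big_mkcond/=; apply: ler_sum => h _.
have bound1 n : n \in s -> \sum_(q <- s | (cl_index T y q == h) && P n q) 1 <= 4 :> R.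
  move=> ns; apply: (@count_window _ _ (i%:R * y n / j%:R)) => // q qs /andP[_].
  rewrite /P ltr_norml => /andP[p1 p2]; have /andP[q1 q2] := ys q qs.
  have j0 : 0 < j%:R :> R by lra.
  have e1 : i%:R * y n / j%:R < y q + 1.
    by rewrite ltr_pdivrMr//; nra.
  have e2 : y q - 1 < i%:R * y n / j%:R by rewrite ltr_pdivlMr//; nra.
  by rewrite -natr1 in q2; apply/andP; split; lra.
have bound2 q : q \in s -> \sum_(n <- s | (cl_index T y n == k) && P n q) 1 <= 4 :> R.
  move=> qs; apply: (@count_window _ _ (j%:R * y q / i%:R)) => // n ns /andP[_].
  rewrite /P ltr_norml => /andP[p1 p2]; have /andP[q1 q2] := ys n ns.
  have i0 : 0 < i%:R :> R by lra.
  have e1 : j%:R * y q / i%:R < y n + 1 by rewrite ltr_pdivrMr//; nra.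
  have e2 : y n - 1 < j%:R * y q / i%:R by rewrite ltr_pdivlMr//; nra.
  by rewrite -natr1 in q2; apply/andP; split; lra.
have -> : \sum_(n <- s | cl_index T y n == k) \sum_(q <- s | cl_index T y q == h)
    (if P n q then 1 else 0) =
  \sum_(n <- s | cl_index T y n == k) \sum_(q <- s | (cl_index T y q == h) && P n q) 1 :> R.
  by apply: eq_bigr => n _; rewrite big_mkcondr.
set X := \sum_(n <- s | _) _.
have X1 : X <= 4 * cl_size T s y k.
  rewrite /X /cl_size big_distrr/= big_seq_cond [leRHS]big_seq_cond.
  by apply: ler_sum => n /andP[ns _]; rewrite mulr1; exact: bound1.
have X2 : X <= 4 * cl_size T s y h.
  rewrite /X (exchange_big_dep (fun q => cl_index T y q == h))/=; last by move=> n q _ /andP[].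
  rewrite /cl_size big_distrr/= big_seq_cond [leRHS]big_seq_cond.
  apply: ler_sum => q /andP[qs /eqP qh]; rewrite mulr1.
  apply: le_trans (bound2 q qs); rewrite le_eqVlt; apply/orP; left; apply/eqP.
  by apply: eq_bigl => n; rewrite qh eqxx.
case: ifPn => [_|far].
  have w1 := cl_weight_sqr T s y k; have w2 := cl_weight_sqr T s y h.
  rewrite -w1 in X1; rewrite -w2 in X2.
  have a1 : 0 <= cl_weight T s y k by exact: sqrtr_ge0.
  have a2 : 0 <= cl_weight T s y h by exact: sqrtr_ge0.
  by have [kh|kh] := leP (cl_weight T s y k) (cl_weight T s y h); nra.
rewrite le_eqVlt; apply/orP; left; apply/eqP.
rewrite /X big_seq_cond big1// => n /andP[ns /eqP nk].
rewrite big_seq_cond big1// => q /andP[qs /andP[/eqP qh Pnq]].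
exfalso; move/negP: far; apply.
have yn := yY n ns; have yq := yY q qs.
have iD' : D%:R <= i%:R :> R by rewrite ler_nat.
have jD' : D%:R <= j%:R :> R by rewrite ler_nat.
have h1 : T <= i%:R * y n by apply: le_trans TY _; apply: ler_pM => //; lra.
have h2 : T <= j%:R * y q by apply: le_trans TY _; apply: ler_pM => //; lra.
have := ln_dist_le T0 h1 h2 Pnq.
have yn0 : 0 < y n by lra. have yq0 : 0 < y q by lra.
rewrite !lnM ?posrE//; [|lra|lra].
have tr m : m \in s -> (cl_index T y m)%:R / T <= ln (y m) <= (cl_index T y m)%:R / T + T^-1.
  move=> ms; have ym : 1 <= y m by apply: le_trans (yY m ms).
  have /andP[b1 b2] : (cl_index T y m)%:R <= T * ln (y m) < (cl_index T y m).+1%:R.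
    by apply: truncn_itv; rewrite mulr_ge0 ?(ltW T0)// ln_ge0.
  rewrite ler_pdivrMr// mulrC b1/= -{2}[T^-1]mul1r -mulrDl natr1 ler_pdivlMr// mulrC.
  exact: ltW.
have := tr n ns; have := tr q qs; rewrite nk qh => /andP[c1 c2] /andP[c3 c4].
rewrite !ler_norml => /andP[d1 d2].
by move: c1 c2 c3 c4 d1 d2; move: (k%:R / T) (h%:R / T) (T^-1) => x z v *; apply/andP; split; lra.
Qed.

End Clusters.

(** * The second moment of the cosine sum *)

Section Variance.
Variable R : realType.
Implicit Types (s : seq nat) (y : nat -> R) (T A : R) (D : nat).

Definition trig_block (m1 m2 : nat) s y (c : nat -> R) (a : R) : R :=
  \sum_(m1 <= j < m2) \sum_(n <- s) c j * cos (2 * pi * j%:R * y n * a).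

Lemma continuous_trig_block m1 m2 s y c : continuous (trig_block m1 m2 s y c).
Proof.
apply: continuous_sum => j; apply: continuous_sum => n x.
by apply: cvgM; [exact: cvg_cst|exact: continuous_cosM].
Qed.

Lemma truncn_eq_dist (x z : R) : 0 <= x -> 0 <= z -> Num.truncn x = Num.truncn z ->
  `|x - z| < 1.
Proof.
move=> x0 z0 E; have /andP[a1 a2] := truncn_itv x0; have /andP[b1 b2] := truncn_itv z0.
rewrite E in a1 a2; rewrite -natr1 in a2 b2; rewrite ltr_norml; apply/andP; split; lra.
Qed.

(** The cosine sum is completed to a square modulus with frequencies 2 pi j y_n. Two of them in one
    cell of length 1/A satisfy 2 pi A |i y_n - j y_h| < 1, hence form a close pair. *)
Lemma block_sieve A D s y c : 1 <= A -> (forall n, 0 <= y n) ->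
  (forall j, 0 <= c j <= 1) ->
  Int 0 A (fun a => (1 - a / A) * trig_block D (2 * D) s y c a ^+ 2) <=
  32 * A * pair_count D s y.
Proof.
move=> A1 y0 c01; have A0 : 0 < A by lra.
have c0 j : 0 <= c j by case/andP: (c01 j).
have c1 j : c j <= 1 by case/andP: (c01 j).
pose r := [seq (j, n) | j <- index_iota D (2 * D), n <- s].
pose l (jn : nat * nat) : R := 2 * pi * jn.1%:R * y jn.2.
pose cc (jn : nat * nat) : R := c jn.1.
have p0 : 0 < 2 * pi :> R by rewrite mulr_gt0// pi_gt0.
have l0 jn : 0 <= l jn by rewrite !mulr_ge0// ?pi_ge0.
apply: (@le_trans _ _ (Int 0 A (fun t => (1 - t / A) * trigsq r cc l t))).
  apply: le_Int.
  - by move=> x; apply: cvgM; [exact: continuous_tent|apply: cvgM; exact: continuous_trig_block].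
  - by move=> x; apply: cvgM; [exact: continuous_tent|exact: continuous_trigsq].
  move=> x /andP[x0 xA]; rewrite ler_wpM2l//.
    by rewrite subr_ge0 ler_pdivrMr// mul1r.
  rewrite /trigsq /trig_block big_allpairs/= lerDl; exact: sqr_ge0.
apply: le_trans (large_sieve r A0 (fun jn => c0 jn.1) l0) _.
rewrite ler_wpM2l//; first by rewrite mulr_ge0 ?ler0n ?(ltW A0).
rewrite big_allpairs/= /pair_count; apply: ler_sum => i _.
rewrite [leRHS]exchange_big/=; apply: ler_sum => n _.
rewrite big_mkcond/= big_allpairs/=; apply: ler_sum => j _.
rewrite [leRHS]big_mkcond/=; apply: ler_sum => h _.
case: ifP => [/eqP E|_]; last by case: ifP.
have d := truncn_eq_dist (mulr_ge0 (ltW A0) (l0 (i, n))) (mulr_ge0 (ltW A0) (l0 (j, h))) E.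
rewrite ifT; last first.
  apply: le_lt_trans d; rewrite /l/=.
  have -> : A * (2 * pi * i%:R * y n) - A * (2 * pi * j%:R * y h) =
     (A * (2 * pi)) * (i%:R * y n - j%:R * y h) by ring.
  rewrite normrM -[leLHS]mul1r ler_wpM2r// ger0_norm ?mulr_ge0 ?(ltW A0) ?(ltW p0) ?pi_ge0//.
  have := pi_ge2 R; nra.
by rewrite /cc/=; have := c0 i; have := c0 j; have := c1 i; have := c1 j; nra.
Qed.

Lemma sqr_sum_le (L : nat) (x : nat -> R) :
  (\sum_(0 <= i < L) x i) ^+ 2 <= L%:R * \sum_(0 <= i < L) x i ^+ 2.
Proof.
rewrite expr2 big_distrlr/=.
apply: (@le_trans _ _ (\sum_(0 <= i < L) \sum_(0 <= j < L) (x i ^+ 2 / 2 + x j ^+ 2 / 2))).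
  apply: ler_sum => i _; apply: ler_sum => j _; have := sqr_ge0 (x i - x j); nra.
have E : \sum_(0 <= i < L) \sum_(0 <= j < L) x i ^+ 2 / 2 = L%:R * (\sum_(0 <= i < L) x i ^+ 2) / 2.
  under eq_bigr do rewrite sumr_const_nat subn0 -[_ *+ L]mulr_natl mulrA.
  by rewrite -big_distrl/= -big_distrr.
under [leLHS]eq_bigr do rewrite big_split/=.
by rewrite big_split/= [X in _ + X]exchange_big/= E -mulrDl -mulr2n -[_ *+ 2]mulr_natr mulfK.
Qed.

Lemma trig_block_dyadic L s y c a :
  trig_block 1 (2 ^ L) s y c a = \sum_(0 <= i < L) trig_block (2 ^ i) (2 * 2 ^ i) s y c a.
Proof.
elim: L => [|L IH]; first by rewrite /trig_block !big_geq.
rewrite big_nat_recr//= -IH /trig_block -expnS.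
by rewrite (big_cat_nat (n := 2 ^ L))//= ?expn_gt0// leq_exp2l.
Qed.

(* Cauchy-Schwarz over the dyadic blocks comes before the large sieve, so that only pairs
   [j, j'] in the same block are compared. *)
Lemma dyadic_sieve A L s y c : 1 <= A -> (forall n, 0 <= y n) ->
  (forall j, 0 <= c j <= 1) ->
  Int 0 A (fun a => (1 - a / A) * trig_block 1 (2 ^ L) s y c a ^+ 2) <=
  32 * A * L%:R * \sum_(0 <= i < L) pair_count (2 ^ i) s y.
Proof.
move=> A1 y0 c01; have A0 : 0 < A by lra.
have cK m1 m2 : continuous (fun a : R => (1 - a / A) * trig_block m1 m2 s y c a ^+ 2).
  by move=> x; apply: cvgM; [exact: continuous_tent|apply: cvgM; exact: continuous_trig_block].
apply: (@le_trans _ _ (L%:R * \sum_(0 <= i < L)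
   Int 0 A (fun a => (1 - a / A) * trig_block (2 ^ i) (2 * 2 ^ i) s y c a ^+ 2))).
  rewrite -Int_sum// -IntZ; last by apply: continuous_sum => i; exact: cK.
  apply: le_Int => //.
    by move=> x; apply: cvgM; [exact: cvg_cst|apply: continuous_sum => i; exact: cK].
  move=> x /andP[x0 xA]; rewrite trig_block_dyadic -big_distrr/= [leRHS]mulrCA ler_wpM2l//.
    by rewrite subr_ge0 ler_pdivrMr// mul1r.
  exact: sqr_sum_le.
rewrite [32 * A * _]mulrC -mulrA ler_wpM2l ?ler0n// big_distrr/=.
by apply: ler_sum => i _; exact: block_sieve.
Qed.

End Variance.

(** * A cosine polynomial negative away from the integers *)

Section FejerPower.
Variable R : realType.
Implicit Types (x t : R).

Definition cexp (t : R) : R[i] := (cos t +i* sin t)%C.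
(** Square modulus with values in [R], multiplicative, so that powers of the geometric sum are
    handled by [csqX]. *)
Definition csq (z : R[i]) : R := complex.Re z ^+ 2 + complex.Im z ^+ 2.

Lemma csqM (z w : R[i]) : csq (z * w) = csq z * csq w.
Proof. by case: z => a b; case: w => c d; rewrite /csq /=; ring. Qed.

Lemma csqX (z : R[i]) p : csq (z ^+ p) = csq z ^+ p.
Proof.
elim: p => [|p IH]; first by rewrite !expr0 /csq/= expr1n expr0n addr0.
by rewrite !exprS csqM IH.
Qed.

Lemma cexpX t k : cexp t ^+ k = cexp (k%:R * t).
Proof.
elim: k => [|k IH]; first by rewrite expr0 mul0r /cexp cos0 sin0.
rewrite exprS IH -nat1r mulrDl mul1r /cexp cosD sinD.
by apply/eqP; rewrite eq_complex/=; apply/andP; split; apply/eqP; ring.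
Qed.

Lemma csq_one_sub t : csq (1 - cexp t) = 4 * sin (t / 2) ^+ 2.
Proof.
have : csq (1 - cexp t) = 2 * (1 - cos t).
  by rewrite /csq /= ; have := cos2Dsin2 t; nra.
by rewrite one_sub_cos => ->; ring.
Qed.

(** The sum times 1 - z equals 1 - z^L, of square modulus at most 4. *)
Lemma csq_geom_le (L : nat) t (e : R) : 0 < e -> e <= csq (1 - cexp t) ->
  csq (\sum_(a < L) cexp t ^+ a) <= 4 / e.
Proof.
move=> e0 he; rewrite ler_pdivlMr//.
have : csq (\sum_(a < L) cexp t ^+ a) * csq (1 - cexp t) = csq (1 - cexp (L%:R * t)).
  rewrite -csqM mulrC -cexpX; congr csq.
  by rewrite -[1 - _ ^+ L]opprB subrX1 -mulNr opprB.
rewrite csq_one_sub => E.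
have S0 : 0 <= csq (\sum_(a < L) cexp t ^+ a) by rewrite addr_ge0 ?sqr_ge0.
apply: le_trans (ler_wpM2l S0 he) _; rewrite csq_one_sub E csq_one_sub.
by have := sin2cos2 (L%:R * t / 2); have := sqr_ge0 (cos (L%:R * t / 2)); lra.
Qed.

Lemma cos_int_period (k : int) t : cos (t + 2 * pi * k%:~R) = cos t.
Proof.
have H (n : nat) (u : R) : cos (u + 2 * pi * n%:R) = cos u.
  elim: n u => [|n IH] u; first by rewrite mulr0 addr0.
  have -> : u + 2 * pi * n.+1%:R = (u + pi *+ 2) + 2 * pi * n%:R.
    by rewrite -natr1 -mulr_natl; ring.
  by rewrite IH cosD2pi.
case: k => n; first exact: H.
rewrite NegzE; rewrite -(H n.+1 (t + _)); congr cos.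
by rewrite mulrNz mulrN subrK.
Qed.

Lemma csq_one_sub_ge x (e : R) : 0 <= e -> (forall k : int, e <= `|x - k%:~R|) ->
  e ^+ 2 <= csq (1 - cexp (2 * pi * x)).
Proof.
move=> e0 He; pose k := Num.floor (x + 1 / 2).
have /andP[k1 k2] := floor_itv (x + 1 / 2); rewrite -/k in k1 k2.
pose r := x - k%:~R.
have r12 : `|r| <= 1 / 2.
  by rewrite intrD in k2; rewrite ler_norml /r; apply/andP; split; lra.
have -> : csq (1 - cexp (2 * pi * x)) = 4 * sin (pi * r) ^+ 2.
  rewrite csq_one_sub; have h1 := one_sub_cos (2 * pi * x); have h2 := one_sub_cos (2 * pi * r).
  have E : cos (2 * pi * x) = cos (2 * pi * r).
    by rewrite -[RHS](cos_int_period k); congr cos; rewrite /r; ring.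
  rewrite E h2 in h1; have -> : pi * r = 2 * pi * r / 2 by field.
  by lra.
have hs : `|r| / 2 <= `|sin (pi * r)|.
  have p2 := pi_ge2 R; have p4 : pi <= 4 :> R by have := pihalf_lt2 R; lra.
  (* Halving the angle brings it into [-1, 1], as |r| <= 1/2 and pi <= 4; the double-angle formula
     then gives the bound for pi r. *)
  pose v := pi * r / 2.
  have v1 : `|v| <= 1.
    rewrite /v !normrM (ger0_norm (x := pi)) ?pi_ge0// (ger0_norm (x := 2^-1)) ?invr_ge0//.
    by have := normr_ge0 r; nra.
  have -> : pi * r = v *+ 2 by rewrite /v -mulr_natr divfK.
  rewrite sin_mulr2n -[cos v * sin v *+ 2]mulr_natr !normrM (ger0_norm (x := 2)) ?ler0n//.
  have h1 := sin_ge_half v1.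
  have h2 : 1 / 2 <= `|cos v|.
    apply: le_trans (ler_norm _); apply: le_trans (cos_ge_quad v).
    have : v ^+ 2 <= 1 ^+ 2 by apply: sqr_le_norm; rewrite normr1.
    by rewrite expr1n; lra.
  have h3 : `|r| <= `|v|.
    rewrite /v !normrM (ger0_norm (x := pi)) ?pi_ge0// (ger0_norm (x := 2^-1)) ?invr_ge0//.
    by have := normr_ge0 r; nra.
  have := normr_ge0 (sin v); nra.
have he := He k; rewrite -/r in he.
have : (e / 2) ^+ 2 <= sin (pi * r) ^+ 2.
  by apply: sqr_le_norm; rewrite (ger0_norm (x := e / 2)) ?divr_ge0//; lra.
by lra.
Qed.


(* the sum over pairs (k, l), regrouped according to the difference j = l - k *)
Lemma csq_cexp_sum (r : nat -> R) K t : (forall k, (K <= k)%N -> r k = 0) ->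
  csq (\sum_(k < K) (r k)%:C%C * cexp t ^+ k) =
  \sum_(0 <= k < K) r k ^+ 2 +
  2 * \sum_(1 <= j < K) (\sum_(0 <= k < K) r k * r (k + j)%N) * cos (j%:R * t).
Proof.
move=> rK.
have -> : csq (\sum_(k < K) (r k)%:C%C * cexp t ^+ k) = trigsq (index_iota 0 K) r (fun k => k%:R) t.
  rewrite /csq /trigsq !big_mkord; congr (_ ^+ 2 + _ ^+ 2).
    rewrite (raddf_sum (@complex.Re R)); apply: eq_bigr => k _.
    by rewrite cexpX /= mul0r subr0.
  rewrite (raddf_sum (@complex.Im R)); apply: eq_bigr => k _.
  by rewrite cexpX /= mul0r addr0.
rewrite trigsqE.
pose f (k l : nat) := r k * r l * cos ((k%:R - l%:R) * t).
have fC k l : f k l = f l k by rewrite /f -cosN; congr (_ * cos _); ring.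
have E1 : \sum_(0 <= k < K) \sum_(0 <= l < K) f k l =
   \sum_(0 <= k < K) f k k + 2 * \sum_(0 <= k < K) \sum_(k.+1 <= l < K) f k l.
  elim: K {rK} => [|K IH]; first by rewrite !big_geq// mulr0 addr0.
  rewrite [LHS]big_nat_recr//= [X in _ = X + _]big_nat_recr//=.
  rewrite [X in _ = _ + 2 * X]big_nat_recr//= (big_geq (m := K.+1) (n := K.+1))// addr0.
  under eq_bigr do rewrite big_nat_recr//=.
  rewrite big_split/= IH [X in _ + X = _]big_nat_recr//=.
  have -> : \sum_(0 <= k < K) \sum_(k.+1 <= l < K.+1) f k l =
     \sum_(0 <= k < K) \sum_(k.+1 <= l < K) f k l + \sum_(0 <= k < K) f k K.
    rewrite -big_split/= big_nat [RHS]big_nat; apply: eq_bigr => k kK.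
    by rewrite big_nat_recr.
  under [X in _ + (X + _) = _]eq_bigr do rewrite fC.
  ring.
rewrite E1; congr (_ + 2 * _).
  by apply: eq_bigr => k _; rewrite /f subrr mul0r cos0 mulr1 expr2.
transitivity (\sum_(0 <= k < K) \sum_(1 <= j < K) r k * r (k + j)%N * cos (j%:R * t)).
  rewrite big_nat [RHS]big_nat; apply: eq_bigr => k /andP[_ kK].
  rewrite [RHS](big_cat_nat (n := (K - k)%N))//=; [|lia|lia].
  have -> : \sum_(K - k <= j < K) r k * r (k + j)%N * cos (j%:R * t) = 0.
    rewrite big_nat big1// => j /andP[j1 _].
    by rewrite (rK (k + j)%N) ?mulr0 ?mul0r// -leq_subLR.
  rewrite addr0.
  rewrite -addn1 addnC big_addn; apply: eq_bigr => j _.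
  by rewrite /f addnC natrD -cosN; congr (_ * cos _); ring.
by rewrite exchange_big/=; apply: eq_bigr => j _; rewrite big_distrl.
Qed.

(* [c j] is the j-th correlation of the coefficients of [(1 + z + ... + z^(L-1)) ^ p],
   divided by the 0-th one. *)
Lemma fejer_kernel (d : R) : 0 < d -> exists p L0 : nat, (0 < p)%N /\
  forall L : nat, (L0 <= L)%N -> (0 < L)%N -> exists c : nat -> R,
  [/\ forall j, 0 <= c j <= 1, forall j, (p * L <= j)%N -> c j = 0 &
   forall x, (forall k : int, L%:R `^ (- 1 + d) <= `|x - k%:~R|) ->
     \sum_(1 <= j < p * L) c j * cos (2 * pi * j%:R * x) <= - (1 / 4)].
Proof.
(* With p d >= 1, a point at distance e = L^(d - 1) from the integers satisfies (e L)^p = L^(d p) >=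
   L: the p-th power gains a full factor L^2 in square modulus. *)
move=> d0; pose p := (Num.truncn d^-1).+1.
have pd : 1 <= p%:R * d.
  by rewrite -ler_pdivrMr// div1r; apply: ltW; exact: truncnS_gt.
exists p, (4 ^ p * (2 * p))%N; split=> // L LL L0.
have L1 : 1 <= L%:R :> R by rewrite ler1n.
have L0' : 0 < L%:R :> R by rewrite ltr0n.
pose P : {poly R} := (\sum_(a < L) 'X^a) ^+ p.
pose K := (p * L)%N.
have sP : (size P <= K)%N.
  have s1 : (size (\sum_(a < L) 'X^a : {poly R})%R <= L)%N.
    apply: leq_trans (size_sum _ _ _) _; apply/bigmax_leqP => a _.
    by rewrite size_polyXn.
  apply: leq_trans (size_poly_exp_leq _ _) _.
  by rewrite /K; case: (size _) s1 => [|q] /= s1; nia.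
pose r k := P`_k.
have rK k : (K <= k)%N -> r k = 0 by move=> kK; rewrite /r nth_default// (leq_trans sP).
have r0 k : 0 <= r k.
  rewrite /r /P; elim: (p) k => [|q IH] k; first by rewrite expr0 coef1 ler0n.
  rewrite exprS coefM sumr_ge0// => i _; rewrite mulr_ge0//.
  by rewrite coef_sum sumr_ge0// => a _; rewrite coefXn ler0n.
have rsum : \sum_(0 <= k < K) r k = L%:R ^+ p.
  have := horner_coef_wide 1 sP; rewrite {1}/P horner_exp horner_sum.
  under eq_bigr do rewrite hornerXn expr1n.
  rewrite sumr_const card_ord => ->; rewrite big_mkord.
  by apply: eq_bigr => k _; rewrite expr1n mulr1.
pose c0 := \sum_(0 <= k < K) r k ^+ 2.
pose cj j := \sum_(0 <= k < K) r k * r (k + j)%N.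
(* Cauchy-Schwarz over the at most K = p L coefficients: the constant term is at least L^(2p) / (p
   L). *)
have Kc : (L%:R ^+ p) ^+ 2 <= K%:R * c0 by rewrite -rsum; exact: sqr_sum_le.
have c0p : 0 < c0.
  have Lp : 0 < (L%:R ^+ p) ^+ 2 :> R by rewrite !exprn_gt0.
  have K0 : 0 < K%:R :> R by rewrite ltr0n muln_gt0 L0.
  by rewrite -(pmulr_rgt0 _ K0); apply: lt_le_trans Kc.
have cj0 j : 0 <= cj j by apply: sumr_ge0 => k _; rewrite mulr_ge0.
have cj1 j : cj j <= c0.
  have H : \sum_(0 <= k < K) r (k + j)%N ^+ 2 <= c0.
    have -> : \sum_(0 <= k < K) r (k + j)%N ^+ 2 = \sum_(j <= k < K + j) r k ^+ 2.
      by rewrite -{2}[j]add0n big_addn addnK.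
    apply: (@le_trans _ _ (\sum_(0 <= k < K + j) r k ^+ 2)).
      rewrite [leRHS](big_cat_nat (n := j))//= ?leq_addl// lerDr sumr_ge0// => k _.
      exact: sqr_ge0.
    rewrite (big_cat_nat (n := K)) ?leq_addr//=.
    have -> : \sum_(K <= k < K + j) r k ^+ 2 = 0.
      by rewrite big_nat big1// => k /andP[kK _]; rewrite rK// expr0n.
    by rewrite addr0.
  apply: (@le_trans _ _ (\sum_(0 <= k < K) (r k ^+ 2 / 2 + r (k + j)%N ^+ 2 / 2))).
    apply: ler_sum => k _; have := sqr_ge0 (r k - r (k + j)%N); nra.
  by rewrite big_split/= -!big_distrl/=; move: H; rewrite -/c0; lra.
exists (fun j => cj j / c0); split.
- by move=> j; rewrite divr_ge0 ?(ltW c0p)//= ler_pdivrMr// mul1r.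
- move=> j jK; rewrite /cj big1 ?mul0r// => k _.
  by rewrite (rK (k + j)%N) ?mulr0//; apply: leq_trans jK _; exact: leq_addl.
move=> x Hx; set e := L%:R `^ _ in Hx; have e0 : 0 < e by rewrite powR_gt0.
pose th := 2 * pi * x.
have hZ := csq_geom_le L (exprn_gt0 2 e0) (csq_one_sub_ge (ltW e0) Hx); rewrite -/th in hZ.
have ER : csq ((\sum_(a < L) cexp th ^+ a) ^+ p) = c0 + 2 * \sum_(1 <= j < K) cj j * cos (j%:R * th).
  rewrite -(csq_cexp_sum th rK); congr csq.
  have sP' : (size (map_poly (real_complex R) P) <= K)%N by rewrite size_map_poly.
  transitivity ((map_poly (real_complex R) P).[cexp th]).
    rewrite /P rmorphXn/= horner_exp rmorph_sum horner_sum; congr (_ ^+ _).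
    by apply: eq_bigr => a _; rewrite /= map_polyXn hornerXn.
  rewrite (horner_coef_wide _ sP'); apply: eq_bigr => k _.
  by rewrite coef_map.
(* Far from the integers the kernel is at most 4^p L^(2p - 2), which is below half the constant term
   once L >= 2 p 4^p. Then 1 + 2S <= 1/2, that is S <= -1/4. *)
have Hle : csq ((\sum_(a < L) cexp th ^+ a) ^+ p) <= c0 / 2.
  rewrite csqX; apply: (@le_trans _ _ ((4 / e ^+ 2) ^+ p)).
    by rewrite lerXn2r ?nnegrE ?divr_ge0 ?addr_ge0 ?sqr_ge0.
  have eL : e * L%:R = L%:R `^ d.
    rewrite /e powRD; last by rewrite (gt_eqF L0') implybT.
    by rewrite powR_inv1 ?ler0n// mulrAC mulVf ?mul1r// gt_eqF.
  have eLp : L%:R <= (e * L%:R) ^+ p.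
    rewrite eL -powR_mulrn ?powR_ge0// -powRrM.
    by rewrite -[leLHS](powRr1 (ltW L0')) ler_powR// mulrC.
  have LLR : 4 ^+ p * (2 * p%:R) <= L%:R :> R by rewrite -natrX -!natrM ler_nat.
  have e2p : 0 < e ^+ p by rewrite exprn_gt0.
  have -> : (4 / e ^+ 2) ^+ p = 4 ^+ p / (e ^+ p) ^+ 2.
    by rewrite expr_div_n -!exprM mulnC.
  have K0 : 0 < K%:R :> R by rewrite ltr0n muln_gt0 L0.
  rewrite ler_pdivrMr ?exprn_gt0// -(ler_pM2l K0).
  have h1 : K%:R * 4 ^+ p <= L%:R ^+ 2 / 2 :> R.
    rewrite /K natrM expr2; have := ler_wpM2l (ltW L0') LLR.
    by move: (4 ^+ p) => q; lra.
  have h2 : L%:R ^+ 2 <= (e ^+ p) ^+ 2 * (L%:R ^+ p) ^+ 2 :> R.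
    rewrite -!exprMn; apply: lerXn2r; rewrite ?nnegrE ?ler0n//.
    by rewrite exprn_ge0// mulr_ge0 ?ler0n ?(ltW e0).
  have h3 := ler_wpM2l (sqr_ge0 (e ^+ p)) Kc.
  apply: le_trans h1 _; move: h2 h3; move: ((e ^+ p) ^+ 2) => q; nra.
have : c0 + 2 * \sum_(1 <= j < K) cj j * cos (j%:R * th) <= c0 / 2 by rewrite -ER.
have -> : \sum_(1 <= j < K) cj j * cos (j%:R * th) =
    c0 * \sum_(1 <= j < K) cj j / c0 * cos (2 * pi * j%:R * x).
  rewrite big_distrr/=; apply: eq_bigr => j _.
  have -> : 2 * pi * j%:R * x = j%:R * th by rewrite /th; ring.
  by field; rewrite gt_eqF.
move: (\sum_(_ <= _ < _) _) => S; nra.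
Qed.

End FejerPower.

(** * Gaps in distinct unit cells *)

Section Selection.
Variable R : realType.
Implicit Types (x : nat -> R) (N : nat).

Lemma increasing_of_gap x (c : R) : 0 < c ->
  (forall n, (1 <= n)%N -> c <= x n.+1 - x n) ->
  forall a b, (a < b)%N -> x a.+1 < x b.+1.
Proof.
move=> c0 gap a; elim=> // b IH; rewrite ltnS leq_eqVlt => /predU1P[->|/IH ab].
  by have := gap b.+1 isT; lra.
by have := gap b.+1 isT; lra.
Qed.

Lemma sum_ord_lt_ge N : (2 <= N)%N ->
  N%:R ^+ 2 / 4 <= \sum_(p : 'I_N * 'I_N | (p.2 < p.1)%N) 1 :> R.
Proof.
move=> N2.
have -> : \sum_(p : 'I_N * 'I_N | (p.2 < p.1)%N) 1 = \sum_(0 <= i < N) i%:R :> R.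
  rewrite -(pair_big_dep xpredT (fun i j : 'I_N => (j < i)%N) (fun _ _ => 1))/= big_mkord.
  apply: eq_bigr => i _.
  rewrite -(big_mkord (fun j => (j < i)%N) (fun=> 1 : R)).
  by rewrite -(big_nat_widen _ _ _ xpredT) ?(ltnW (ltn_ord i))// sumr_const_nat subn0.
have E n : 2 * \sum_(0 <= i < n) i%:R = n%:R * (n%:R - 1) :> R.
  elim: n => [|n IH]; first by rewrite big_geq// mulr0 mul0r.
  by rewrite big_nat_recr//= mulrDr IH -natr1; ring.
have N2' : 2 <= N%:R :> R by rewrite ler_nat.
by have := E N; nra.
Qed.

Lemma sqr_sum_seq_le (s : seq nat) (f : nat -> R) :
  (\sum_(k <- s) f k) ^+ 2 <= (size s)%:R * \sum_(k <- s) f k ^+ 2.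
Proof.
rewrite (big_nth 0%N) [X in _ * X](big_nth 0%N).
exact: (@sqr_sum_le R (size s) (fun i => f (nth 0%N s i))).
Qed.

Section Cells.
Variables (x : nat -> R) (N : nat).
Hypothesis xinc : forall a b, (a < b)%N -> x a.+1 < x b.+1.

Definition gap_of (p : 'I_N * 'I_N) : R := x p.1.+1 - x p.2.+1.
Definition cell_of (p : 'I_N * 'I_N) : nat := Num.truncn (gap_of p).
Definition ordered_pairs : seq ('I_N * 'I_N) :=
  [seq p : 'I_N * 'I_N <- enum {: 'I_N * 'I_N} | (p.2 < p.1)%N].
Definition cells : seq nat := undup (map cell_of ordered_pairs).

Lemma mem_ordered_pairs p : (p \in ordered_pairs) = (p.2 < p.1)%N.
Proof. by rewrite mem_filter mem_enum andbT. Qed.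

Lemma gap_of_ge0 p : p \in ordered_pairs -> 0 <= gap_of p.
Proof. by rewrite mem_ordered_pairs => /xinc h; rewrite subr_ge0 ltW. Qed.

(** Two gaps with the same integer part differ by less than 1. Exchanging the two subtracted terms
    turns such a pair of gaps into a quadruple of the energy, injectively. *)
Lemma same_cell_le_energy :
  \sum_(p <- ordered_pairs) \sum_(q <- ordered_pairs | cell_of q == cell_of p) 1
  <= (add_energy x N)%:R :> R.
Proof.
pose Q : pred (('I_N * 'I_N) * ('I_N * 'I_N)) := fun u =>
  [&& (u.1.2 < u.1.1)%N, (u.2.2 < u.2.1)%N & cell_of u.2 == cell_of u.1].
have -> : \sum_(p <- ordered_pairs) \sum_(q <- ordered_pairs | cell_of q == cell_of p) 1
   = #|Q|%:R :> R.
  rewrite /ordered_pairs big_filter/= big_enum_cond/=.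
  under eq_bigr do rewrite big_filter_cond/= big_enum_cond/=.
  rewrite (pair_big_dep (fun p : 'I_N * 'I_N => (p.2 < p.1)%N)
    (fun p q : 'I_N * 'I_N => (q.2 < q.1)%N && (cell_of q == cell_of p)) (fun _ _ => 1))/=.
  by rewrite sumr_const.
pose f (u : ('I_N * 'I_N) * ('I_N * 'I_N)) := (u.1.1, u.2.2, u.1.2, u.2.1).
have finj : injective f by move=> [[a b] [a' b']] [[e g] [e' g']] [-> -> -> ->].
rewrite ler_nat -(card_imset _ finj); apply: subset_leq_card.
apply/fintype.subsetP => t /imsetP[u /and3P[h1 h2 /eqP h3] ->].
rewrite inE /f/=.
have g1 : 0 <= gap_of u.1 by apply: gap_of_ge0; rewrite mem_ordered_pairs.
have g2 : 0 <= gap_of u.2 by apply: gap_of_ge0; rewrite mem_ordered_pairs.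
have := truncn_eq_dist g1 g2 (esym h3); congr (`| _ | < 1); rewrite /gap_of; ring.
Qed.

(** A representative of each visited cell; the default 0 is taken only off [cells] and keeps the
    function nonnegative everywhere. *)
Definition cell_gap (n : nat) : R :=
  if [pick p : 'I_N * 'I_N | (p.2 < p.1)%N && (cell_of p == n)] is Some p then gap_of p else 0.

Lemma cell_gap_ge0 n : 0 <= cell_gap n.
Proof.
rewrite /cell_gap; case: pickP => // p /andP[h _].
by apply: gap_of_ge0; rewrite mem_ordered_pairs.
Qed.

Lemma cell_gapP n : n \in cells -> n%:R <= cell_gap n < n.+1%:R /\
  exists a b, [/\ (1 <= b)%N, (b < a)%N, (a <= N)%N & cell_gap n = x a - x b].
Proof.
rewrite mem_undup => /mapP[p pin ->]; rewrite mem_ordered_pairs in pin.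
rewrite /cell_gap; case: pickP => [q /andP[h /eqP E]|/(_ p)]; last by rewrite pin eqxx.
have q0 : 0 <= gap_of q by apply: gap_of_ge0; rewrite mem_ordered_pairs.
split; first by rewrite -E; exact: truncn_itv.
by exists q.1.+1, q.2.+1; split.
Qed.

(** Cauchy-Schwarz: the squared number of ordered pairs is at most the number of cells times the
    number of pairs of gaps sharing a cell, which the energy bounds. *)
Lemma size_cells_ge : (2 <= N)%N ->
  (N%:R ^+ 2 / 4) ^+ 2 <= (size cells)%:R * (add_energy x N)%:R :> R.
Proof.
move=> N2; pose P : R := \sum_(p <- ordered_pairs) 1.
have HP : N%:R ^+ 2 / 4 <= P.
  by rewrite /P /ordered_pairs big_filter big_enum_cond; exact: sum_ord_lt_ge.
have fib (F : 'I_N * 'I_N -> R) : \sum_(p <- ordered_pairs) F p =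
    \sum_(k <- cells) \sum_(p <- ordered_pairs | cell_of p == k) F p.
  rewrite (exchange_big_dep predT)//= big_seq [RHS]big_seq; apply: eq_bigr => p pin.
  rewrite (eq_bigl (fun k => k == cell_of p)); last by move=> k /=; rewrite eq_sym.
  rewrite -big_filter (_ : [seq k <- _ | k == cell_of p] = [:: cell_of p]) ?big_seq1//.
  by apply: filter_pred1_uniq; rewrite ?undup_uniq// mem_undup map_f.
pose sz k : R := \sum_(p <- ordered_pairs | cell_of p == k) 1.
apply: (@le_trans _ _ (P ^+ 2)).
  by rewrite lerXn2r ?nnegrE ?(le_trans _ HP)// divr_ge0 ?sqr_ge0.
rewrite /P fib; apply: le_trans (sqr_sum_seq_le cells sz) _.
rewrite ler_wpM2l ?ler0n//; apply: le_trans same_cell_le_energy.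
rewrite fib; apply: ler_sum => k _.
rewrite expr2 {1}/sz big_distrl/=; apply: ler_sum => p /eqP pk.
by rewrite mul1r /sz pk.
Qed.

(** There are only Y cells below Y, hence the [Y%:R] added to the size of the selection. *)
Lemma select_gaps (Y : nat) : (2 <= N)%N -> exists (s : seq nat) (y : nat -> R),
  [/\ uniq s, forall n, 0 <= y n,
      forall n, n \in s -> [/\ (Y <= n)%N, n%:R <= y n < n.+1%:R &
        exists a b, [/\ (1 <= b)%N, (b < a)%N, (a <= N)%N & y n = x a - x b]] &
      (N%:R ^+ 2 / 4) ^+ 2 <= ((size s)%:R + Y%:R) * (add_energy x N)%:R :> R].
Proof.
move=> N2; exists [seq k <- cells | (Y <= k)%N], cell_gap; split.
- by rewrite filter_uniq// undup_uniq.
- exact: cell_gap_ge0.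
- by move=> n; rewrite mem_filter => /andP[Yn /cell_gapP[]].
apply: le_trans (size_cells_ge N2) _; rewrite ler_wpM2r ?ler0n// -natrD ler_nat.
rewrite -(count_predC (fun k => (Y <= k)%N) cells) -size_filter leq_add2l.
rewrite -size_filter -[leqRHS](size_iota 0); apply: uniq_leq_size.
  by rewrite filter_uniq// undup_uniq.
by move=> k; rewrite mem_filter mem_iota /= -ltnNge => /andP[].
Qed.

End Cells.

End Selection.

(** * Minimal gaps and bad sets *)

Section MinimalGap.
Variable R : realType.
Implicit Types (x : nat -> R) (al : R) (N : nat).

Lemma dist_int_le (y : R) (k : int) : dist_int y <= `|y - k%:~R|.
Proof.
apply: ge_inf; last by exists k.
by exists 0 => _ [j _ <-].
Qed.

Lemma dist_int_ge0 (y : R) : 0 <= dist_int y.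
Proof.
apply: lb_le_inf; first by exists `|y - 0%:~R|, 0.
by move=> _ [j _ <-].
Qed.

Lemma dist_int_le_half (y : R) : dist_int y <= 1 / 2.
Proof.
apply: le_trans (dist_int_le y (Num.floor (y + 1 / 2))) _.
have /andP[k1 k2] := floor_itv (y + 1 / 2); rewrite intrD in k2.
by rewrite ler_norml; apply/andP; split; lra.
Qed.

Lemma delta_min_le x al N a b : (1 <= a <= N)%N -> (1 <= b <= N)%N -> a <> b ->
  delta_min x al N <= dist_int (al * x a - al * x b).
Proof.
move=> ha hb ab; apply: ge_inf; last by exists (a, b).
by exists 0 => _ [j _ <-]; exact: dist_int_ge0.
Qed.

Lemma delta_min_ge0 x al N : (2 <= N)%N -> 0 <= delta_min x al N.
Proof.
move=> N2; apply: lb_le_inf; last by move=> _ [j _ <-]; exact: dist_int_ge0.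
by exists (dist_int (al * x 1%N - al * x 2%N)), (1%N, 2%N) => //=; split=> //; lia.
Qed.

Lemma delta_min_le_half x al N : (2 <= N)%N -> delta_min x al N <= 1 / 2.
Proof.
move=> N2; apply: le_trans (dist_int_le_half (al * x 1%N - al * x 2%N)).
by apply: delta_min_le => //; lia.
Qed.

Lemma delta_min_mono x al M N : (2 <= M)%N -> (M <= N)%N ->
  delta_min x al N <= delta_min x al M.
Proof.
move=> M2 MN; apply: lb_le_inf.
  by exists (dist_int (al * x 1%N - al * x 2%N)), (1%N, 2%N) => //=; split=> //; lia.
move=> _ [[a b] /= [/andP[a1 a2] /andP[b1 b2] ab] <-].
by apply: delta_min_le => //; rewrite ?a1 ?b1/=; [exact: leq_trans a2 MN|exact: leq_trans b2 MN].
Qed.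

Lemma near_powR_ge (a K : R) : 0 < a -> \forall N \near \oo, K <= N%:R `^ a.
Proof.
move=> a0; have [T0 _ HT] := powR_unbounded K a0.
near=> N; apply: HT; near: N; exact: nbhs_infty_ger.
Unshelve. all: by end_near. Qed.

Lemma markov_Int (f : R -> R) (a c : R) : 0 <= a -> 0 < c -> continuous f ->
  (forall t, 0 <= f t) ->
  (@lebesgue_measure R (`[- a, a]%classic `&` [set t | c <= f t])%R <= (Int (- a) a f / c)%R%:E)%E.
Proof.
move=> a0 c0 cf f0; pose B := `[- a, a]%classic `&` [set t | c <= f t].
have mf : measurable_fun setT f by exact: continuous_measurable_fun.
have mB : measurable B.
  apply: measurableI => //.
  have -> : [set t | c <= f t] = f @^-1` `[c, +oo[.
    by apply/seteqP; split => t /=; rewrite in_itv/= andbT.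
  by rewrite -[X in measurable X]setTI; exact: mf.
rewrite EFinM lee_pdivlMr// -(Int_ereal _ _ cf).
apply: (@le_trans _ _ (\int[lebesgue_measure]_(t in B) (f t)%:E)%E); last first.
  apply: ge0_subset_integral => //.
  - by apply/measurable_EFinP; exact: measurable_funTS.
  - by move=> t _; rewrite lee_fin.
  - exact: subIsetl.
rewrite muleC -integral_cst//.
apply: ge0_le_integral => //.
- by move=> t _; rewrite lee_fin ltW.
- by apply/measurable_EFinP; exact: measurable_funTS.
- by move=> t [_ ct]; rewrite lee_fin.
Qed.

Lemma trig_blockN m1 m2 (s : seq nat) (y c : nat -> R) (t : R) :
  trig_block m1 m2 s y c (- t) = trig_block m1 m2 s y c t.
Proof. by apply: eq_bigr => j _; apply: eq_bigr => n _; rewrite mulrN cosN. Qed.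

Lemma Int_even_le (f : R -> R) (a : R) : 0 < a -> continuous f -> (forall t, 0 <= f t) ->
  (forall t, f (- t) = f t) ->
  Int (- a) a f <= 4 * Int 0 (2 * a) (fun t => (1 - t / (2 * a)) * f t).
Proof.
move=> a0 cf f0 fN; have a2 : 0 < 2 * a by rewrite mulr_gt0.
have E : Int (- a) 0 f = Int 0 a f.
  have := @Int_opp R 0 a f (ltW a0) cf; rewrite oppr0 => <-; exact: eq_Int.
have cK : continuous (fun t : R => (1 - t / (2 * a)) * f t).
  by move=> x; apply: cvgM; [exact: continuous_tent|exact: cf].
have cK2 : continuous (fun t : R => 2 * ((1 - t / (2 * a)) * f t)).
  by move=> x; apply: cvgM; [exact: cvg_cst|exact: cK].
rewrite (@Int_split R _ 0)//; [|lra|lra]; rewrite E.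
have h1 : Int 0 a f <= 2 * Int 0 a (fun t => (1 - t / (2 * a)) * f t).
  rewrite -IntZ//; apply: le_Int => // t /andP[t0 ta].
  have : t / (2 * a) <= 1 / 2 by rewrite ler_pdivrMr//; lra.
  by have := f0 t; nra.
have h2 : Int 0 a (fun t => (1 - t / (2 * a)) * f t) <=
    Int 0 (2 * a) (fun t => (1 - t / (2 * a)) * f t).
  rewrite (@Int_split R 0 a (2 * a))//; [|lra|lra].
  rewrite lerDl; apply: Int_ge0 => t /andP[t0 ta]; rewrite mulr_ge0//.
  by rewrite subr_ge0 ler_pdivrMr// mul1r.
lra.
Qed.

End MinimalGap.

(** * Choice of the parameters T and U *)

Section Exponents.
Variable R : realType.
Implicit Types (s : seq nat) (y : nat -> R) (X : R).

Lemma powR_mulD X (a b : R) : 0 < X -> X `^ a * X `^ b = X `^ (a + b).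
Proof. by move=> X0; rewrite powRD// (gt_eqF X0) implybT. Qed.

Lemma pair_count_exponent (p m e th c Y X : R) (D : nat) s y :
  1 <= p -> 0 <= m -> 0 < e -> 0 <= c ->
  (forall D T U s (w : nat -> R),
    (0 < D)%N -> 1 <= T -> 0 < U -> uniq s -> (forall k, 0 <= w k) ->
    close_count D T s w <= c * (D%:R / T) *
      (U * T * (\sum_(k <- s) w k ^+ 2)
       + (U `^ (1 - p) * T `^ (1 + (m + e)) + D%:R) * (\sum_(k <- s) w k) ^+ 2)) ->
  th + (2 - 3 * e - th) * (1 - p) + (2 * th + e) * (m + e) <= - e ->
  1 <= X -> (0 < D)%N -> D%:R <= X `^ th -> 1 <= Y -> D%:R * X `^ e <= Y ->
  uniq s -> (forall n, n \in s -> n%:R <= y n < n.+1%:R) ->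
  (forall n, n \in s -> Y <= n%:R) -> X `^ (2 - 2 * e) <= (size s)%:R ->
  pair_count D s y <= 12 * c * X `^ (- e) * (size s)%:R ^+ 2.
Proof.
move=> p1 m0 e0 c0 Hz HE X1 D0 DX Y1 DY us ys sY sM.
have X0 : 0 < X by lra.
have D1 : 1 <= D%:R :> R by rewrite ler1n.
have D0' : 0 < D%:R :> R by lra.
have Xe : 1 <= X `^ e by rewrite -[leLHS](powRr0 X) ler_powR// ltW.
(* Makes the pole term D^2 / T exactly X^(-e), while the lower bound on Y still gives T <= D Y. *)
pose T := D%:R * (D%:R * X `^ e).
have T1 : 1 <= T by rewrite /T; nra.
have T0 : 0 < T by lra.
have TY : T <= D%:R * Y by rewrite /T ler_wpM2l ?ler0n.
(* Chosen so that the diagonal term obeys D U <= X^(2 - 3e) <= X^(-e) M; the moment term is then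
   what [HE] controls. *)
pose U := X `^ (2 - 3 * e - th); have U0 : 0 < U by rewrite powR_gt0.
have h1 := pair_count_le D0 T0 TY Y1 us ys sY.
set cs := cl_seq T s y in h1; set w := cl_weight T s y in h1.
have w0 k : 0 <= w k by exact: sqrtr_ge0.
have h2 := Hz D T U cs w D0 T1 U0 (undup_uniq _) w0.
rewrite sum_cl_weight_sqr in h2.
have S1 : (\sum_(k <- cs) w k) ^+ 2 <= (size s)%:R ^+ 2.
  by rewrite lerXn2r ?nnegrE ?ler0n ?sumr_ge0// sum_cl_weight_le.
set M : R := (size s)%:R in h2 S1 sM *; set S := _ ^+ 2 in h2 S1.
have S0 : 0 <= S by exact: sqr_ge0.
have M0 : 0 <= M by exact: ler0n.
set V := X `^ (- e); have V0 : 0 < V by rewrite powR_gt0.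
have VXe : V * X `^ e = 1 by rewrite powR_mulD// addNr powRr0.
have a1 : D%:R * U <= V * M.
  apply: (@le_trans _ _ (X `^ th * U)); first by rewrite ler_wpM2r// ltW.
  rewrite /U powR_mulD//; apply: (@le_trans _ _ (V * X `^ (2 - 2 * e))).
    by rewrite /V powR_mulD// ler_powR//; lra.
  by rewrite ler_wpM2l// ltW.
have a2 : D%:R / T * D%:R = V.
  have Xe0 : X `^ e != 0 by rewrite gt_eqF//; lra.
  apply: (mulIf Xe0); rewrite VXe /T; field.
  by rewrite Xe0 gt_eqF.
have a3 : D%:R / T * (U `^ (1 - p) * T `^ (1 + (m + e))) <= V.
  have -> : T `^ (1 + (m + e)) = T * T `^ (m + e) by rewrite -[T `^ (1 + _)]powR_mulD// powRr1// ltW.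
  have -> : D%:R / T * (U `^ (1 - p) * (T * T `^ (m + e))) = D%:R * (U `^ (1 - p) * T `^ (m + e)).
    by field; rewrite gt_eqF.
  have TX : T <= X `^ (2 * th + e).
    have -> : 2 * th + e = th + (th + e) by ring.
    rewrite -!powR_mulD// /T; apply: ler_pM; rewrite ?ler0n ?mulr_ge0 ?ler0n ?powR_ge0//.
    by rewrite ler_wpM2r ?powR_ge0.
  have TX' : T `^ (m + e) <= X `^ ((2 * th + e) * (m + e)).
    rewrite powRrM; apply: ge0_ler_powR; rewrite ?nnegrE ?powR_ge0 ?(ltW T0)//.
    by rewrite addr_ge0// ltW.
  rewrite /U -powRrM; apply: (@le_trans _ _ (X `^ th * (X `^ ((2 - 3 * e - th) * (1 - p)) *
     X `^ ((2 * th + e) * (m + e))))).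
    apply: ler_pM; rewrite ?ler0n ?mulr_ge0 ?powR_ge0//.
    by rewrite ler_wpM2l ?powR_ge0.
  by rewrite !powR_mulD// addrA ler_powR.
have h3 : close_count D T cs w <= 3 * c * V * M ^+ 2.
  apply: le_trans h2 _.
  have -> : c * (D%:R / T) * (U * T * M + (U `^ (1 - p) * T `^ (1 + (m + e)) + D%:R) * S) =
     c * (D%:R * U * M + (D%:R / T * (U `^ (1 - p) * T `^ (1 + (m + e))) + D%:R / T * D%:R) * S).
    by field; rewrite gt_eqF.
  rewrite a2; have -> : 3 * c * V * M ^+ 2 = c * (3 * V * M ^+ 2) by ring.
  rewrite ler_wpM2l//.
  have b1 : D%:R * U * M <= V * M * M by rewrite ler_wpM2r.
  have b2 : (D%:R / T * (U `^ (1 - p) * T `^ (1 + (m + e))) + V) * S <= (2 * V) * M ^+ 2.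
    apply: (@le_trans _ _ (2 * V * S)); first by rewrite ler_wpM2r//; lra.
    by rewrite ler_wpM2l// mulr_ge0// ltW.
  have -> : 3 * V * M ^+ 2 = V * M * M + 2 * V * M ^+ 2 by ring.
  exact: lerD.
by apply: le_trans h1 _; lra.
Qed.

Lemma ln2_ge_half : 1 / 2 <= ln 2 :> R.
Proof.
rewrite -ler_expR lnK ?posrE// -(ler_pXn2r (n := 2)) ?nnegrE ?expR_ge0//.
rewrite -expRM_natl (_ : 2%:R * (1 / 2) = 1); last by field.
by apply: le_trans (expR1_le3 R) _; lra.
Qed.

Lemma ln_le_powR X (e : R) : 1 <= X -> 0 < e -> ln X <= X `^ e / e.
Proof.
move=> X1 e0; rewrite ler_pdivlMr// mulrC -ln_powR.
have P0 : 0 < X `^ e by rewrite powR_gt0//; lra.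
have := @le_ln1Dx R (X `^ e - 1); rewrite addrCA subrr addr0 => H.
by apply: le_trans (H _) _; lra.
Qed.

Lemma dyadic_cover (J : nat) : (0 < J)%N -> exists2 L : nat, (J <= 2 ^ L)%N &
  (forall i, (i < L)%N -> (2 ^ i <= J)%N) /\ L%:R <= 1 + 2 * ln J%:R :> R.
Proof.
move=> J0; exists (trunc_log 2 J).+1; first by apply: ltnW; exact: trunc_log_ltn.
have h : (2 ^ trunc_log 2 J <= J)%N by exact: trunc_logP.
split.
  by move=> i; rewrite ltnS => iL; apply: leq_trans h; rewrite leq_exp2l.
rewrite -natr1 addrC lerD2l.
have : ln (2 ^ trunc_log 2 J)%:R <= ln J%:R :> R.
  by rewrite ler_ln ?posrE ?ltr0n ?expn_gt0// ler_nat.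
rewrite natrX lnXn// -[_ *+ trunc_log 2 J]mulr_natl => H.
have := ler_wpM2l (ler0n R (trunc_log 2 J)) ln2_ge_half; lra.
Qed.

End Exponents.

Section BadSets.
Variable R : realType.
Implicit Types (x : nat -> R) (N : nat).

Lemma powR_le_neg (a b r : R) : 0 < a -> a <= b -> 0 <= r -> b `^ (- r) <= a `^ (- r).
Proof.
move=> a0 ab r0; have b0 : 0 < b by lra.
rewrite !powRN lef_pV2 ?posrE ?powR_gt0//.
by apply: ge0_ler_powR; rewrite ?nnegrE ?(ltW a0) ?(ltW b0).
Qed.

(** The loss eps is spent as eps/2 on shortening the polynomial, eps/4 on the constant 2P, and th d
    = eps/4 on the width of the kernel. *)
Lemma fejer_radius_le (th eps d P z : R) (X : R) : 1 <= X -> 0 < eps -> eps <= th ->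
  d = eps / (4 * th) -> 1 <= P -> 2 * P <= X `^ (eps / 4) ->
  X `^ (th - eps / 2) / (2 * P) <= z -> z `^ (- 1 + d) <= X `^ (- th + eps).
Proof.
move=> X1 e0 eth dE P1 HP Hz; have X0 : 0 < X by lra.
have th0 : 0 < th by lra.
have d0 : 0 < d by rewrite dE divr_gt0// mulr_gt0.
have thd : th * d = eps / 4 by rewrite dE; field; rewrite gt_eqF.
have d1 : d <= 1 by rewrite dE ler_pdivrMr ?mulr_gt0//; lra.
have w0 : 0 < X `^ (th - eps / 2) / (2 * P) by rewrite divr_gt0 ?powR_gt0//; lra.
have -> : - 1 + d = - (1 - d) by ring.
apply: le_trans (powR_le_neg w0 Hz _) _; first by lra.
have P2 : 0 < 2 * P by lra.
rewrite powRN powRM ?powR_ge0 ?invr_ge0 ?(ltW P2)//.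
have -> : (2 * P)^-1 `^ (1 - d) = ((2 * P) `^ (1 - d))^-1.
  by rewrite -powR_inv1 ?(ltW P2)// -powRrM mulN1r powRN.
rewrite -powRrM invfM invrK -powRN mulrC.
have h1 : (2 * P) `^ (1 - d) <= X `^ (eps / 4).
  by apply: le_trans HP; apply: ler1_powR; lra.
apply: le_trans (ler_wpM2r (powR_ge0 _ _) h1) _.
rewrite powR_mulD// ler_powR//.
have : (th - eps / 2) * d <= th * d by rewrite ler_wpM2r ?(ltW d0)//; lra.
by rewrite thd; lra.
Qed.

(** The relation defining th cancels the main terms. What remains is at most 9e (p + 2m) against the
    gain (eps/2)(p + 2m), hence the condition 18e <= eps. *)
Lemma exponent_margin (p m th th' eps e : R) : th' = th - eps / 2 -> 1 <= p -> 0 <= m -> 0 < e -> e <= 1 ->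
  18 * e <= eps -> th <= 2 -> th * (p + 2 * m) = 2 * (p - 1) ->
  th' + (2 - 3 * e - th') * (1 - p) + (2 * th' + e) * (m + e) <= - e.
Proof.
move=> th'E p1 m0 e0 e1 e18 t2 tE.
have E : th' + (2 - 3 * e - th') * (1 - p) + (2 * th' + e) * (m + e) + e =
   e * (3 * (p - 1) + 2 * th' + m + e + 1) - eps / 2 * (p + 2 * m)
   + (th * (p + 2 * m) - 2 * (p - 1)) by rewrite th'E; ring.
have {}tE : th * (p + 2 * m) - 2 * (p - 1) = 0 by rewrite tE subrr.
rewrite tE addr0 in E.
have h1 : e * (3 * (p - 1) + 2 * th' + m + e + 1) <= e * (9 * (p + 2 * m)).
  by rewrite ler_wpM2l ?(ltW e0)// th'E; lra.
have h2 : (9 * e) * (p + 2 * m) <= eps / 2 * (p + 2 * m).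
  by rewrite ler_wpM2r//; lra.
by lra.
Qed.

(** If M < X^(2 - 2e), then M + Y < 3 X^(2 - 2e) and the energy bound gives X^4 / 16 < 3 C X^(4 -
    e), against X^e >= 48 C. *)
Lemma energy_count_ge (M Y E C X e th : R) : 2 <= X -> 0 < e -> th <= 2 - 2 * e ->
  e <= 1 -> 0 <= E -> 1 <= C ->
  (X ^+ 2 / 4) ^+ 2 <= (M + Y) * E -> E <= C * X `^ (2 + e) -> Y <= X `^ th + 1 ->
  48 * C <= X `^ e -> X `^ (2 - 2 * e) <= M.
Proof.
move=> X2 e0 te e1 E0 C1 HE EC HY He; have X0 : 0 < X by lra.
set Z := X `^ (2 - 2 * e).
have X1 : 1 <= X by lra.
have Z1 : 1 <= Z by rewrite /Z -[leLHS](powRr0 X) ler_powR//; lra.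
have YZ : Y <= 2 * Z.
  have : X `^ th <= Z by rewrite /Z ler_powR.
  by lra.
rewrite leNgt; apply/negP => MZ.
have W0 : 0 < X `^ (2 + e) by rewrite powR_gt0.
have ZW : Z * X `^ (2 + e) * X `^ e = X ^+ 4.
  rewrite /Z !powR_mulD// -powR_mulrn ?(ltW X0)//; congr (_ `^ _); ring.
have E1 : (M + Y) * E < 3 * Z * (C * X `^ (2 + e)).
  have MY : M + Y < 3 * Z by lra.
  have [E00|E00] := eqVneq E 0.
    by rewrite E00 mulr0; rewrite !mulr_gt0//; lra.
  have Ep : 0 < E by rewrite lt_neqAle eq_sym E00.
  apply: (@lt_le_trans _ _ (3 * Z * E)); first by rewrite ltr_pM2r.
  by rewrite ler_wpM2l// mulr_ge0//; lra.
have Xe0 : 0 < X `^ e by rewrite powR_gt0.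
have ZW0 : 0 < Z * X `^ (2 + e) by rewrite mulr_gt0//; lra.
have : 48 * C * (Z * X `^ (2 + e)) <= X `^ e * (Z * X `^ (2 + e)).
  by rewrite ler_wpM2r// ltW.
have : X ^+ 4 / 16 < 3 * Z * (C * X `^ (2 + e)).
  by apply: le_lt_trans E1; apply: le_trans HE; rewrite expr_div_n -exprM; lra.
by move: ZW; move: (X `^ (2 + e)) (X `^ e) => w v; lra.
Qed.

End BadSets.

(** * Measure of the bad sets *)

Section BadSets.
Variable R : realType.
Implicit Types (x : nat -> R) (N : nat).

Lemma near_truncn_ge (th P : R) (L0 : nat) : 0 < th -> 0 < P -> \forall N \near \oo,
  [/\ (L0 <= Num.truncn (N%:R `^ th / P))%N, (0 < Num.truncn (N%:R `^ th / P))%N &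
      N%:R `^ th / (2 * P) <= (Num.truncn (N%:R `^ th / P))%:R].
Proof.
move=> th0 P0; near=> N.
have h : (L0%:R + 2) * P <= N%:R `^ th by near: N; exact: near_powR_ge.
have h1 : L0%:R + 2 <= N%:R `^ th / P by rewrite ler_pdivlMr.
have L00 : 0 <= L0%:R :> R by rewrite ler0n.
have z0 : 0 <= N%:R `^ th / P by lra.
have /andP[t1 t2] := truncn_itv z0; rewrite -natr1 in t2.
set z := _ / P in h1 z0 t1 t2 *; set t := Num.truncn z in t1 t2 *.
have zE : N%:R `^ th / (2 * P) = z / 2 by rewrite /z; field; rewrite gt_eqF.
split.
- by rewrite -ltnS -(ltr_nat R) -natr1; lra.
- by rewrite -(ltr_nat R); lra.
- by rewrite zE; lra.
Unshelve. all: by end_near. Qed.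

Lemma trig_block_le (J L : nat) (s : seq nat) (y c : nat -> R) (al : R) :
  (J <= 2 ^ L)%N -> (0 < J)%N -> (forall j, (J <= j)%N -> c j = 0) ->
  (forall n, n \in s -> \sum_(1 <= j < J) c j * cos (2 * pi * j%:R * (al * y n)) <= - (1 / 4)) ->
  trig_block 1 (2 ^ L) s y c al <= - ((size s)%:R / 4).
Proof.
move=> JL J0 cJ H; rewrite /trig_block exchange_big/=.
have -> : - ((size s)%:R / 4) = \sum_(n <- s) - (1 / 4) :> R.
  elim: (s) => [|n r IH]; first by rewrite big_nil /= mul0r oppr0.
  by rewrite big_cons -IH /= -natr1; ring.
rewrite big_seq [leRHS]big_seq; apply: ler_sum => n ns.
apply: le_trans (H n ns); rewrite le_eqVlt; apply/orP; left; apply/eqP.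
rewrite (big_cat_nat (n := J))//= [X in _ + X]big_nat [X in _ + X]big1; last first.
  by move=> j /andP[Jj _]; rewrite cJ// mul0r.
rewrite addr0; apply: eq_bigr => j _; congr (_ * cos _); ring.
Qed.

(** The number of dyadic blocks enters squared; at X^(e/4) each it costs X^(e/2), half of the gain
    X^(-e). *)
Lemma ln_cover_le (X e th : R) (J : nat) : 1 <= X -> 0 < e -> th <= 2 ->
  (0 < J)%N -> J%:R <= X `^ th -> 1 + 2 * ln J%:R <= (1 + 16 / e) * X `^ (e / 4).
Proof.
move=> X1 e0 th2 J0 JX; have X0 : 0 < X by lra.
have lnJ : ln J%:R <= th * ln X.
  have pJ : J%:R \is @Num.pos R by rewrite posrE ltr0n.
  have pX : X `^ th \is Num.pos by rewrite posrE powR_gt0.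
  by rewrite -(ln_powR X th) (ler_ln pJ pX).
have e4 : 0 < e / 4 by rewrite divr_gt0.
have lnX := ln_le_powR X1 e4.
have Xe4 : 1 <= X `^ (e / 4) by rewrite -[leLHS](powRr0 X) ler_powR// ltW.
have lnX0 : 0 <= ln X by exact: ln_ge0.
have h1 : th * ln X <= 2 * ln X by rewrite ler_wpM2r.
have h2 : X `^ (e / 4) / (e / 4) = 4 / e * X `^ (e / 4) by field; rewrite gt_eqF.
rewrite h2 in lnX.
have -> : (1 + 16 / e) * X `^ (e / 4) = X `^ (e / 4) + 4 * (4 / e * X `^ (e / 4)) by ring.
lra.
Qed.

Lemma bad_sets x (th eps a p m e c : R) :
  (forall a b, (a < b)%N -> x a.+1 < x b.+1) ->
  (exists C : R, forall N, (1 <= N)%N -> (add_energy x N)%:R <= C * (N%:R `^ (2 + e))) ->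
  0 <= c ->
  (forall D T U s (w : nat -> R),
    (0 < D)%N -> 1 <= T -> 0 < U -> uniq s -> (forall k, 0 <= w k) ->
    close_count D T s w <= c * (D%:R / T) *
      (U * T * (\sum_(k <- s) w k ^+ 2)
       + (U `^ (1 - p) * T `^ (1 + (m + e)) + D%:R) * (\sum_(k <- s) w k) ^+ 2)) ->
  1 <= p -> 0 <= m -> 0 < e -> e <= 1 -> 18 * e <= eps -> eps <= th -> th <= 2 - 2 * e ->
  th * (p + 2 * m) = 2 * (p - 1) -> 1 <= a ->
  exists C g : R, 0 < g /\ \forall N \near \oo, exists B : set R,
    [/\ measurable B, (@lebesgue_measure R B <= (C * N%:R `^ (- g))%:E)%E &
      forall al, - a <= al <= a -> N%:R `^ (- th + eps) <= delta_min x al N -> B al].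
Proof.
move=> xinc [CE HE] c0 Hz p1 m0 e0 e1 e18 eth te thE a1.
have eps0 : 0 < eps by lra.
have th0 : 0 < th by lra.
have th2 : th <= 2 by lra.
have a0 : 0 < a by lra.
pose th' := th - eps / 2; have th'0 : 0 < th' by rewrite /th'; lra.
have th'e : th' + e <= th by rewrite /th'; lra.
have th'2 : th' <= 2 by lra.
have a2 : 1 <= 2 * a by lra.
pose d := eps / (4 * th); have d0 : 0 < d by rewrite divr_gt0// mulr_gt0.
have [P [L0 [P0 HK]]] := fejer_kernel d0.
have P0' : 0 < P%:R :> R by rewrite ltr0n.
have P1 : 1 <= P%:R :> R by rewrite ler1n.
pose C' : R := `|CE| + 1; have C'1 : 1 <= C' by rewrite lerDr.
pose K : R := 1 + 16 / e; have K0 : 0 <= K by rewrite addr_ge0// divr_ge0// ltW.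
(* The factor 64 is 4, for passing to a tent on [0, 2a], times 16 from (M/4)^2; 64 a is 32 (2a) from
   the sieve. *)
pose CC : R := 64 * (64 * a * (12 * c) * K ^+ 2).
exists CC, (e / 2); split; first by rewrite divr_gt0.
near=> N.
have N2 : (2 <= N)%N by near: N; exists 2%N.
have LLL : [/\ (L0 <= Num.truncn (N%:R `^ th' / P%:R))%N,
    (0 < Num.truncn (N%:R `^ th' / P%:R))%N &
    N%:R `^ th' / (2 * P%:R) <= (Num.truncn (N%:R `^ th' / P%:R))%:R].
  by near: N; apply: near_truncn_ge.
have XP0 : 2 * P%:R <= N%:R `^ (eps / 4) by near: N; apply: near_powR_ge; rewrite divr_gt0.
have XC0 : 48 * C' <= N%:R `^ e by near: N; exact: near_powR_ge.
set X : R := N%:R in LLL XP0 XC0 *.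
have XP := XP0; have XC := XC0; have [LL Lpos Lz] := LLL.
have X2 : 2 <= X by rewrite ler_nat.
have X0 : 0 < X by exact: lt_le_trans X2.
have X1 : 1 <= X by apply: le_trans X2; rewrite ler1n.
set L := Num.truncn _ in LL Lpos Lz.
have [ck [ck01 ckJ Hck]] := HK L LL Lpos.
pose J := (P * L)%N; have J0 : (0 < J)%N by rewrite muln_gt0 P0.
have JX : J%:R <= X `^ th'.
  have z0 : 0 <= X `^ th' / P%:R by rewrite divr_ge0 ?powR_ge0// ltW.
  have /andP[t1 _] := truncn_itv z0; rewrite -/L in t1.
  by rewrite natrM mulrC -ler_pdivlMr.
have [Lx JL [LxJ Lxle]] := @dyadic_cover R J J0.
pose Y := (Num.truncn (X `^ th)).+1.
have YX : X `^ th <= Y%:R by apply: ltW; exact: truncnS_gt.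
have YX' : Y%:R <= X `^ th + 1.
  have /andP[t1 _] := truncn_itv (powR_ge0 X th).
  by rewrite -natr1 lerD2r.
have [s [y [us y0 sy HM]]] := select_gaps xinc Y N2.
set M : R := (size s)%:R in HM.
have E0 : 0 <= (add_energy x N)%:R :> R by exact: ler0n.
have EC : (add_energy x N)%:R <= C' * X `^ (2 + e).
  apply: le_trans (HE N _) _; first exact: ltnW.
  by rewrite ler_wpM2r ?powR_ge0// /C'; apply: le_trans (ler_norm CE) _; rewrite lerDl.
have XM : X `^ (2 - 2 * e) <= M.
  exact: (energy_count_ge X2 e0 te e1 E0 C'1 HM EC YX' XC).
have M0 : 0 < M by apply: lt_le_trans XM; exact: powR_gt0.
have Xe0 : 0 < X `^ (- e) by exact: powR_gt0.
have HD i : (i < Lx)%N -> pair_count (2 ^ i) s y <= 12 * c * X `^ (- e) * M ^+ 2.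
  move=> iL; have DX : (2 ^ i)%:R <= X `^ th'.
    by apply: le_trans JX; rewrite ler_nat; exact: LxJ.
  apply: (@pair_count_exponent R p m e th' c Y%:R X) => //.
  - by apply: (@exponent_margin R p m th th' eps e).
  - by rewrite expn_gt0.
  - by rewrite ler1n.
  - apply: le_trans YX; apply: (@le_trans _ _ (X `^ th' * X `^ e)).
      by rewrite ler_wpM2r ?powR_ge0.
    by rewrite powR_mulD// ler_powR.
  - by move=> n /sy[].
  - by move=> n /sy[Yn _ _]; rewrite ler_nat.
pose f t := trig_block 1 (2 ^ Lx) s y ck t ^+ 2.
have cf : continuous f by move=> t; apply: cvgM; exact: continuous_trig_block.
have f0 t : 0 <= f t by exact: sqr_ge0.
have fN t : f (- t) = f t by rewrite /f trig_blockN.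
have M4 : 0 < (M / 4) ^+ 2 by rewrite exprn_gt0// divr_gt0.
(* A superlevel set of a continuous function, hence measurable; it contains the alpha in [-a, a]
   with a large minimal gap. *)
exists (`[- a, a]%classic `&` [set t | (M / 4) ^+ 2 <= f t]); split.
- apply: measurableI => //.
  have -> : [set t | (M / 4) ^+ 2 <= f t] = f @^-1` `[(M / 4) ^+ 2, +oo[.
    by apply/seteqP; split => t /=; rewrite in_itv/= andbT.
  have mf : measurable_fun setT f by exact: continuous_measurable_fun.
  by rewrite -[X in measurable X]setTI; exact: mf.
- apply: le_trans (markov_Int (ltW a0) M4 cf f0) _; rewrite lee_fin.
  rewrite ler_pdivrMr//; apply: le_trans (Int_even_le a0 cf f0 fN) _.
  have hS := dyadic_sieve Lx s a2 y0 ck01.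
  have hP : \sum_(0 <= i < Lx) pair_count (2 ^ i) s y <= Lx%:R * (12 * c * X `^ (- e) * M ^+ 2).
    have -> : Lx%:R * (12 * c * X `^ (- e) * M ^+ 2) =
      \sum_(0 <= i < Lx) 12 * c * X `^ (- e) * M ^+ 2.
      by rewrite sumr_const_nat subn0 [LHS]mulr_natl.
    by rewrite big_nat [leRHS]big_nat; apply: ler_sum => i; exact: HD.
  have hL : Lx%:R <= K * X `^ (e / 4).
    apply: le_trans Lxle _; rewrite /K.
    by apply: ln_cover_le X1 e0 th'2 J0 JX.
  have hL2 : Lx%:R ^+ 2 <= K ^+ 2 * X `^ (e / 2).
    have -> : X `^ (e / 2) = (X `^ (e / 4)) ^+ 2.
      by rewrite expr2 powR_mulD//; congr (_ `^ _); field.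
    by rewrite -exprMn lerXn2r ?nnegrE ?ler0n// mulr_ge0 ?powR_ge0.
  have hX : X `^ (e / 2) * X `^ (- e) = X `^ (- (e / 2)).
    by rewrite powR_mulD//; congr (_ `^ _); field.
  have q0 : 0 <= 32 * (2 * a) * Lx%:R by rewrite !mulr_ge0// ?ler0n// ltW.
  have h3 := le_trans hS (ler_wpM2l q0 hP).
  apply: le_trans (ler_wpM2l _ h3) _; first by rewrite ler0n.
  have -> : 4 * (32 * (2 * a) * Lx%:R * (Lx%:R * (12 * c * X `^ (- e) * M ^+ 2))) =
     (4 * (64 * a * (12 * c))) * M ^+ 2 * X `^ (- e) * Lx%:R ^+ 2 by ring.
  have q1 : 0 <= (4 * (64 * a * (12 * c))) * M ^+ 2 * X `^ (- e).
    apply: mulr_ge0; last exact: ltW.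
    by apply: mulr_ge0; rewrite ?sqr_ge0// !mulr_ge0 ?ler0n ?(ltW a0).
  apply: le_trans (ler_wpM2l q1 hL2) _.
  rewrite le_eqVlt; apply/orP; left; apply/eqP; rewrite -hX /CC.
  by move: (12 * c) (64 * a) => u v; field.
move=> al /andP[al1 al2] Hd; split; first by rewrite /= in_itv/= al1 al2.
have Hn n : n \in s -> \sum_(1 <= j < J) ck j * cos (2 * pi * j%:R * (al * y n)) <= - (1 / 4).
  move=> /sy[_ _ [a' [b' [b1 ba aN yE]]]]; apply: Hck => k.
  apply: le_trans (fejer_radius_le X1 eps0 eth erefl P1 XP Lz) _.
  apply: le_trans Hd _; rewrite yE mulrBr; apply: le_trans (dist_int_le _ k).
  apply: delta_min_le.
  - by rewrite aN (leq_trans b1 (ltnW ba)).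
  - by rewrite b1 (leq_trans (ltnW ba) aN).
  - by move=> ab; rewrite ab ltnn in ba.
have G := trig_block_le JL J0 ckJ Hn.
rewrite /= /f -[leRHS]sqrrN; apply: lerXn2r; rewrite ?nnegrE.
- by rewrite divr_ge0// ltW.
- by rewrite oppr_ge0; apply: le_trans G _; rewrite oppr_le0 divr_ge0// ltW.
- by rewrite lerNr.
Unshelve. all: by end_near. Qed.

End BadSets.

(** * Borel-Cantelli *)

Section Assembly.
Variable R : realType.
Implicit Types (x : nat -> R) (N : nat).
Local Notation mu := (@lebesgue_measure R).

Lemma borel_cantelli_geometric (F : nat -> set R) (C q : R) :
  (forall i, measurable (F i)) -> 0 <= C -> 0 <= q < 1 ->
  (forall i, (mu (F i) <= (C * q ^+ i)%:E)%E) -> mu (lim_sup_set F) = 0%E.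
Proof.
move=> mF C0 /andP[q0 q1] H; apply: lim_sup_set_cvg0 => //.
have q1' : 0 < 1 - q by lra.
apply: (@le_lt_trans _ _ (C / (1 - q))%:E); last exact: ltry.
apply: lime_le; first by apply: is_cvg_nneseries => *; exact: measure_ge0.
suff S n : (\sum_(0 <= i < n) mu (F i) <= (C / (1 - q) * (1 - q ^+ n))%:E)%E.
  apply: nearW => n; apply: le_trans (S n) _; rewrite lee_fin ler_piMr//.
  - by rewrite divr_ge0// ltW.
  - by rewrite gerBl exprn_ge0.
elim: n => [|n IH]; first by rewrite big_nil expr0 subrr mulr0.
rewrite big_nat_recr//=; apply: le_trans (leeD IH (H n)) _.
rewrite -EFinD lee_fin le_eqVlt; apply/orP; left; apply/eqP.
by rewrite exprS; field; rewrite gt_eqF.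
Qed.

(** By monotonicity N inherits the bound at the power of 2 below it; the resulting constant, at most
    2^th, is absorbed by the second [eps]. *)
Lemma delta_min_dyadic x (al th eps : R) : 0 < eps -> eps <= th ->
  (\forall i \near \oo, delta_min x al (2 ^ i) < (2 ^ i)%:R `^ (- th + eps)) ->
  \forall N \near \oo, delta_min x al N < N%:R `^ (- th + 2 * eps).
Proof.
move=> e0 eth [i0 _ Hi]; near=> N.
have N0 : (2 ^ i0.+1 <= N)%N by near: N; exact: nbhs_infty_ge.
have hN : 2 `^ th <= N%:R `^ eps by near: N; exact: near_powR_ge.
have Npos : (0 < N)%N by apply: leq_trans N0; rewrite expn_gt0.
pose i := trunc_log 2 N.
have h1 : (2 ^ i <= N)%N by exact: trunc_logP.
have h2 : (N < 2 ^ i.+1)%N by exact: trunc_log_ltn.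
have ii : (i0 < i)%N.
  by rewrite -ltnS -(ltn_exp2l _ _ (isT : (1 < 2)%N)); apply: leq_ltn_trans h2.
have i2 : (2 <= 2 ^ i)%N.
  by rewrite -[X in (X <= _)%N]expn1 leq_exp2l//; exact: leq_ltn_trans ii.
apply: le_lt_trans (delta_min_mono _ _ i2 h1) _.
apply: lt_le_trans (Hi i (ltnW ii)) _.
have X0 : 0 < N%:R :> R by rewrite ltr0n.
have h3 : N%:R / 2 <= (2 ^ i)%:R :> R.
  by rewrite ler_pdivrMr// -natrM ler_nat -expnSr ltnW.
have te : 0 <= th - eps by rewrite subr_ge0.
have -> : - th + eps = - (th - eps) by ring.
apply: le_trans (powR_le_neg _ h3 te) _; first by rewrite divr_gt0.
rewrite powRM ?invr_ge0 ?ler0n// -powR_inv1 ?ler0n// -powRrM.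
have -> : N%:R `^ (- th + 2 * eps) = N%:R `^ (- (th - eps)) * N%:R `^ eps.
  by rewrite powR_mulD//; congr (_ `^ _); ring.
rewrite ler_wpM2l ?powR_ge0//; apply: le_trans hN.
by rewrite ler_powR ?ler1n//; lra.
Unshelve. all: by end_near. Qed.

Lemma exponent_rate (u : nat -> R) (th : R) : (forall N, (2 <= N)%N -> 0 <= u N) ->
  (forall eps : R, 0 < eps -> \forall N \near \oo, u N < N%:R `^ (- th + eps)) ->
  exists f : nat -> R, f @ \oo --> 0 /\
    \forall N \near \oo, u N < N%:R `^ (- (th - f N)).
Proof.
move=> u0 H.
(* The actual excess of the exponent of u N over -th, cut off at 0. Adding 1/(N + 1) makes the final
   inequality strict; where u N = 0 the logarithm carries no information. *)
pose g N : R := if u N == 0 then 0 else Num.max 0 (th + ln (u N) / ln N%:R).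
exists (fun N => g N + N.+1%:R^-1); split.
  apply/cvgrPdist_lt => e e0; near=> N.
  have hu : u N < N%:R `^ (- th + e / 2) by near: N; apply: H; rewrite divr_gt0.
  have hN : N.+1%:R^-1 < e / 2.
    near: N; have : (fun n => n.+1%:R^-1 : R) @ \oo --> 0 by exact: cvg_harmonic.
    move/cvgrPdist_lt => /(_ (e / 2)); rewrite divr_gt0// => /(_ isT).
    by apply: filterS => n; rewrite sub0r normrN ger0_norm ?invr_ge0 ?ler0n.
  have N2 : (2 <= N)%N by near: N; exact: nbhs_infty_ge.
  have lnN : 0 < ln N%:R :> R by rewrite ln_gt0// ltr1n.
  have i0 : 0 < N.+1%:R^-1 :> R by rewrite invr_gt0 ltr0n.
  have g0 : 0 <= g N by rewrite /g; case: ifP => // _; rewrite le_max lexx.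
  have ge : g N <= e / 2.
    rewrite /g; case: eqP => [_|/eqP un0]; first by rewrite divr_ge0// ltW.
    have up : 0 < u N by rewrite lt0r un0 u0.
    have lu : ln (u N) < (- th + e / 2) * ln N%:R.
      by rewrite -ln_powR ltr_ln// posrE powR_gt0// ltr0n; exact: leq_trans N2.
    have : ln (u N) / ln N%:R < - th + e / 2 by rewrite ltr_pdivrMr.
    by rewrite ge_max => ?; apply/andP; split; lra.
  rewrite sub0r normrN ger0_norm ?addr_ge0 ?(ltW i0)//.
  by move: hN ge; move: (_^-1) (g N) => v w; lra.
near=> N.
have N2 : (2 <= N)%N by near: N; exact: nbhs_infty_ge.
have N1 : 1 < N%:R :> R by rewrite ltr1n.
have X0 : 0 < N%:R :> R by lra.
have lnN : 0 < ln N%:R :> R by rewrite ln_gt0.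
have i0 : 0 < N.+1%:R^-1 :> R by rewrite invr_gt0 ltr0n.
rewrite /g; case: eqP => [->|/eqP un0]; first exact: powR_gt0.
have up : 0 < u N by rewrite lt0r un0 u0.
have uE : u N = N%:R `^ (ln (u N) / ln N%:R).
  by rewrite /powR (gt_eqF X0) divfK ?gt_eqF// lnK// posrE.
rewrite [ltLHS]uE /powR (gt_eqF X0) ltr_expR ltr_pM2r//.
have : th + ln (u N) / ln N%:R <= Num.max 0 (th + ln (u N) / ln N%:R) by rewrite le_max lexx orbT.
by move: i0; move: (Num.max _ _) (_^-1) => v w; lra.
Unshelve. all: by end_near. Qed.

(** Ranges |alpha| <= k + 1 and losses tending to 0 are indexed by integers, so one null set serves
    all alpha and all eps. *)
Lemma ae_small_gaps x (th : R) : 0 < th ->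
  (forall a eps : R, 1 <= a -> 0 < eps -> eps <= th ->
    exists C g : R, 0 < g /\ \forall N \near \oo, exists B : set R,
    [/\ measurable B, (mu B <= (C * N%:R `^ (- g))%:E)%E &
      forall al : R, - a <= al <= a -> N%:R `^ (- th + eps) <= delta_min x al N -> B al]) ->
  {ae mu, forall al, forall eps : R, 0 < eps ->
     \forall N \near \oo, delta_min x al N < N%:R `^ (- th + eps)}.
Proof.
move=> th0 H.
pose eps_ r : R := Num.min (r.+1%:R^-1) th.
have eps0 r : 0 < eps_ r by rewrite lt_min th0 invr_gt0 ltr0n.
have epsth r : eps_ r <= th by rewrite ge_min lexx orbT.
suff : {ae mu, forall al, forall k r : nat, - k.+1%:R <= al <= k.+1%:R ->
     \forall N \near \oo, delta_min x al N < N%:R `^ (- th + 2 * eps_ r)}.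
  apply: (@filterS _ _ (ae_filter_ringOfSetsType mu)) => al Hal eps e0.
  have [k hk] : exists k : nat, `|al| <= k.+1%:R.
    by exists (Num.truncn `|al|); apply: ltW; exact: truncnS_gt.
  have [r hr] : exists r : nat, 2 * eps_ r <= eps.
    exists (Num.truncn (2 / eps)).
    have h : 2 / eps < (Num.truncn (2 / eps)).+1%:R by exact: truncnS_gt.
    apply: (@le_trans _ _ (2 * (Num.truncn (2 / eps)).+1%:R^-1)).
      by rewrite ler_pM2l// ge_min lexx.
    by rewrite ler_pdivrMr ?ltr0n// mulrC -ler_pdivrMr// ltW.
  have {}Hal := Hal k r (_ : - k.+1%:R <= al <= k.+1%:R).
  have : \forall N \near \oo, delta_min x al N < N%:R `^ (- th + 2 * eps_ r).
    by apply: Hal; rewrite -ler_norml.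
  move=> Hn; near=> N; have N1 : (1 <= N)%N by near: N; exact: nbhs_infty_ge.
  have hN : delta_min x al N < N%:R `^ (- th + 2 * eps_ r) by near: N.
  by apply: lt_le_trans hN _; rewrite ler_powR ?ler1n// lerD2l.
apply: ae_foralln => k; apply: ae_foralln => r.
set a : R := k.+1%:R; have a1 : 1 <= a by rewrite ler1n.
have [C [g [g0 [N0 _ HB]]]] := H a (eps_ r) a1 (eps0 r) (epsth r).
(* Below the threshold [N0] the set is empty, which leaves the limit superior unchanged and makes
   the geometric bound hold for every i. *)
have /choice[B HBi] i : exists Bi : set R, [/\ measurable Bi,
    (mu Bi <= (`|C| * (2 `^ (- g)) ^+ i)%:E)%E &
    (N0 <= i)%N -> forall al : R, - a <= al <= a ->
      (2 ^ i)%:R `^ (- th + eps_ r) <= delta_min x al (2 ^ i) -> Bi al].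
  case: (leqP N0 i) => Ni; last first.
    exists set0; split; first exact: measurable0.
    + rewrite measure0 lee_fin; apply: mulr_ge0; first exact: normr_ge0.
      by apply: exprn_ge0; exact: powR_ge0.
    + by [].
  have N0i : (N0 <= 2 ^ i)%N by apply: leq_trans Ni _; exact: ltnW (ltn_expl _ _).
  have [D [mD DC HD]] := HB _ N0i; exists D.
  have E : (2 ^ i)%:R `^ (- g) = (2 `^ (- g)) ^+ i :> R.
    by rewrite natrX -(powR_mulrn _ (ler0n R 2)) -(powR_mulrn _ (powR_ge0 _ _)) -!powRrM mulrC.
  split=> [//||_]; last exact: HD.
  apply: le_trans DC _; rewrite lee_fin E; apply: ler_wpM2r (ler_norm C).
  by apply: exprn_ge0; exact: powR_ge0.
exists (lim_sup_set B); split.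
- apply: bigcap_measurable => // n _; apply: bigcup_measurable => j _.
  by have [] := HBi j.
- apply: (@borel_cantelli_geometric B `|C| (2 `^ (- g))) => //.
  + by move=> i; have [] := HBi i.
  + rewrite powR_ge0/= powRN invf_lt1 ?powR_gt0//.
    by rewrite -[ltLHS](powRr0 2) /powR gt_eqF// ltr_expR ltr_pM2r// ln_gt0// ltr1n.
  + by move=> i; have [] := HBi i.
move=> al /= /not_implyP[ala Hal]; apply: contrapT => nB; apply: Hal.
apply: delta_min_dyadic => //.
move/existsNP: nB => [n /not_implyP[_ nB]].
exists (maxn n N0) => // i /=; rewrite geq_max => /andP[ni Ni].
rewrite ltNge; apply/negP => hd; apply: nB; exists i => //.
by have [_ _] := HBi i; apply.
Unshelve. all: by end_near. Qed.

End Assembly.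

Theorem theorem4 (R : realType) (x : nat -> R) (c kappa m : R) :
  (forall n, (1 <= n)%N -> 0 < x n) ->
  0 < c ->
  (forall n, (1 <= n)%N -> c <= x n.+1 - x n) ->
  (forall eps : R, 0 < eps -> exists C : R, forall N : nat, (1 <= N)%N ->
     (add_energy x N)%:R <= C * (N%:R `^ (2 + eps))) ->
  2 <= kappa ->
  (forall eps : R, 0 < eps -> exists C T0 : R, forall T : R, T0 <= T -> 0 < T ->
     ((T^-1)%:E * \int[lebesgue_measure]_(t in `[0%R, T]%classic) ((zeta_crit_abs t) `^ kappa)%:E
       <= (C * T `^ (m + eps))%:E)%E) ->
  {ae (@lebesgue_measure R), forall alpha : R,
     exists f : nat -> R, f @ \oo --> 0 /\
       \forall N \near \oo,
         delta_min x alpha N <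
           N%:R `^ (- ((2 * kappa - 4) / (kappa + 4 * m) - f N))}.
Proof.
move=> _ c0 gap HE k2 Hz; set th := _ / _.
have m0 := moment_exponent_ge0 k2 Hz.
(* Covers kappa = 2, where th = 0: the minimal gap is at most 1/2 while the right-hand side is at
   least 1. *)
case: (lerP th 0) => th0.
  apply: aeW => al; exists (fun=> 0); split; first exact: cvg_cst.
  near=> N; have N2 : (2 <= N)%N by near: N; exact: nbhs_infty_ge.
  apply: (@le_lt_trans _ _ (1 / 2)); first exact: delta_min_le_half.
  apply: (@lt_le_trans _ _ 1); first by lra.
  rewrite subr0 -[leLHS](powRr0 N%:R) ler_powR ?oppr_ge0//.
  by rewrite ler1n; exact: ltnW.
have km0 : 0 < kappa + 4 * m by lra.
have k0 : 2 < kappa.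
  by move: th0; rewrite /th pmulr_lgt0 ?invr_gt0// => ?; lra.
have thE : th * (kappa / 2 + 2 * m) = 2 * (kappa / 2 - 1).
  by rewrite /th; field; rewrite gt_eqF.
have th2 : th < 2 by rewrite /th ltr_pdivrMr//; lra.
apply: (@filterS _ _ (ae_filter_ringOfSetsType (@lebesgue_measure R))) (ae_small_gaps th0 _) => [al Hal|].
  have [|f [f0 Hf]] := @exponent_rate R (delta_min x al) th _ Hal; last by exists f.
  by move=> N; exact: delta_min_ge0.
move=> a eps a1 eps0 epsth.
(* The bound eps/18 pays for the exponent margin, and (2 - th)/2 ensures that dropping the cells
   below X^th loses few of them. *)
pose e := Num.min 1 (Num.min (eps / 18) ((2 - th) / 2)).
have e0 : 0 < e by rewrite !lt_min ltr01 !divr_gt0// subr_gt0.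
have e1 : e <= 1 by rewrite ge_min lexx.
have e18 : 18 * e <= eps.
  have : e <= eps / 18 by rewrite !ge_min lexx orbT.
  by lra.
have te : th <= 2 - 2 * e.
  have : e <= (2 - th) / 2 by rewrite !ge_min lexx !orbT.
  by lra.
have p1 : 1 <= kappa / 2 by lra.
have b0 : 0 <= 1 + (m + e) by lra.
have kp : 0 < kappa by lra.
have [cz cz0 Hcz] := moment_bound kp b0 (Hz e e0).
have [cc cc0 Hcc] := zeta_count p1 b0 cz0 Hcz.
exact: (bad_sets (increasing_of_gap c0 gap) (HE e e0) cc0 Hcc p1 m0 e0 e1 e18 epsth te thE a1).
Unshelve. all: by end_near. Qed.
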